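(* Let $(W,S)$ be a finite Coxeter system. Let $v,w\in W$ be such that $v\leq w$. Then \[ x_{w/v}=\bar{\mathscr S}\bigl(x_{vw_o/ww_o}\bigr) \] in $\mathscr B_W$. In particular, $x_{w/v}$ is a positive element of $\mathscr B_W$, i.e. $x_{w/v}\in\mathscr B_W^{\geq 0}$.
   Context: Coxeter setup. $(W,S)$ is a Coxeter system with $W$ finite; $m(s,s')$ is the order of $ss'$. $\mathfrak h_{\mathbb R}$ is a real vector space with basis $\Delta$ (the simple roots), in bijection with $S$ via $\beta\mapsto s_\beta$, with symmetric bilinear form $B(\beta,\beta')=-\cos(\pi/m(s_\beta,s_{\beta'}))$. $W$ acts by $s_\beta(x)=x-2B(x,\beta)\beta$. $R=\{u(\beta):u\in W,\beta\in\Delta\}$ is the root system, $R^+$ the set of roots that are nonnegative linear combinations of $\Delta$. For $\alpha=u(\beta)\in R$, $s_\alpha=us_\beta u^{-1}$. $\leq$ is the (strong) Bruhat order, $w_o$ the longest element of $W$. Nichols algebra $\mathscr B_W$. $V_W$ is the complex vector space spanned by symbols $x_\alpha$ ($\alpha\in R$) modulo $x_{-\alpha}=-x_\alpha$; $\{x_\alpha:\alpha\in R^+\}$ is a basis. $W$ acts by $ux_\alpha=x_{u(\alpha)}$, and $V_W$ is $W$-graded with $x_\alpha$ of degree $s_\alpha$. The braiding is $\Psi(x_\alpha\otimes y)=s_\alpha y\otimes x_\alpha$ on $V_W^{\otimes 2}$. For $\sigma$ in the symmetric group $\mathbb S_m$ with reduced expression $s_{i_1}\cdots s_{i_k}$,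 $\Psi_\sigma=\Psi_{i_1}\cdots\Psi_{i_k}$ on $V_W^{\otimes m}$, where $\Psi_i$ is $\Psi$ applied to factors $i,i+1$; the braided factorial is $[m]!=\sum_{\sigma\in\mathbb S_m}\Psi_\sigma$. $\mathscr B_W=T(V_W)/\bigoplus_m\ker[m]!$. The tensor algebra $T(V_W)$, with multiplicatively extended $W$-action and $W$-grading, is a braided Hopf algebra: $\Delta$ is the algebra homomorphism to $T(V_W)\otimes T(V_W)$ with twisted multiplication $(a\otimes b)(c\otimes d)=a(gc)\otimes bd$'s braided form, i.e. for $b$ of $W$-degree $g$, $(a\otimes b)\cdot(c\otimes d)=a(gc)\otimes bd$, and $\Delta(x)=x\otimes1+1\otimes x$ for $x\in V_W$. This structure, the $W$-action, the $W$-grading and the $\mathbb Z_{\geq0}$-grading descend to $\mathscr B_W$. Elements. For $w\in W$ with reduced expression $s_{\beta_1}\cdots s_{\beta_\ell}$, $x_w=x_{\beta_1}\cdots x_{\beta_\ell}\in\mathscr B_W$ (well defined; the $x_w$, $w\in W$, are linearly independent). The elements $x_{w/v}\in\mathscr B_W$ for $v\leq w$ are uniquely determined by $\Delta(x_w)=\sum_{v\leq w}x_{w/v}\otimes x_v$; $x_{w/v}=0$ if $v\not\leq w$. The map $\bar{\mathscr S}:\mathscr B_W\to\mathscr B_W$ is linear, defined by $\bar{\mathscr S}(x)=(-1)^m\rho(\mathscr S(x))$ for $x$ of $\mathbb Z_{\geq0}$-degree $m$, where $\mathscr S$ is the braided antipode (determined by $\mathscr S(x)=-x$ on $V_W$)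 and $\rho$ is the anti-algebra involution with $\rho(x_\alpha)=x_\alpha$; explicitly $\bar{\mathscr S}(x_{\alpha_1}\cdots x_{\alpha_m})=x_{\alpha_1}(s_{\alpha_1}x_{\alpha_2})\cdots(s_{\alpha_1}\cdots s_{\alpha_{m-1}}x_{\alpha_m})$ for $\alpha_i\in R$. Positivity. $\mathscr B_W^{\geq0}$ is the $\mathbb Z_{\geq0}$-span of all monomials $x_{\alpha_1}\cdots x_{\alpha_m}$ with $m\geq0$, $\alpha_i\in R^+$; its elements are called positive. *)

(* Defs.v *)
From HB Require Import structures.
From mathcomp Require Import all_boot all_order all_algebra all_fingroup.
From mathcomp Require Import finmap boolp classical_sets reals trigo.
From mathcomp Require Import complex xfinmap monalg.

Set Implicit Arguments.
Unset Strict Implicit.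
Unset Printing Implicit Defensive.

Import Order.TTheory GRing.Theory Num.Theory.
Import BigEnoughFSet.

Local Open Scope ring_scope.
Local Open Scope quotient_scope.

Section Words.

Variables (gT : finGroupType) (n : nat) (gen : 'I_n -> gT).

Definition reduced_word (g : gT) (s : seq 'I_n) : Prop :=
  (\prod_(i <- s) gen i)%g = g /\
  forall s' : seq 'I_n, (\prod_(i <- s') gen i)%g = g -> (size s <= size s')%N.

(* A fixed reduced word of g; it exists as soon as gen generates gT.          *)
Definition redword (g : gT) : seq 'I_n :=
  xget [::] [set s | reduced_word g s]%classic.

End Words.

Section LinearExtension.

Variables (K : choiceType) (F : nzRingType) (M : lmodType F) (f : K -> M).

Definition mlin (t : {malg F[K]}) : M := \sum_(k <- msupp t) t@_k *: f k.

Lemma mlinEw (d : {fset K}) (t : {malg F[K]}) :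
  (msupp t `<=` d)%fset -> mlin t = \sum_(k <- d) t@_k *: f k.
Proof.
move=> le; rewrite [LHS](big_fset_incl _ le) => //= x xd /mcoeff_outdom ->.
by rewrite scale0r.
Qed.

Lemma mlin_is_linear : linear mlin.
Proof.
move=> c t1 t2 /=; pose_big_fset K E; rewrite 3?(mlinEw (d := E)) //.
  rewrite scaler_sumr -big_split; apply/eq_bigr=> k _ /=.
  by rewrite mcoeffD mcoeffZ scalerDl scalerA.
by close.
Qed.

HB.instance Definition _ :=
  GRing.isLinear.Build F {malg F[K]} M *:%R mlin mlin_is_linear.

End LinearExtension.

Section CoxeterGroup.

Variables (gT : finGroupType) (S : {set gT}).

(* W is the whole group [set: gT]. The last clause is the universal property  *)
(* of the presentation < S | (s t)^m(s,t) = 1 >, m(s,t) being the order of    *)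
(* s t; the case s = t contributes the relations s^2 = 1.                     *)
Definition coxeter_system : Prop :=
  [/\ <<S>>%g = [set: gT],
      {in S, forall s, #[s]%g = 2%N}
    & forall (H : groupType) (f : gT -> H),
        {in S &, forall s t, ((f s * f t) ^+ #[s * t] = 1)%g} ->
        exists phi : gT -> H,
          {morph phi : x y / (x * y)%g} /\ {in S, phi =1 f}].

Definition sref (i : 'I_#|S|) : gT := enum_val i.

Definition coxlen (g : gT) : nat := size (redword sref g).

Definition longest : gT := [arg max_(w > 1%g) coxlen w].

(* Reflections are the conjugates of the elements of S.                       *)
Definition bruhat_step (x y : gT) : bool :=
  [exists t in class_support S [set: gT],
     (y == x * t)%g && (coxlen x < coxlen y)%N].

Definition bruhat (v w : gT) : bool := connect bruhat_step v w.

End CoxeterGroup.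

Section RootSystem.

Variables (R : realType) (gT : finGroupType) (S : {set gT}).

Local Notation n := #|S|.
Local Notation h := 'cV[R]_n.

Definition simple_root (i : 'I_n) : h := delta_mx i 0.

Definition gram : 'M[R]_n :=
  \matrix_(i, j) - cos (pi / #[sref i * sref j]%g%:R).

Definition bform (x y : h) : R := (x^T *m gram *m y) 0 0.

Definition sact (i : 'I_n) (x : h) : h :=
  x - (2 * bform x (simple_root i)) *: simple_root i.

(* g acts by the product of the simple reflections along a reduced word.      *)
Definition hact (g : gT) (x : h) : h := foldr sact x (redword (@sref gT S) g).

Definition is_root (v : h) : bool :=
  [exists g : gT, exists i : 'I_n, v == hact g (simple_root i)].

Definition is_proot (v : h) : bool := is_root v && [forall i, 0 <= v i 0].

(* s_alpha = u s_beta u^-1 for some presentation alpha = u(beta).             *)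
Definition root_refl (v : h) : gT :=
  if [pick p : gT * 'I_n | v == hact p.1 (simple_root p.2)] is Some p
  then (p.1 * sref p.2 * p.1^-1)%g else 1%g.

Definition proot : Type := {v : h | is_proot v}.

HB.instance Definition _ := Choice.on proot.
HB.instance Definition _ := SubType.on proot.

End RootSystem.

Section TensorAlgebra.

Variables (R : realType) (gT : finGroupType) (S : {set gT}).

Local Notation C := R[i].
Local Notation h := 'cV[R]_#|S|.
Local Notation P := (proot R S).

(* V_W has basis x_alpha, alpha positive, so T(V_W) is the free algebra on    *)
(* the positive roots, with V_W as its part of degree 1.                      *)
Definition tensalg : Type := {malg C[{fmonom P}]}.

HB.instance Definition _ := GRing.Lalgebra.on tensalg.

Local Notation T := tensalg.

Definition mon (s : seq P) : T := << FMonom s >>.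

(* x_v for any root v, with x_(-v) = - x_v.                                   *)
Definition xroot (v : h) : T :=
  if insub v is Some a then mon [:: a]
  else if insub (- v) is Some a then - mon [:: a] else 0.

Definition tact (g : gT) : T -> T :=
  mlin (fun m : {fmonom P} => \prod_(a <- m) xroot (hact g (val a))).

Definition wdeg (s : seq P) : gT := (\prod_(a <- s) root_refl (val a))%g.

(* Psi applied to the tensor factors at positions i and i + 1, counted from 0 *)
Definition braid_word (i : nat) (m : {fmonom P}) : T :=
  if drop i m is a :: b :: s then
    mon (take i m) * tact (root_refl (val a)) (mon [:: b]) * mon [:: a] * mon s
  else mon m.

Definition braid (i : nat) : T -> T := mlin (braid_word i).

(* The product of permutations in MathComp is the opposite of the usual one.  *)
(* This turns Psi_sigma into Psi_(sigma^-1), and leaves [m]! unchanged.       *)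
Definition adjacent k (i : 'I_k) : 'S_k.+1 :=
  tperm (widen_ord (leqnSn k) i) (lift ord0 i).

Definition braid_perm k (sigma : 'S_k.+1) (t : T) : T :=
  foldr (fun i : 'I_k => braid i) t (redword (@adjacent k) sigma).

Definition bfact (m : nat) (t : T) : T :=
  if m is k.+1 then \sum_(sigma : 'S_k.+1) braid_perm sigma t else t.

Definition homog (m : nat) : T -> T :=
  mlin (fun u : {fmonom P} => if size u == m then mon u else 0).

(* The direct sum over m of the kernels of [m]! on the degree m part.         *)
Definition nker : {pred T} :=
  fun t => `[< forall m : nat, bfact m (homog m t) = 0 >].

Lemma braid_perm_linear k (sigma : 'S_k.+1) : linear (braid_perm sigma).
Proof.
move=> c x y; rewrite /braid_perm.
by elim: (redword _ _) => //= i s ->; rewrite /braid linearP.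
Qed.

Lemma bfact_linear m : linear (bfact m).
Proof.
case: m => [|k] c x y //=.
rewrite scaler_sumr -big_split; apply: eq_bigr => s _.
exact: braid_perm_linear.
Qed.

Lemma nker_submod_closed : submod_closed nker.
Proof.
have b0 m : bfact m 0 = 0.
  by rewrite -{1}(subrr 0) -scaleN1r addrC bfact_linear scaleN1r addNr.
split=> [|c x y /asboolP hx /asboolP hy]; apply/asboolP=> m.
  by rewrite /homog linear0 b0.
by rewrite /homog linearP bfact_linear hx hy scaler0 addr0.
Qed.

HB.instance Definition _ :=
  GRing.isSubmodClosed.Build C T nker nker_submod_closed.

Definition tens2 : Type := {malg C[({fmonom P} * {fmonom P})%type]}.

HB.instance Definition _ := GRing.Lmodule.on tens2.

Definition tprod (a b : T) : tens2 :=
  \sum_(m <- msupp a) \sum_(k <- msupp b) (a@_m * b@_k) *: << (m, k) >>.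

(* (a ⊗ b) (c ⊗ d) = a (g c) ⊗ b d for b of W-degree g.                       *)
Definition tmul (X Y : tens2) : tens2 :=
  \sum_(p <- msupp X) \sum_(q <- msupp Y)
    (X@_p * Y@_q) *: tprod (mon p.1 * tact (wdeg p.2) (mon q.1))
                           (mon p.2 * mon q.2).

Definition coprod : T -> tens2 :=
  mlin (fun m : {fmonom P} =>
    foldr (fun a => tmul (tprod (mon [:: a]) 1 + tprod 1 (mon [:: a])))
          (tprod 1 1) m).

(* nker ⊗ T + T ⊗ nker, so that tens2 / nker2 = (T / nker) ⊗ (T / nker).      *)
Definition nker2 : {pred tens2} :=
  fun X => `[< exists l : seq (T * T),
     all (fun p => (p.1 \in nker) || (p.2 \in nker)) l /\
     X = \sum_(p <- l) tprod p.1 p.2 >].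

Lemma tprodZl c (a b : T) : tprod (c *: a) b = c *: tprod a b.
Proof.
rewrite /tprod scaler_sumr; pose_big_fset {fmonom P} E.
  rewrite (big_fset_incl _ (B := E)) //=; last first.
    move=> x _ /mcoeff_outdom ->; rewrite big1 // => k _.
    by rewrite mul0r scale0r.
  rewrite [RHS](big_fset_incl _ (B := E)) //=; last first.
    move=> x _ /mcoeff_outdom ->; rewrite big1 ?scaler0 // => k _.
    by rewrite mul0r scale0r.
  apply: eq_bigr => m _; rewrite scaler_sumr; apply: eq_bigr => k _.
  by rewrite mcoeffZ scalerA mulrA.
by close.
Qed.

Lemma nker2_submod_closed : submod_closed nker2.
Proof.
split=> [|c X Y /asboolP[l1 [h1 ->]] /asboolP[l2 [h2 ->]]]; apply/asboolP.
  by exists [::]; rewrite big_nil.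
exists ([seq (c *: p.1, p.2) | p <- l1] ++ l2); split.
  rewrite all_cat h2 andbT all_map; apply: sub_all h1 => p /=.
  by case/orP=> hp; apply/orP; [left; apply: rpredZ | right].
rewrite big_cat big_map /= scaler_sumr; congr (_ + _).
by apply: eq_bigr => p _; rewrite tprodZl.
Qed.

HB.instance Definition _ :=
  GRing.isSubmodClosed.Build C tens2 nker2 nker2_submod_closed.

(* Braided antipode on T(V_W): S(x_a t) = (s_a S(t)) S(x_a), S(x_a) = - x_a.  *)
Fixpoint antipode_word (s : seq P) : T :=
  if s is a :: s' then
    tact (root_refl (val a)) (antipode_word s') * - mon [:: a]
  else 1.

Definition antipode : T -> T := mlin (fun m : {fmonom P} => antipode_word m).

Definition trev : T -> T := mlin (fun m : {fmonom P} => mon (rev m)).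

Definition tsbar : T -> T :=
  mlin (fun m : {fmonom P} => (-1) ^+ size m *: trev (antipode (mon m))).

End TensorAlgebra.

Section NicholsAlgebra.

Variables (R : realType) (gT : finGroupType) (S : {set gT}).

Local Notation C := R[i].
Local Notation T := (tensalg R S).

Definition nichols : Type := {ideal_quot @nker R gT S}.

HB.instance Definition _ := GRing.Zmodule.on nichols.
HB.instance Definition _ := EqQuotient.on nichols.

(* The product of T(V_W) is what defines products in the quotient; products   *)
(* of elements x_alpha are formed in T(V_W) and then projected by npi.        *)
Definition npi (t : T) : nichols := \pi_nichols t.

Lemma npi_eq (t u : T) : npi t = npi u <-> t - u \in @nker R gT S.
Proof.
by rewrite /npi; split=> [/eqP|h]; [|apply/eqP]; rewrite -Quotient.idealrBE.
Qed.

Lemma npi_surj (x : nichols) : npi (generic_quotient.repr x) = x.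
Proof. exact: reprK. Qed.

Lemma npiD : {morph npi : t u / t + u}.
Proof. by move=> t u; rewrite /npi !piE. Qed.

Definition nscale (c : C) (x : nichols) : nichols := npi (c *: generic_quotient.repr x).

Lemma npiZ c t : npi (c *: t) = nscale c (npi t).
Proof.
by apply/npi_eq; rewrite -scalerBr rpredZ //; apply/npi_eq; rewrite npi_surj.
Qed.

Lemma nscaleA c d x : nscale c (nscale d x) = nscale (c * d) x.
Proof. by rewrite -[x]npi_surj -!npiZ scalerA. Qed.

Lemma nscale1 : left_id 1 nscale.
Proof. by move=> x; rewrite -[x]npi_surj -!npiZ scale1r. Qed.

Lemma nscaleDr : right_distributive nscale +%R.
Proof.
move=> c x y; rewrite -[x]npi_surj -[y]npi_surj.
by rewrite -npiD -!npiZ -npiD scalerDr.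
Qed.

Lemma nscaleDl x : {morph nscale^~ x : c d / c + d}.
Proof. by move=> c d; rewrite -[x]npi_surj -!npiZ -npiD scalerDl. Qed.

HB.instance Definition _ := GRing.Zmodule_isLmodule.Build C nichols
  nscaleA nscale1 nscaleDr nscaleDl.

Definition nichols2 : Type := {ideal_quot @nker2 R gT S}.

HB.instance Definition _ := GRing.Zmodule.on nichols2.
HB.instance Definition _ := EqQuotient.on nichols2.

Definition npi2 (X : tens2 R S) : nichols2 := \pi_nichols2 X.

Definition ntens (x y : nichols) : nichols2 := npi2 (tprod (generic_quotient.repr x) (generic_quotient.repr y)).

(* The structure maps of T(V_W) descend to the quotient, so that they may be  *)
(* computed on any representative.                                            *)
Definition ncoprod (x : nichols) : nichols2 := npi2 (coprod (generic_quotient.repr x)).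

Definition nsbar (x : nichols) : nichols := npi (tsbar (generic_quotient.repr x)).

Definition xw (w : gT) : nichols :=
  npi (\prod_(i <- redword (@sref gT S) w) xroot (simple_root R i)).

(* y is the family (x_(w/v))_v, extended by 0 outside of [1, w].              *)
Definition skew_family (w : gT) (y : {ffun gT -> nichols}) : Prop :=
  ncoprod (xw w) = \sum_(v | bruhat S v w) ntens (y v) (xw v) /\
  forall v, ~~ bruhat S v w -> y v = 0.

Definition xskew (w v : gT) : nichols :=
  xget [ffun=> 0] [set y | skew_family w y]%classic v.

Definition npositive (x : nichols) : Prop :=
  exists l : seq (nat * seq (proot R S)),
    x = \sum_(p <- l) npi (mon p.2) *+ p.1.

End NicholsAlgebra.

Arguments xskew R {gT} S w v.

(* Main.v *)
(* Every element of positive degree of the Nichols algebra that is killed by  *)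
(* all left braided derivatives d_a (a a positive root) vanishes, because     *)
(* [m]! = (1 (x) [m-1]!) Delta_(1,m-1). Expanding Delta(x_w) along a reduced  *)
(* word gives, with l the length and s_a the reflection in a,                 *)
(*   d_a x_(w/v) = x_(s_a w / v) if l(s_a w) = l(w) - 1, and 0 otherwise,     *)
(* and for the right derivatives                                              *)
(*   d'_a x_(w/v) = x_(w / s_a v) if l(s_a v) = l(v) + 1, and 0 otherwise.    *)
(* Twisted by signs and reversal, the antipode turns right derivatives into   *)
(* left ones, while right multiplication by w_o reverses lengths; so both     *)
(* sides of the identity satisfy the same recursion.  The antipode side is    *)
(* visibly positive: it is a sum of products of the inversion roots of v w_o. *)

From HB Require Import structures.
Require Import Defs.
From mathcomp Require Import all_boot all_order all_algebra all_fingroup.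
From mathcomp Require Import finmap boolp classical_sets reals trigo.
From mathcomp Require Import complex xfinmap monalg.
From mathcomp Require Import ring zify.

Set Implicit Arguments.
Unset Strict Implicit.
Unset Printing Implicit Defensive.

Import Order.TTheory GRing.Theory Num.Theory.

Local Open Scope ring_scope.

(** * Lengths in a Coxeter group *)

(** For a list [l] of positive roots, [eps_deriv l] differentiates along [l] by the left braided
    derivatives and takes the constant term. On monomials of degree m, these functionals are the
    matrix coefficients of [m]! ([coef_fact_strands]), so the ideal defining the Nichols algebra is
    their common kernel ([nkerP]). Every identity in the quotient can therefore be tested with them
    on lifts to the tensor algebra.

    Let [skew_word] lift x_(w/v) along a reduced word of w. A left derivative d_a deletes letters of
    the word, and a telescoping sum of signs of roots ([sum_deletions]) shows that, under the
    functionals, w becomes s_a w if the length drops by exactly one and the result is 0 otherwise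
    ([eps_deriv_rw]). A right derivative acts on the other index: v becomes s_a v if the length
    rises by exactly one, and the result is 0 otherwise ([rderiv_skew_word]). The map bar carries
    right derivatives to left ones ([deriv_bar]), and right multiplication by w_o turns rises into
    drops ([len_mul_longest]). Hence both sides of the identity satisfy one recursion, with the same
    constant terms; this is [eps_deriv_skew_longest]. Positivity is read off from bar: under it,
    each letter of the word of v w_o is either kept as the image of its simple root under the
    preceding prefix or dropped, and these images are positive because the word is reduced
    ([positive_bar_skew]).

    That [skew_word] lifts the elements defined through the coproduct rests on [eps_deriv_cop]: the
    functional for [a] tensored with the one for [b], evaluated at the coproduct of t, is the
    functional for [a ++ b] at t. So the coproduct descends and that of x_w has the expected form
    ([null2_cop_xword]); functionals dual to the x_v make the coefficients unique ([null2_unique]).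

    The Coxeter theory behind this is derived from the presentation: the geometric representation
    ([geometric_rep]) and the criterion that g sends the i-th simple root to a positive root exactly
    when g s_i is longer than g ([pos_hact_simple]). *)

Section Words.

Variables (gT : finGroupType) (n : nat) (gen : 'I_n -> gT).

Definition wordprod (s : seq 'I_n) : gT := (\prod_(i <- s) gen i)%g.

Lemma wordprod_cat s t : wordprod (s ++ t) = (wordprod s * wordprod t)%g.
Proof. exact: big_cat. Qed.

Lemma wordprod_cons i s : wordprod (i :: s) = (gen i * wordprod s)%g.
Proof. exact: big_cons. Qed.

Lemma wordprod_nil : wordprod [::] = 1%g.
Proof. exact: big_nil. Qed.

Lemma wordprod_rcons s i : wordprod (rcons s i) = (wordprod s * gen i)%g.
Proof. by rewrite -cats1 wordprod_cat /wordprod big_seq1. Qed.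

Hypothesis word_exists : forall g, exists s, wordprod s = g.

Lemma redwordP g : reduced_word gen g (redword gen g).
Proof.
apply: (@xgetPex _ [::] [set s | reduced_word gen g s]%classic).
have ex : exists k, `[< exists2 s, wordprod s = g & size s = k >].
  by have [s hs] := word_exists g; exists (size s); apply/asboolP; exists s.
case: (ex_minnP ex) => k /asboolP [s hs sz] kmin; exists s; split=> // s' hs'.
by rewrite sz; apply: kmin; apply/asboolP; exists s'.
Qed.

Lemma redwordK g : wordprod (redword gen g) = g.
Proof. by case: (redwordP g). Qed.

Lemma redword_min g s : wordprod s = g -> (size (redword gen g) <= size s)%N.
Proof. by case: (redwordP g) => _; apply. Qed.

End Words.

Section CoxeterLength.

Variables (gT : finGroupType) (S : {set gT}) (hS : coxeter_system S).

Local Notation len := (coxlen S).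
Local Notation rw := (redword (@sref gT S)).
Local Notation wprod := (wordprod (@sref gT S)).
Local Notation "'s_ i" := (@sref gT S i) (at level 0, i at level 0, format "''s_' i").
Local Notation n := #|S|.

Lemma sref_in (i : 'I_n) : 's_i \in S.
Proof. exact: enum_valP. Qed.

Lemma sref_surj g : g \in S -> exists i : 'I_n, 's_i = g.
Proof. by move=> gS; exists (enum_rank_in gS g); rewrite /sref enum_rankK_in. Qed.

Lemma sref_inj : injective (@sref gT S).
Proof. exact: enum_val_inj. Qed.

Lemma order_sref (i : 'I_n) : #['s_i]%g = 2%N.
Proof. by case: hS => _ h _; apply: h; apply: sref_in. Qed.

Lemma srefM (i : 'I_n) : ('s_i * 's_i = 1)%g.
Proof. by rewrite -expg2 -(order_sref i) expg_order. Qed.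

Lemma srefV (i : 'I_n) : ('s_i^-1 = 's_i)%g.
Proof. by apply/eqP; rewrite eq_invg_mul srefM. Qed.

Lemma srefKl (i : 'I_n) (g : gT) : ('s_i * ('s_i * g) = g)%g.
Proof. by rewrite mulgA srefM mul1g. Qed.

Lemma srefKr (i : 'I_n) (g : gT) : (g * 's_i * 's_i = g)%g.
Proof. by rewrite -mulgA srefM mulg1. Qed.

Lemma coxeter_word g : exists s, wprod s = g.
Proof.
have : g \in <<S>>%g by case: hS => -> _ _; rewrite inE.
case/gen_prodgP => k [c cS ->].
elim: k c cS => [|k IH] c cS; first by exists [::]; rewrite big_ord0 wordprod_nil.
have [s hs] := IH (fun i => c (lift ord0 i)) (fun i => cS _).
have [i hi] := sref_surj (cS ord0).
by exists (i :: s); rewrite wordprod_cons hi hs big_ord_recl.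
Qed.

Lemma rwK g : wprod (rw g) = g.
Proof. exact: (redwordK coxeter_word). Qed.

Lemma size_rw g : size (rw g) = len g. Proof. by []. Qed.

Lemma len_wprod s : (len (wprod s) <= size s)%N.
Proof. exact: (redword_min coxeter_word). Qed.

Lemma len1 : len 1%g = 0%N.
Proof. by apply/eqP; rewrite -leqn0 -(wordprod_nil (@sref gT S)) len_wprod. Qed.

Lemma lenM g h : (len (g * h)%g <= len g + len h)%N.
Proof. by rewrite -{1}(rwK g) -{1}(rwK h) -wordprod_cat (leq_trans (len_wprod _)) ?size_cat. Qed.

Lemma len_sref_le (i : 'I_n) : (len 's_i <= 1)%N.
Proof. by have := len_wprod [:: i]; rewrite /wordprod big_seq1. Qed.

Lemma wprodV s : ((wprod s)^-1 = wprod (rev s))%g.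
Proof.
elim: s => [|i s IH]; first by rewrite /rev /= wordprod_nil invg1.
by rewrite rev_cons wordprod_rcons -IH wordprod_cons invMg srefV.
Qed.

Lemma lenV g : len (g^-1)%g = len g.
Proof.
have h x : (len (x^-1)%g <= len x)%N.
  by rewrite -{1}(rwK x) wprodV (leq_trans (len_wprod _)) ?size_rev.
by apply/eqP; rewrite eqn_leq h /= -{1}(invgK g) h.
Qed.

(** The universal property allows every generator to be sent to the transposition in S_2. The
    resulting parity excludes equal lengths of g and s_i g. *)
Lemma coxeter_sign : exists sgn : gT -> bool,
  {morph sgn : x y / (x * y)%g >-> x (+) y} /\ forall i : 'I_n, sgn 's_i = true.
Proof.
pose t : 'S_2 := tperm ord0 ord_max.
case: hS => _ _ /(_ ('S_2 : groupType) (fun=> t)) [].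
  by move=> x y _ _; rewrite tperm2 expg1n.
move=> phi [phiM phiS]; exists (fun g => odd_perm (phi g)); split.
  by move=> x y; rewrite phiM odd_permM.
by move=> i; rewrite phiS ?sref_in // odd_tperm.
Qed.

Lemma odd_len_wprod s : odd (len (wprod s)) = odd (size s).
Proof.
have [sgn [sM s1]] := coxeter_sign.
have sg1 : sgn 1%g = false by have := sM 1%g 1%g; rewrite mulg1 addbb.
have h t : sgn (wprod t) = odd (size t).
  by elim: t => [|i t IH]; rewrite ?wordprod_nil // wordprod_cons sM s1 IH.
by rewrite -size_rw -h rwK h.
Qed.

Lemma odd_len_sl i g : odd (len ('s_i * g)%g) = ~~ odd (len g).
Proof.
by rewrite -{1}(rwK g) -wordprod_cons odd_len_wprod /=.
Qed.

Lemma len_sl i g : len ('s_i * g)%g = (len g).+1 \/ len g = (len ('s_i * g)%g).+1.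
Proof.
have h1 : (len ('s_i * g)%g <= (len g).+1)%N.
  by rewrite (leq_trans (lenM _ _)) // -add1n leq_add2r len_sref_le.
have h2 : (len g <= (len ('s_i * g)%g).+1)%N.
  by rewrite -{1}(srefKl i g) (leq_trans (lenM _ _)) // -add1n leq_add2r len_sref_le.
have := odd_len_sl i g; lia.
Qed.

Lemma len_sr i g : len (g * 's_i)%g = (len g).+1 \/ len g = (len (g * 's_i)%g).+1.
Proof.
have := len_sl i (g^-1)%g.
by rewrite -(lenV (g * 's_i)%g) invMg srefV lenV.
Qed.

Definition reduced s := len (wprod s) == size s.

Lemma reduced_rw g : reduced (rw g). Proof. by rewrite /reduced rwK. Qed.

Lemma reduced_catl s t : reduced (s ++ t) -> reduced s.
Proof.
rewrite /reduced wordprod_cat size_cat => /eqP h.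
have := lenM (wprod s) (wprod t); have := len_wprod s; have := len_wprod t.
lia.
Qed.

Lemma reduced_cons i s : reduced (i :: s) =
  reduced s && (len (wprod s) < len ('s_i * wprod s)%g)%N.
Proof.
rewrite /reduced wordprod_cons /=.
have := len_wprod s; have := len_sl i (wprod s).
move: (len ('s_i * _)%g) (len (wprod s)) (size s) => a b c h1 h2.
case: (a =P c.+1); case: (b =P c) => /=; lia.
Qed.

(* The alternating product of length [k] in [x] and [y] that ends in [x]. *)
Definition altp (x y : 'I_n) k : gT :=
  if odd k then ('s_x * ('s_y * 's_x) ^+ k./2)%g else (('s_y * 's_x) ^+ k./2)%g.

Lemma altpS x y k : altp x y k.+1 = (altp y x k * 's_x)%g.
Proof.
have e j : ((('s_x * 's_y) ^+ j) * 's_x = 's_x * ('s_y * 's_x) ^+ j)%g.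
  elim: j => [|j IH]; first by rewrite !expg0 mulg1 mul1g.
  by rewrite expgSr [in RHS]expgSr [RHS]mulgA -IH !mulgA.
rewrite /altp /= uphalf_half; case: (odd k) => /=; rewrite ?add0n ?add1n.
  by rewrite expgS -!mulgA e.
by rewrite e.
Qed.

(** The quotient of the two alternating products of length m is (s_y s_x)^m = 1. *)
Lemma altp_braid x y : altp x y #['s_x * 's_y]%g = altp y x #['s_x * 's_y]%g.
Proof.
set m := #[_]%g.
have hm : (('s_y * 's_x) ^+ m = 1)%g.
  have -> : ('s_y * 's_x = ('s_x * 's_y)^-1)%g by rewrite invMg !srefV.
  by rewrite expVgn expg_order invg1.
have e : (('s_x * 's_y)^-1 = 's_y * 's_x)%g by rewrite invMg !srefV.
apply/eqP; rewrite eq_sym eq_mulVg1; apply/eqP; rewrite /altp.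
have hm2 := odd_double_half m; rewrite -addnn in hm2.
case om: (odd m); rewrite om /= in hm2.
  rewrite invMg srefV -expVgn e -!mulgA (mulgA 's_y) -expgS -expgnDr addnS.
  by rewrite -[RHS]hm; congr (_ ^+ _)%g; rewrite -[RHS]hm2 add1n.
by rewrite -expVgn e -expgnDr -[RHS]hm; congr (_ ^+ _)%g; rewrite -[RHS]hm2 add0n.
Qed.

Lemma len_altp x y k : (len (altp x y k) <= k)%N.
Proof.
elim: k x y => [|k IH] x y; first by rewrite /altp /= expg0 len1.
rewrite altpS (leq_trans (lenM _ _)) // -addn1; apply: leq_add => //.
exact: len_sref_le.
Qed.

(** At length m + 1 the braid relation creates a repeated last letter, which cancels; longer
    products inherit the defect. *)
Lemma len_altp_lt x y k : (#['s_x * 's_y]%g < k)%N -> (len (altp x y k) < k)%N.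
Proof.
elim: k x y => [//|k IH] x y; rewrite ltnS leq_eqVlt => /orP[/eqP e|lt].
  have := altp_braid x y; rewrite e altpS => <-.
  have : (0 < k)%N by rewrite -e order_gt0.
  case: {e IH} k => [//|k'] _.
  by rewrite altpS srefKr (leq_ltn_trans (len_altp _ _ _)).
rewrite altpS (leq_ltn_trans (lenM _ _)) //.
rewrite -[ltnRHS]addn1 -addSn; apply: leq_add (len_sref_le _); apply: IH.
by rewrite -orderV invMg !srefV.
Qed.

Definition two_letters (x y : 'I_n) (u : seq 'I_n) := all (fun z => (z == x) || (z == y)) u.

Lemma reduced_alt x y u : two_letters x y u -> reduced (rcons u x) ->
  wprod (rcons u x) = altp x y (size u).+1.
Proof.
elim/last_ind: u x y => [|u z IH] x y.
  by move=> _ _; rewrite wordprod_rcons wordprod_nil altpS /altp /= expg0.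
rewrite /two_letters all_rcons size_rcons => /andP[/orP[] /eqP -> hu] red.
  move: red; rewrite /reduced !wordprod_rcons srefKr !size_rcons => /eqP h.
  by have := len_wprod u; rewrite h => /ltnW; rewrite ltnn.
rewrite altpS wordprod_rcons; congr (_ * _)%g; apply: IH.
  by apply: sub_all hu => z'; rewrite orbC.
by move: red; rewrite -cats1 => /reduced_catl.
Qed.

(** A reduced word in two letters alternates, and alternating words longer than m are not reduced.
    This bound later keeps the angles in a rank two subgroup at most pi. *)
Lemma size_reduced_alt x y u : two_letters x y u -> reduced (rcons u x) ->
  (size u < #['s_x * 's_y]%g)%N.
Proof.
move=> hu red; rewrite ltnNge -ltnS; apply/negP => h.
have := len_altp_lt h; rewrite -(reduced_alt hu red).
by move: red => /eqP ->; rewrite size_rcons ltnn.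
Qed.

End CoxeterLength.

(** * The geometric representation *)

Section MatrixGroup.

Variables (R : comNzRingType) (n : nat).

(** The group of invertible matrices, as a target for the universal property. Each matrix carries
    its inverse, so inversion is a swap. *)
Definition mxpair : Type :=
  {p : 'M[R]_n * 'M[R]_n | (p.1 *m p.2 == 1%:M) && (p.2 *m p.1 == 1%:M)}.

HB.instance Definition _ := Choice.on mxpair.
HB.instance Definition _ := SubType.on mxpair.

Definition mxpair1 : mxpair.
Proof. by exists (1%:M, 1%:M); rewrite /= mulmx1 eqxx. Defined.

Definition mxpairV (p : mxpair) : mxpair.
Proof. by exists ((val p).2, (val p).1); case: p => p /=; rewrite andbC. Defined.

Definition mxpairM (p q : mxpair) : mxpair.
Proof.
exists ((val p).1 *m (val q).1, (val q).2 *m (val p).2) => /=.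
case: p q => [[a b] /= /andP[/eqP h1 /eqP h2]] [[c d] /= /andP[/eqP h3 /eqP h4]].
by rewrite mulmxA -(mulmxA a) h3 mulmx1 h1 mulmxA -(mulmxA d) h2 mulmx1 h4 !eqxx.
Defined.

Lemma mxpairA : associative mxpairM.
Proof. by move=> p q r; apply: val_inj; rewrite /= !mulmxA. Qed.

Lemma mxpair1M : left_id mxpair1 mxpairM.
Proof. by move=> p; apply: val_inj; rewrite /= mul1mx mulmx1; case: (val p). Qed.

Lemma mxpairM1 : right_id mxpair1 mxpairM.
Proof. by move=> p; apply: val_inj; rewrite /= mul1mx mulmx1; case: (val p). Qed.

Lemma mxpairVM : left_inverse mxpair1 mxpairV mxpairM.
Proof. by case=> [[a b] h]; apply: val_inj => /=; case/andP: h => _ /eqP /= ->. Qed.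

Lemma mxpairMV : right_inverse mxpair1 mxpairV mxpairM.
Proof. by case=> [[a b] h]; apply: val_inj => /=; case/andP: h => /eqP /= ->. Qed.

HB.instance Definition _ := isGroup.Build mxpair
  mxpairA mxpair1M mxpairM1 mxpairVM mxpairMV.

End MatrixGroup.

(* Locked, like [pos], [wroot] and [wrefl] below, because conversion tests    *)
(* that unfold it do not end in reasonable time.                              *)
HB.lock Definition wact (R : realType) (gT : finGroupType) (S : {set gT})
  (g : gT) (v : 'cV[R]_#|S|) : 'cV[R]_#|S| := hact g v.
Arguments wact {R gT S}.

Section GeometricRepresentation.

Variables (R : realType) (gT : finGroupType) (S : {set gT}).
Hypothesis hS : coxeter_system S.

Local Notation len := (coxlen S).
Local Notation n := #|S|.
Local Notation h := 'cV[R]_n.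
Local Notation rw := (redword (@sref gT S)).
Local Notation "'s_ i" := (@sref gT S i) (at level 0, i at level 0, format "''s_' i").
Local Notation e_ := (simple_root R).
Local Notation B := (@bform R gT S).
Local Notation sact := (@sact R gT S).
Local Notation hact := (@wact R gT S).

Definition cosm (i j : 'I_n) : R := cos (pi / #['s_i * 's_j]%g%:R).

Lemma cosmC i j : cosm i j = cosm j i.
Proof. by rewrite /cosm -orderV invMg !srefV. Qed.

Lemma bformDl (x y z : h) : B (x + y) z = B x z + B y z.
Proof. by rewrite /bform linearD !mulmxDl mxE. Qed.

Lemma bformZl c (x z : h) : B (c *: x) z = c * B x z.
Proof. by rewrite /bform linearZ /= -!scalemxAl mxE. Qed.

Lemma gram_sym : (gram R S)^T = gram R S.
Proof. by apply/matrixP => i j; rewrite !mxE -/(cosm j i) -/(cosm i j) cosmC. Qed.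

Lemma bformC (x y : h) : B x y = B y x.
Proof.
rewrite /bform; have tr (M : 'M[R]_1) : M 0 0 = M^T 0 0 by rewrite mxE.
by rewrite tr !trmx_mul trmxK gram_sym mulmxA.
Qed.

Lemma bformDr (x y z : h) : B z (x + y) = B z x + B z y.
Proof. by rewrite !(bformC z) bformDl. Qed.

Lemma bformZr c (x z : h) : B z (c *: x) = c * B z x.
Proof. by rewrite !(bformC z) bformZl. Qed.

Lemma bformNr (x z : h) : B z (- x) = - B z x.
Proof. by rewrite -scaleN1r bformZr mulN1r. Qed.

Lemma bformNl (x z : h) : B (- x) z = - B x z.
Proof. by rewrite -scaleN1r bformZl mulN1r. Qed.

Lemma bform_simple i j : B (e_ i) (e_ j) = - cosm i j.
Proof.
by rewrite /bform /simple_root trmx_delta -rowE -colE !mxE.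
Qed.

Lemma bform_simple1 i : B (e_ i) (e_ i) = 1.
Proof. by rewrite bform_simple /cosm srefM // order1 divr1 cospi opprK. Qed.

Definition smx i : 'M[R]_n := 1%:M - 2%:R *: (e_ i *m ((e_ i)^T *m gram R S)).

Lemma sactE i (x : h) : sact i x = smx i *m x.
Proof.
rewrite /smx mulmxBl mul1mx -scalemxAl -(mulmxA (e_ i)) /Defs.sact bformC /bform.
by rewrite [in RHS](mx11_scalar (_ *m x)) mul_mx_scalar scalerA.
Qed.

Lemma sactD i (x y : h) : sact i (x + y) = sact i x + sact i y.
Proof. by rewrite !sactE mulmxDr. Qed.

Lemma sactZ i c (x : h) : sact i (c *: x) = c *: sact i x.
Proof. by rewrite !sactE scalemxAr. Qed.

Lemma sactK i : involutive (sact i).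
Proof.
move=> x; rewrite /Defs.sact bformDl bformNl bformZl bform_simple1.
by rewrite -addrA -opprD -scalerDl (_ : 2 * _ + _ = 0) ?scale0r ?subr0 //; ring.
Qed.

Lemma smxM i : smx i *m smx i = 1%:M.
Proof.
apply: trmx_inj; apply/row_matrixP => j; apply: trmx_inj.
by rewrite !tr_row !trmxK !colE -mulmxA -!sactE sactK mul1mx.
Qed.

Lemma sact_simple i j : sact i (e_ j) = e_ j + (2 * cosm i j) *: e_ i.
Proof. by rewrite /Defs.sact bform_simple cosmC mulrN scaleNr opprK. Qed.

Lemma sact_simple1 i : sact i (e_ i) = - e_ i.
Proof.
rewrite /Defs.sact bform_simple1 mulr1 -[in LHS](scale1r (e_ i)) scalerA mulr1.
by rewrite -scalerBl (_ : 1 - 2 = -1) ?scaleN1r //; ring.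
Qed.

Definition ang (i j : 'I_n) : R := pi / #['s_i * 's_j]%g%:R.

Lemma angC i j : ang i j = ang j i.
Proof. by rewrite /ang -orderV invMg !srefV. Qed.

(* Up to exchanging [x] and [y], this is sin(theta) times the image of the    *)
(* simple root [x] under [k] alternating reflections, the first one in [y].   *)
Definition dvec (x y : 'I_n) (k : nat) : h :=
  sin (k.+1%:R * ang x y) *: e_ x + sin (k%:R * ang x y) *: e_ y.

Lemma sact_dvec x y k : sact y (dvec x y k) = dvec y x k.+1.
Proof.
rewrite /dvec sactD !sactZ sact_simple sact_simple1 /cosm -/(ang y x) (angC y x).
rewrite scalerDr scalerA -addrA [RHS]addrC; congr (_ + _).
rewrite scalerN -scaleNr -scalerDl; congr (_ *: _).
set t := ang x y.
have -> : k.+2%:R * t = k.+1%:R * t + t by rewrite -[k.+2]addn1 natrD; ring.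
have -> : k%:R * t = k.+1%:R * t - t by rewrite -[k.+1]addn1 natrD; ring.
rewrite sinB sinD; ring.
Qed.

Lemma sin_ang x y : x != y -> 0 < sin (ang x y).
Proof.
move=> nxy; apply: sin_gt0_pi; rewrite /ang.
have m1 : (1 < #['s_x * 's_y]%g)%N.
  rewrite order_gt1; apply: contra nxy => /eqP e.
  by apply/eqP/sref_inj; rewrite -[LHS](srefKr hS y) e mul1g.
have m0 : 0 < #['s_x * 's_y]%g%:R :> R by rewrite ltr0n ltnW.
by rewrite divr_gt0 ?pi_gt0 //= ltr_pdivrMr // ltr_pMr ?pi_gt0 // ltr1n.
Qed.

Lemma ang_period x y : #['s_x * 's_y]%g%:R * ang x y = pi.
Proof. by rewrite /ang mulrC divfK // pnatr_eq0 -lt0n order_gt0. Qed.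

Lemma iter_dvec x y k r :
  iter r (fun v => sact x (sact y v)) (dvec x y k) = dvec x y (k + r.*2).
Proof.
elim: r => [|r IH]; first by rewrite addn0.
by rewrite iterS IH !sact_dvec doubleS !addnS.
Qed.

Lemma dvec_period x y k : dvec x y (k + #['s_x * 's_y]%g.*2) = dvec x y k.
Proof.
have e j : sin ((j + #['s_x * 's_y]%g.*2)%:R * ang x y) = sin (j%:R * ang x y).
  by rewrite natrD mulrDl -muln2 natrM mulrAC ang_period mulr_natr sinD2pi.
by rewrite /dvec -addSn !e.
Qed.

(** On the plane of the two simple roots, s_x s_y advances the index of [dvec] by two, a rotation
    whose period divides m; on the orthogonal complement of the plane it is the identity. The two
    parts span because the Gram determinant of the plane is sin^2 of the angle, hence nonzero. *)
Lemma iter_sact x y (v : h) :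
  iter #['s_x * 's_y]%g (fun v => sact x (sact y v)) v = v.
Proof.
set m := #[_]%g; set f := fun v => _.
case: (eqVneq x y) => [exy|nxy].
  rewrite /m exy (srefM hS) order1 /= /f exy; exact: sactK.
have fD u w : f (u + w) = f u + f w by rewrite /f !sactD.
have fZ c u : f (c *: u) = c *: f u by rewrite /f !sactZ.
have iD k u w : iter k f (u + w) = iter k f u + iter k f w.
  by elim: k => //= k ->; rewrite fD.
have iZ k c u : iter k f (c *: u) = c *: iter k f u.
  by elim: k => //= k ->; rewrite fZ.
have s0 := sin_ang nxy; set t := ang x y in s0.
have sn0 : sin t != 0 by rewrite gt_eqF.
have d0 : dvec x y 0 = sin t *: e_ x by rewrite /dvec mul1r mul0r sin0 scale0r addr0.
have d1 : dvec x y 1 = sin (2 * t) *: e_ x + sin t *: e_ y by rewrite /dvec mul1r.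
have hd k : iter m f (dvec x y k) = dvec x y k by rewrite iter_dvec dvec_period.
have hx : iter m f (e_ x) = e_ x.
  by have := hd 0; rewrite d0 iZ => /(scalerI sn0).
have hy : iter m f (e_ y) = e_ y.
  by have := hd 1; rewrite d1 iD !iZ hx => /addrI /(scalerI sn0).
pose c := cos t.
have c2 : 1 - c ^+ 2 != 0.
  by rewrite -[1](cos2Dsin2 t) addrAC subrr add0r expf_neq0.
(* Coordinates of the orthogonal projection of [v] to the plane, by Cramer's rule. *)
pose p := (B v (e_ x) + c * B v (e_ y)) / (1 - c ^+ 2).
pose q := (B v (e_ y) + c * B v (e_ x)) / (1 - c ^+ 2).
pose z := v - (p *: e_ x + q *: e_ y).
have cyx : B (e_ y) (e_ x) = - c by rewrite bform_simple cosmC.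
have cxy : B (e_ x) (e_ y) = - c by rewrite bform_simple.
have zx : B z (e_ x) = 0.
  rewrite /z bformDl bformNl bformDl !bformZl bform_simple1 cyx /p /q.
  by field.
have zy : B z (e_ y) = 0.
  rewrite /z bformDl bformNl bformDl !bformZl bform_simple1 cxy /p /q.
  by field.
have fz : f z = z by rewrite /f /Defs.sact zy mulr0 scale0r subr0 zx mulr0 scale0r subr0.
have iz : iter m f z = z by elim: (m) => [//|k IH]; rewrite iterS IH fz.
have ev : v = z + (p *: e_ x + q *: e_ y) by rewrite /z subrK.
by rewrite {1}ev iD iz iD !iZ hx hy -ev.
Qed.

Definition smxpair (i : 'I_n) : mxpair R n.
Proof. by exists (smx i, smx i); rewrite /= smxM eqxx. Defined.

(** The matrices of simple reflections satisfy the defining relations by [iter_sact], so the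
    presentation extends them to the whole group. *)
Lemma geometric_rep : exists M : gT -> 'M[R]_n,
  (forall g k, M (g * k)%g = M g *m M k) /\ (forall i, M 's_i = smx i).
Proof.
pose f g : mxpair R n := if [pick i | 's_i == g] is Some i then smxpair i else 1%g.
have fE i : f 's_i = smxpair i.
  rewrite /f; case: pickP => [j /eqP /sref_inj -> //|/(_ i)].
  by rewrite eqxx.
case: hS => _ _ /(_ (mxpair R n) f) [].
  move=> s t /sref_surj[i <-] /sref_surj[j <-]; rewrite !fE.
  have sE k : (val ((smxpair i * smxpair j) ^+ k)%g).1 =
              iter k (fun v => smx i *m (smx j *m v)) 1%:M.
    elim: k => [|k IH] //; rewrite expgS iterS -IH /= mulmxA //.
  have h1 : (val ((smxpair i * smxpair j) ^+ #['s_i * 's_j])%g).1 = 1%:M.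
    rewrite sE; apply/matrixP => a b.
    have hc k : col b (iter k (fun v => smx i *m (smx j *m v)) 1%:M) =
       iter k (fun v => sact i (sact j v)) (col b 1%:M).
      elim: k => //= k IH; rewrite !sactE -IH.
      by rewrite !colE !mulmxA.
    have := hc #['s_i * 's_j]%g; rewrite iter_sact => /colP /(_ a).
    by rewrite !mxE.
  apply: val_inj; case: (_ ^+ _)%g h1 => [[a b] hab] /= a1.
  by move: hab; rewrite /= a1 mul1mx andbC => /andP[_ /eqP ->].
move=> phi [phiM phiS]; exists (fun g => (val (phi g)).1); split.
  by move=> g k; rewrite phiM.
by move=> i; rewrite phiS ?sref_in // fE.
Qed.

(** The action is defined through one chosen reduced word; its agreement with the representation
    makes it a group action by linear maps. *)
Lemma hactE : exists M : gT -> 'M[R]_n,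
  (forall g k, M (g * k)%g = M g *m M k) /\ (forall g x, hact g x = M g *m x).
Proof.
have [M [MM Ms]] := geometric_rep; exists M; split=> // g x.
have M1 : M 1%g = 1%:M.
  (* With a generator at hand, the invertible matrix [smx i] cancels; without one, the matrices are
     empty. *)
  case: (pickP (fun i : 'I_n => true)) => [i _|n0].
    have := congr1 (mulmx^~ (smx i)) (MM 1%g 's_i).
    by rewrite mul1g Ms -mulmxA !smxM mulmx1.
  by apply/matrixP => i; have := n0 i.
rewrite wact.unlock /Defs.hact -{2}(rwK hS g); elim: (rw g) => [|i s IH] /=.
  by rewrite wordprod_nil M1 mul1mx.
by rewrite IH sactE wordprod_cons MM Ms mulmxA.
Qed.

Lemma hactM g k (x : h) : hact (g * k)%g x = hact g (hact k x).
Proof. by have [M [MM hM]] := hactE; rewrite !hM MM mulmxA. Qed.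

Lemma hactD g (x y : h) : hact g (x + y) = hact g x + hact g y.
Proof. by have [M [MM hM]] := hactE; rewrite !hM mulmxDr. Qed.

Lemma hactZ g c (x : h) : hact g (c *: x) = c *: hact g x.
Proof. by have [M [MM hM]] := hactE; rewrite !hM scalemxAr. Qed.

Lemma hactN g (x : h) : hact g (- x) = - hact g x.
Proof. by rewrite -scaleN1r hactZ scaleN1r. Qed.

Lemma hact0 g : hact g 0 = 0.
Proof. by rewrite -[X in wact _ X](scale0r 0) hactZ scale0r. Qed.

Lemma hact1 (x : h) : hact 1%g x = x.
Proof.
by rewrite wact.unlock /Defs.hact (size0nil (_ : size (rw 1%g) = 0%N)) // size_rw (len1 hS).
Qed.

Lemma hactKV g (x : h) : hact g (hact g^-1%g x) = x.
Proof. by rewrite -hactM mulgV hact1. Qed.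

Lemma hactVK g (x : h) : hact g^-1%g (hact g x) = x.
Proof. by rewrite -hactM mulVg hact1. Qed.

Lemma hact_sref i (x : h) : hact 's_i x = sact i x.
Proof.
have [M [MM hM]] := hactE; have [M' [M'M M's]] := geometric_rep.
rewrite wact.unlock /Defs.hact; have l1 : len 's_i = 1%N.
  have := len_sl hS i 1%g; rewrite mulg1 len1 //; lia.
have := rwK hS 's_i; have := l1; rewrite -size_rw.
by case: (rw 's_i) => [|j []] //= _; rewrite /wordprod big_seq1 => /sref_inj ->.
Qed.

Lemma bform_sact i (x y : h) : B (sact i x) (sact i y) = B x y.
Proof.
rewrite /Defs.sact !(bformDl, bformDr, bformNl, bformNr, bformZl, bformZr).
by rewrite bform_simple1 (bformC (e_ i) y); ring.
Qed.

Lemma bform_hact g (x y : h) : B (hact g x) (hact g y) = B x y.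
Proof.
by rewrite wact.unlock /Defs.hact; elim: (rw g) => //= i s IH; rewrite bform_sact.
Qed.

End GeometricRepresentation.

(** * Positive and negative roots *)

HB.lock Definition pos (R : realType) n (v : 'cV[R]_n) : bool :=
  [forall i, 0 <= v i 0].
Arguments pos {R n}.

HB.lock Definition wroot (R : realType) (gT : finGroupType) (S : {set gT})
  (v : 'cV[R]_#|S|) : bool := is_root v.
Arguments wroot {R gT S}.

HB.lock Definition wrefl (R : realType) (gT : finGroupType) (S : {set gT})
  (v : 'cV[R]_#|S|) : gT := root_refl v.
Arguments wrefl {R gT S}.

Section RootPositivity.

Variables (R : realType) (gT : finGroupType) (S : {set gT}).
Hypothesis hS : coxeter_system S.

Local Notation len := (coxlen S).
Local Notation n := #|S|.
Local Notation h := 'cV[R]_n.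
Local Notation rw := (redword (@sref gT S)).
Local Notation wprod := (wordprod (@sref gT S)).
Local Notation "'s_ i" := (@sref gT S i) (at level 0, i at level 0, format "''s_' i").
Local Notation e_ := (simple_root R).
Local Notation B := (@bform R gT S).
Local Notation sact := (@sact R gT S).
Local Notation hact := (@wact R gT S).
Local Notation root := (@wroot R gT S).
Local Notation root_refl := (@wrefl R gT S).

Lemma is_prootE (v : h) : is_proot v = root v && pos v.
Proof. by rewrite wroot.unlock pos.unlock. Qed.

Lemma posP (v : h) : reflect (forall i, 0 <= v i 0) (pos v).
Proof. by rewrite pos.unlock; apply: forallP. Qed.

Lemma posD (u v : h) : pos u -> pos v -> pos (u + v).
Proof. by move=> /posP hu /posP hv; apply/posP => i; rewrite mxE addr_ge0. Qed.

Lemma posZ c (v : h) : 0 <= c -> pos v -> pos (c *: v).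
Proof. by move=> c0 /posP hv; apply/posP => i; rewrite mxE mulr_ge0. Qed.

Lemma pos_simple (i : 'I_n) : pos (e_ i).
Proof. by apply/posP => j; rewrite mxE; case: (_ && _). Qed.

Lemma pos_anti (v : h) : pos v -> pos (- v) -> v = 0.
Proof.
move=> /posP h1 /posP h2; apply/colP => i; rewrite mxE; apply/eqP.
by rewrite eq_le h1 andbT -oppr_ge0; have := h2 i; rewrite mxE.
Qed.

(** Reducedness of [rcons u x] forces the letter that acts first to be [y], and after that the
    letters alternate; each letter raises the index of [dvec] by one and exchanges the roles of [x]
    and [y]. *)
Lemma hact_word_dvec x y u r : two_letters x y u -> reduced (rcons u x) ->
  let v := hact (wprod u) (dvec R x y r) in
  v = dvec R x y (r + size u) \/ v = dvec R y x (r + size u).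
Proof.
elim/last_ind: u x y r => [|u z IH] x y r /=.
  by rewrite wordprod_nil (hact1 hS) addn0; left.
rewrite /two_letters all_rcons size_rcons => /andP[/orP[] /eqP -> hu] red.
  move: red; rewrite /reduced !wordprod_rcons (srefKr hS) !size_rcons => /eqP hh.
  by have := len_wprod hS u; rewrite hh => /ltnW; rewrite ltnn.
rewrite wordprod_rcons (hactM hS) (hact_sref hS) (sact_dvec R hS) addnS -addSn.
have hu' : two_letters y x u by apply: sub_all hu => z'; rewrite orbC.
have red' : reduced (rcons u y) by move: red; rewrite -cats1 => /(reduced_catl hS).
by case: (IH y x r.+1 hu' red') => ->; [right | left].
Qed.

(** Induction on length by reduction to rank two: g = v u with u in a dihedral subgroup and v
    minimal in its coset. Then u sends the simple root to a nonnegative combination of the two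
    simple roots, whose images under v are positive by induction. *)
Lemma hact_simple_pos g i : (len g < len (g * 's_i)%g)%N -> pos (hact g (e_ i)).
Proof.
move: {2}(len g).+1 (leqnn (len g).+1) => N; elim: N g i => // N IH g i.
rewrite ltnS => leN lt; case: (eqVneq g 1%g) => [-> | g1].
  by rewrite (hact1 hS) pos_simple.
have [j lj] : exists j, len g = (len (g * 's_j)%g).+1.
  have : rw g != [::].
    by apply: contra g1 => /eqP e; rewrite -(rwK hS g) e wordprod_nil.
  case/lastP E : (rw g) => [//|u j] _; exists j.
  have := reduced_rw hS g; rewrite E -cats1 => /(reduced_catl hS).
  rewrite /reduced => /eqP hu.
  by rewrite -{2}(rwK hS g) E wordprod_rcons (srefKr hS) hu -size_rw E size_rcons.
(* Factorizations of [g] with additive lengths whose right part is a word of length [k] in the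
   letters [i] and [j]; a maximal [k] makes [v] minimal in its coset. *)
pose Q k := `[< exists v u, [/\ two_letters i j u, g = (v * wprod u)%g,
                 size u = k & len g = (len v + k)%N] >].
have Qex : exists k, Q k.
  exists 0%N; apply/asboolP; exists g, [::].
  by rewrite wordprod_nil mulg1 addn0.
have Qub k : Q k -> (k <= len g)%N.
  by move=> /asboolP [v [u [_ _ _ ->]]]; rewrite leq_addl.
have Q1 : Q 1%N.
  apply/asboolP; exists (g * 's_j)%g, [:: j]; split=> //=.
  - by rewrite /two_letters /= eqxx orbT.
  - by rewrite /wordprod big_seq1 (srefKr hS).
  - by rewrite addn1.
case: (ex_maxnP Qex Qub) => k /asboolP [v [u [hu gE su lg]]] kmax.
have k1 := kmax _ Q1.
have ltv x : (x == i) || (x == j) -> (len v < len (v * 's_x)%g)%N.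
  move=> hx; case: (len_sr hS x v) => [->//|lv].
  have /kmax : Q k.+1; last by rewrite ltnn.
  apply/asboolP; exists (v * 's_x)%g, (x :: u); split=> /=.
  - by rewrite /two_letters /= hx.
  - by rewrite wordprod_cons mulgA (srefKr hS).
  - by rewrite su.
  - by rewrite lg lv addnS addSn.
have lv : (len v < N)%N by rewrite (leq_trans _ leN) // lg -addn1 leq_add2l.
have pi : pos (hact v (e_ i)) by apply: IH => //; apply: ltv; rewrite eqxx.
have pj : pos (hact v (e_ j)) by apply: IH => //; apply: ltv; rewrite eqxx orbT.
have redu : reduced (rcons u i).
  have := lenM hS v (wprod u * 's_i)%g; rewrite mulgA -gE.
  have := len_wprod hS (rcons u i); rewrite /reduced wordprod_rcons size_rcons.
  move=> /[swap]; move: lt lg; rewrite su.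
  move: (len g) (len (g * 's_i)%g) (len v) (len (wprod u * 's_i)%g) => a b c d.
  lia.
have nij : i != j by apply/eqP => e; move: lj lt; rewrite -e; lia.
have km := size_reduced_alt hS hu redu; rewrite su in km.
have m0 : 0 < #['s_i * 's_j]%g%:R :> R by rewrite ltr0n order_gt0.
(* Since k + 1 is at most m by [km], the angles that occur do not exceed pi. *)
have sge0 r : (r <= k.+1)%N -> 0 <= sin (r%:R * ang R i j).
  move=> rk; apply: sin_ge0_pi; rewrite /ang mulr_ge0 ?divr_ge0 ?pi_ge0 ?ler0n //=.
  rewrite mulrCA ger_pMr ?pi_gt0 // ler_pdivrMr // mul1r ler_nat.
  exact: leq_trans rk km.
have s0 := sin_ang R hS nij.
have d0 : dvec R i j 0 = sin (ang R i j) *: e_ i by rewrite /dvec mul1r mul0r sin0 scale0r addr0.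
have pd : pos (sin (ang R i j) *: hact g (e_ i)).
  rewrite -(hactZ hS) -d0 gE (hactM hS).
  case: (hact_word_dvec 0 hu redu) => ->; rewrite add0n su.
    rewrite /dvec (hactD hS) !(hactZ hS).
    by apply: posD; apply: posZ => //; apply: sge0.
  rewrite /dvec (hactD hS) !(hactZ hS) -(angC R hS).
  by apply: posD; apply: posZ => //; apply: sge0.
by have := posZ (ltW (_ : 0 < (sin (ang R i j))^-1)) pd;
  rewrite scalerA mulVf ?scale1r ?gt_eqF //; apply; rewrite invr_gt0.
Qed.

Lemma is_rootP (v : h) : reflect (exists g i, v = hact g (e_ i)) (root v).
Proof.
rewrite wroot.unlock; apply: (iffP existsP) => [[g /existsP[i /eqP ->]]|[g [i ->]]].
  by exists g, i; rewrite wact.unlock.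
by exists g; apply/existsP; exists i; rewrite wact.unlock.
Qed.

Lemma root_simple i : root (e_ i).
Proof. by apply/is_rootP; exists 1%g, i; rewrite (hact1 hS). Qed.

Lemma is_root_hact g (v : h) : root v -> root (hact g v).
Proof. by case/is_rootP => k [i ->]; apply/is_rootP; exists (g * k)%g, i; rewrite (hactM hS). Qed.

Lemma is_rootN (v : h) : root (- v) = root v.
Proof.
have hN u : root u -> root (- u).
  case/is_rootP => g [i ->]; apply/is_rootP; exists (g * 's_i)%g, i.
  by rewrite (hactM hS) (hact_sref hS) (sact_simple1 R hS) (hactN hS).
by apply/idP/idP => [/hN|/hN //]; rewrite opprK.
Qed.

Lemma bform_root (v : h) : root v -> B v v = 1.
Proof. by case/is_rootP => g [i ->]; rewrite (bform_hact hS) (bform_simple1 R hS). Qed.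

Lemma root_neq0 (v : h) : root v -> v != 0.
Proof.
move/bform_root => b; apply: contraTneq isT => v0; move: b.
by rewrite v0 -(scale0r 0) bformZl mul0r => /eqP; rewrite eq_sym oner_eq0.
Qed.

Lemma root_neqN (v : h) : root v -> v != - v.
Proof.
move=> /root_neq0; apply: contra => /eqP e.
have : 2 *: v = 0 by rewrite -[2]/(1 + 1) scalerDl scale1r {2}e subrr.
by move/eqP; rewrite scaler_eq0 pnatr_eq0.
Qed.

Lemma hact_simple_neg g i : (len (g * 's_i)%g < len g)%N -> pos (- hact g (e_ i)).
Proof.
move=> lt; have := @hact_simple_pos (g * 's_i)%g i; rewrite (srefKr hS) => /(_ lt).
by rewrite (hactM hS) (hact_sref hS) (sact_simple1 R hS) (hactN hS).
Qed.

Lemma pos_hact_simple g i : pos (hact g (e_ i)) = (len g < len (g * 's_i)%g)%N.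
Proof.
apply/idP/idP => [p|]; last exact: hact_simple_pos.
case: (len_sr hS i g) => [->//|l].
have := @hact_simple_neg g i; rewrite l ltnSn => /(_ isT) /(pos_anti p) e.
by have := root_neq0 (is_root_hact g (root_simple i)); rewrite e eqxx.
Qed.

Lemma posN (v : h) : root v -> pos (- v) = ~~ pos v.
Proof.
move=> rv; apply/idP/idP => [pN|].
  by apply/negP => p; have := root_neq0 rv; rewrite (pos_anti p pN) eqxx.
case/is_rootP: rv => g [i ->]; rewrite pos_hact_simple -leqNgt => l.
by apply: hact_simple_neg; case: (len_sr hS i g) => e; move: l; rewrite e // ltnn.
Qed.

(** A nontrivial g sends the simple root of the last letter of its reduced word to a negative
    root. *)
Lemma hact_faithful g : (forall v, hact g v = v) -> g = 1%g.
Proof.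
move=> hg; apply/eqP; case: (eqVneq g 1%g) => // g1.
have : rw g != [::].
  by apply: contra g1 => /eqP e; rewrite -(rwK hS g) e wordprod_nil.
case/lastP E : (rw g) => [//|u j] _.
have := reduced_rw hS g; rewrite E -cats1 => /(reduced_catl hS).
rewrite /reduced => /eqP hu.
have : (len g <= len (g * 's_j)%g)%N.
  by rewrite ltnW // -pos_hact_simple hg pos_simple.
by rewrite -{2}(rwK hS g) E wordprod_rcons (srefKr hS) hu -size_rw E size_rcons ltnn.
Qed.

Lemma hact_inj g k : (forall v, hact g v = hact k v) -> g = k.
Proof.
move=> e; apply/eqP; rewrite eq_sym eq_mulVg1; apply/eqP/hact_faithful => v.
by rewrite (hactM hS) e (hactVK hS).
Qed.

Lemma root_refl_witness (v : h) : root v ->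
  exists g i, v = hact g (e_ i) /\ root_refl v = (g * 's_i * g^-1)%g.
Proof.
case/is_rootP => g [i e]; rewrite wrefl.unlock /Defs.root_refl; case: pickP => [[k j] /eqP /= ->|].
  by exists k, j; rewrite wact.unlock.
by move/(_ (g, i)); rewrite /= e wact.unlock eqxx.
Qed.

(** Invariance of the form turns the conjugated simple reflection into a formula in [v] alone. With
    faithfulness it shows that the presentation chosen by [root_refl] does not matter. *)
Lemma root_reflE (v x : h) : root v -> hact (root_refl v) x = x - (2 * B x v) *: v.
Proof.
case/root_refl_witness => g [i [-> ->]].
rewrite !(hactM hS) (hact_sref hS) /Defs.sact (hactD hS) (hactN hS) (hactZ hS).
by rewrite (hactKV hS) -[in RHS](hactKV hS g x) (bform_hact hS) (hactKV hS).
Qed.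

Lemma root_refl_self (v : h) : root v -> hact (root_refl v) v = - v.
Proof.
move=> rv; rewrite root_reflE // bform_root // mulr1 scaler_nat mulr2n opprD.
by rewrite addrA subrr add0r.
Qed.

Lemma root_refl_simple i : root_refl (e_ i) = 's_i.
Proof.
by apply: hact_inj => v; rewrite root_reflE ?root_simple // (hact_sref hS).
Qed.

Lemma root_reflN (v : h) : root v -> root_refl (- v) = root_refl v.
Proof.
move=> rv; apply: hact_inj => x; rewrite !root_reflE ?is_rootN //.
by rewrite (bformNr hS) mulrN scaleNr scalerN opprK.
Qed.

Lemma root_refl_hact g (v : h) : root v ->
  root_refl (hact g v) = (g * root_refl v * g^-1)%g.
Proof.
move=> rv; apply: hact_inj => x; rewrite !(hactM hS) !root_reflE ?is_root_hact //.
rewrite (hactD hS) (hactN hS) (hactZ hS) (hactKV hS).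
by rewrite -[in LHS](hactKV hS g x) (bform_hact hS) (hactKV hS).
Qed.

Lemma root_reflK (v : h) : root v -> (root_refl v * root_refl v = 1)%g.
Proof.
case/root_refl_witness => g [i [_ ->]].
by rewrite -!mulgA (mulgA g^-1%g) mulVg mul1g (srefKl hS) mulgV.
Qed.

Lemma root_reflV (v : h) : root v -> ((root_refl v)^-1 = root_refl v)%g.
Proof. by move=> rv; apply/eqP; rewrite eq_invg_mul root_reflK. Qed.

(** A simple reflection changes only the [i]-th coordinate. If the image were negative, all other
    coordinates of [v] would vanish, and a positive multiple of the simple root of norm 1 is the
    simple root itself. *)
Lemma pos_sact i (v : h) : root v -> pos v -> v != e_ i -> pos (sact i v).
Proof.
move=> rv pv nv; have rs : root (sact i v) by rewrite -(hact_sref hS) is_root_hact.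
case: (boolP (pos (sact i v))) => // np; case/negP: nv.
have pN : pos (- sact i v) by rewrite posN.
have vj j : j != i -> v j 0 = 0.
  move=> nj; apply/eqP; rewrite eq_le (posP _ pv j) andbT.
  have := posP _ pN j; rewrite /Defs.sact !mxE (negPf nj) /= mulr0 subr0.
  by rewrite oppr_ge0.
have ve : v = v i 0 *: e_ i.
  apply/colP => j; rewrite !mxE eqxx andbT; case: (eqVneq j i) => [->|/vj ->].
    by rewrite mulr1.
  by rewrite mulr0.
have := bform_root rv; rewrite ve bformZl (bformZr hS) (bform_simple1 R hS) mulr1 => c2.
have : (v i 0) ^+ 2 = 1 by rewrite expr2.
by move/eqP; rewrite sqrp_eq1 ?(posP _ pv) // => /eqP ->; rewrite scale1r.
Qed.

Lemma proot_root (a : proot R S) : root (val a).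
Proof. by have := valP a; rewrite is_prootE => /andP[]. Qed.

Lemma proot_pos (a : proot R S) : pos (val a).
Proof. by have := valP a; rewrite is_prootE => /andP[]. Qed.

End RootPositivity.

(** * Deletions and the longest element *)

Section Deletions.

Variables (R : realType) (gT : finGroupType) (S : {set gT}).
Hypothesis hS : coxeter_system S.

Local Notation C := R[i].
Local Notation len := (coxlen S).
Local Notation n := #|S|.
Local Notation h := 'cV[R]_n.
Local Notation rw := (redword (@sref gT S)).
Local Notation wprod := (wordprod (@sref gT S)).
Local Notation "'s_ i" := (@sref gT S i) (at level 0, i at level 0, format "''s_' i").
Local Notation e_ := (simple_root R).
Local Notation sact := (@sact R gT S).
Local Notation hact := (@wact R gT S).
Local Notation root := (@wroot R gT S).
Local Notation root_refl := (@wrefl R gT S).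

Local Notation w0 := (longest S).

(** The coefficient of x_a in x_c, for roots of either sign under x_(-c) = - x_c. *)
Definition pairing (a c : h) : C := (c == a)%:R - (c == - a)%:R.

Lemma pairingC (a c : h) : pairing a c = pairing c a.
Proof. by rewrite /pairing (eq_sym a c) (eq_sym a (- c)) eqr_oppLR. Qed.

Lemma pairingNr (a c : h) : pairing a (- c) = - pairing a c.
Proof. by rewrite /pairing eqr_opp eqr_oppLR opprB. Qed.

Lemma pairingNl (a c : h) : pairing (- a) c = - pairing a c.
Proof. by rewrite pairingC pairingNr pairingC. Qed.

Lemma pairing_hact g (a c : h) : pairing a (hact g c) = pairing (hact g^-1%g a) c.
Proof.
have e b : (hact g c == b) = (c == hact g^-1%g b).
  by apply/eqP/eqP => [<-|->]; rewrite ?(hactVK hS) ?(hactKV hS).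
by rewrite /pairing !e (hactN hS).
Qed.

Lemma pairing_neq0 (a c : h) : pairing a c != 0 -> c = a \/ c = - a.
Proof.
rewrite /pairing; case: (c =P a) => [-> _|_]; first by left.
by case: (c =P - a) => [-> _|_]; [right | rewrite subrr eqxx].
Qed.

Definition sgn_neg (v : h) : C := (~~ pos v)%:R.

Lemma sgn_neg_sact i (v : h) : root v ->
  sgn_neg (sact i v) - sgn_neg v = pairing (e_ i) v.
Proof.
move=> rv; rewrite /sgn_neg /pairing.
have pe := pos_simple R i; have re := root_simple R hS i.
have neN : - e_ i != e_ i by rewrite eq_sym (root_neqN hS).
case: (eqVneq v (e_ i)) => [->|ne].
  rewrite (sact_simple1 R hS) (posN hS) // pe /= subr0.
  by rewrite eq_sym (negPf neN) subr0.
case: (eqVneq v (- e_ i)) => [->|neN'].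
  by rewrite -scaleN1r (sactZ hS) (sact_simple1 R hS) !scaleN1r opprK (posN hS) // pe.
rewrite subr0; have rs : root (sact i v) by rewrite -(hact_sref hS) (is_root_hact hS).
case: (boolP (pos v)) => pv; first by rewrite (pos_sact hS) // subr0.
have pN : pos (- v) by rewrite (posN hS).
have : pos (sact i (- v)) by apply: (pos_sact hS); rewrite ?(is_rootN hS) // eqr_oppLR.
rewrite -scaleN1r (sactZ hS) scaleN1r (posN hS) // => /negPf ->.
by rewrite subrr.
Qed.

(** Each one-letter deletion is recorded with the image of the deleted simple root under the prefix
    before it; the reflection in this root, multiplied on the left, performs the deletion. *)
Fixpoint deletions (s : seq 'I_n) : seq (h * seq 'I_n) :=
  if s is i :: s' then
    (e_ i, s') :: [seq (sact i p.1, i :: p.2) | p <- deletions s']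
  else [::].

Lemma deletionsP s p : p \in deletions s ->
  [/\ root p.1, wprod p.2 = (root_refl p.1 * wprod s)%g & (size p.2).+1 = size s].
Proof.
elim: s p => //= i s IH p; rewrite inE => /orP[/eqP ->|/mapP [q /IH [rq eq sq] ->]] /=.
  by rewrite (root_simple R hS) (root_refl_simple R hS) wordprod_cons (srefKl hS).
rewrite -(hact_sref hS) (is_root_hact hS) // sq; split=> //.
rewrite (root_refl_hact hS) // !wordprod_cons eq (srefV hS).
by rewrite -!mulgA (srefKl hS).
Qed.

(* The sign of the roots [u_k^-1 (a)], for the prefixes [u_k] of [s], changes *)
(* exactly at the deletions whose root is [a] or [- a], so the sum telescopes. *)
Lemma sum_deletions s (a : h) : root a ->
  \sum_(p <- deletions s) pairing a p.1 =
    sgn_neg (hact (wprod s)^-1%g a) - sgn_neg a.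
Proof.
elim: s a => [|i s IH] a ra /=.
  by rewrite big_nil wordprod_nil invg1 (hact1 hS) subrr.
rewrite big_cons big_map /=.
under eq_bigr => p _ do rewrite -(hact_sref hS) pairing_hact (srefV hS).
rewrite IH ?(is_root_hact hS) // wordprod_cons invMg (srefV hS) (hactM hS).
rewrite pairingC pairingC pairingC -(sgn_neg_sact _ ra) (hact_sref hS).
by rewrite addrC addrA subrK.
Qed.

(** The strong exchange property: the sum in [sum_deletions] equals 1 here, so some deletion in a
    reduced word of [g] has root [a] or [- a]. *)
Lemma reflect_descent (a : h) g : root a -> pos a -> ~~ pos (hact g^-1%g a) ->
  (len (root_refl a * g)%g < len g)%N.
Proof.
move=> ra pa na; have := sum_deletions (rw g) ra; rewrite (rwK hS) /sgn_neg na pa subr0.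
have [|/hasPn no] := boolP (has (fun p => pairing a p.1 != 0) (deletions (rw g))).
  case/hasP => p /deletionsP [rp ep sp] /pairing_neq0 pa0 _.
  have <- : root_refl p.1 = root_refl a by case: pa0 => ->; rewrite ?(root_reflN hS).
  have := len_wprod hS p.2; rewrite ep (rwK hS) => l.
  by rewrite (leq_ltn_trans l) // -ltnS sp size_rw.
rewrite big_seq big1 => [/eqP|p /no /negPn/eqP //].
by rewrite eq_sym oner_eq0.
Qed.

Lemma reflect_ascent (a : h) g : root a -> pos a -> pos (hact g^-1%g a) ->
  (len g < len (root_refl a * g)%g)%N.
Proof.
move=> ra pa pga.
have := @reflect_descent a (root_refl a * g)%g ra pa.
rewrite invMg (root_reflV hS) // (hactM hS) (root_refl_self hS) // (hactN hS).
rewrite (posN hS) ?(is_root_hact hS) // pga => /(_ isT).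
by rewrite mulgA (root_reflK hS) // mul1g.
Qed.

Lemma len_sl_lt i g : (len ('s_i * g)%g < len g)%N = ~~ pos (hact g^-1%g (e_ i)).
Proof.
have re := root_simple R hS i.
have := @reflect_descent (e_ i) g re (pos_simple R i).
have := @reflect_ascent (e_ i) g re (pos_simple R i).
rewrite (root_refl_simple R hS); case: (pos _) => /= h1 h2.
  by apply/negbTE; rewrite -leqNgt ltnW // h1.
by rewrite h2.
Qed.

Lemma len_longest g : (len g <= len w0)%N.
Proof.
rewrite /longest; case: arg_maxnP => //= k _ hk; exact: hk.
Qed.

Lemma longest_simple i : ~~ pos (hact w0 (e_ i)).
Proof. by rewrite (pos_hact_simple R hS) -leqNgt len_longest. Qed.

(** By maximality the longest element makes every simple root negative, hence by linearity every
    positive root; the inverse is handled by applying this to the image of [v]. *)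
Lemma longest_pos (v : h) : root v -> pos (hact w0^-1%g v) = ~~ pos v.
Proof.
have key u : root u -> pos u -> ~~ pos (hact w0 u).
  move=> ru pu; rewrite -(posN hS) ?(is_root_hact hS) //.
  have -> : u = \sum_i u i 0 *: e_ i.
    rewrite [LHS]matrix_sum_delta; apply: eq_bigr => j _.
    by rewrite big_ord1.
  rewrite (big_morph (hact w0) (hactD hS w0) (hact0 R hS w0)).
  rewrite -sumrN; elim/big_rec: _ => [|j x _ px].
    by apply/posP => j; rewrite mxE.
  apply: posD px; rewrite (hactZ hS) -scalerN; apply: posZ; first exact: (posP _ pu).
  by rewrite (posN hS) ?longest_simple // (is_root_hact hS) // (root_simple R hS).
move=> rv; have rw : root (hact w0^-1%g v) by rewrite (is_root_hact hS).
apply/idP/idP => [p|np].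
  by have := key _ rw p; rewrite (hactKV hS).
rewrite -[pos _]negbK -(posN hS) // -(hactN hS); apply/negP => p.
have := key _ _ p; rewrite (hactKV hS) (is_root_hact hS) ?(is_rootN hS) // => /(_ isT).
by rewrite (posN hS) // np.
Qed.

(** A letter that lengthens [wprod s] from the left shortens [wprod s * w0], since [w0] exchanges
    the signs of roots. *)
Lemma len_mul_longest g : (len (g * w0)%g + len g = len w0)%N.
Proof.
have key s : reduced s -> (len (wprod s * w0)%g + size s = len w0)%N.
  elim: s => [|i s IH]; first by rewrite wordprod_nil mul1g addn0.
  rewrite (reduced_cons hS) => /andP[/IH {}IH lt].
  have h1 : pos (hact (wprod s)^-1%g (e_ i)).
    by have := len_sl_lt i (wprod s); move: lt; case: (pos _) => //; lia.
  have : ~~ pos (hact (wprod s * w0)^-1%g (e_ i)).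
    rewrite invMg (hactM hS) longest_pos ?h1 //.
    by rewrite (is_root_hact hS) // (root_simple R hS).
  rewrite -len_sl_lt wordprod_cons -mulgA => l.
  case: (len_sl hS i (wprod s * w0)%g) => e; move: l IH; rewrite e.
    by rewrite ltnNge leqnSn.
  by rewrite addSn addnS.
by have := key _ (reduced_rw hS g); rewrite (rwK hS) size_rw.
Qed.

End Deletions.

(** * Braided derivatives *)

(* The braided operations on T(V_W), abstracted from their construction: the *)
(* rewriting below is only practical on an algebra that does not compute.    *)
Record braided_algebra (R : realType) (gT : finGroupType) (S : {set gT}) :=
  BraidedAlgebra {
  br_alg :> lalgType R[i];
  br_gen : proot R S -> br_alg;
  br_xroot : 'cV[R]_#|S| -> br_alg;
  br_act : gT -> br_alg -> br_alg;
  br_deriv : 'cV[R]_#|S| -> br_alg -> br_alg;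
  br_rderiv : 'cV[R]_#|S| -> br_alg -> br_alg;
  br_bar : br_alg -> br_alg;
  br_eps : br_alg -> R[i];
  br_braid : nat -> br_alg -> br_alg;
  br_coef : seq (proot R S) -> br_alg -> R[i];
  br_scaleAr : forall c (x y : br_alg), x * (c *: y) = c *: (x * y);
  br_ind : forall Q : br_alg -> Prop, Q 1 -> (forall a t, Q t -> Q (br_gen a * t)) ->
    (forall c x y, Q x -> Q y -> Q (c *: x + y)) -> forall t, Q t;
  br_xroot_val : forall a, br_xroot (val a) = br_gen a;
  br_xrootN : forall v, wroot v -> br_xroot (- v) = - br_xroot v;
  br_actP : forall g c x y, br_act g (c *: x + y) = c *: br_act g x + br_act g y;
  br_actM : forall g x y, br_act g (x * y) = br_act g x * br_act g y;
  br_act1 : forall g, br_act g 1 = 1;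
  br_act_gen : forall g a, br_act g (br_gen a) = br_xroot (wact g (val a));
  br_derivP : forall a c x y,
    br_deriv a (c *: x + y) = c *: br_deriv a x + br_deriv a y;
  br_deriv1 : forall a, br_deriv a 1 = 0;
  br_deriv_genM : forall a c t, br_deriv a (br_gen c * t) =
    pairing a (val c) *: t + br_gen c * br_deriv (wact (wrefl (val c)) a) t;
  br_rderivP : forall a c x y,
    br_rderiv a (c *: x + y) = c *: br_rderiv a x + br_rderiv a y;
  br_rderiv1 : forall a, br_rderiv a 1 = 0;
  br_rderiv_genM : forall a c t, br_rderiv a (br_gen c * t) =
    pairing a (val c) *: br_act (wrefl (val c)) t + br_gen c * br_rderiv a t;
  br_barP : forall c x y, br_bar (c *: x + y) = c *: br_bar x + br_bar y;
  br_bar1 : br_bar 1 = 1;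
  br_bar_genM : forall c t,
    br_bar (br_gen c * t) = br_gen c * br_act (wrefl (val c)) (br_bar t);
  br_epsP : forall c x y, br_eps (c *: x + y) = c * br_eps x + br_eps y;
  br_eps1 : br_eps 1 = 1;
  br_eps_genM : forall c t, br_eps (br_gen c * t) = 0;
  br_braidP : forall i c x y,
    br_braid i (c *: x + y) = c *: br_braid i x + br_braid i y;
  br_braid0 : forall a c t, br_braid 0 (br_gen a * (br_gen c * t)) =
    br_xroot (wact (wrefl (val a)) (val c)) * (br_gen a * t);
  br_braidS : forall i c t, br_braid i.+1 (br_gen c * t) = br_gen c * br_braid i t;
  br_coefP : forall l c x y, br_coef l (c *: x + y) = c * br_coef l x + br_coef l y;
  br_coef_nil : forall t, br_coef [::] t = br_eps t;
  br_coef1 : forall a l, br_coef (a :: l) 1 = 0;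
  br_coef_genM : forall a l c t,
    br_coef (a :: l) (br_gen c * t) = (a == c)%:R * br_coef l t
}.

Arguments br_gen {R gT S b}.
Arguments br_xroot {R gT S b}.
Arguments br_act {R gT S b}.
Arguments br_deriv {R gT S b}.
Arguments br_rderiv {R gT S b}.
Arguments br_bar {R gT S b}.
Arguments br_eps {R gT S b}.
Arguments br_braid {R gT S b}.
Arguments br_coef {R gT S b}.

Lemma scale_exchange (F : comNzRingType) (V : lmodType F) (p k : F) (x y u w : V) :
  p *: (k *: x + y) + (k *: u + w) = k *: (p *: x + u) + (p *: y + w).
Proof. by rewrite !scalerDr !scalerA (mulrC k) addrACA. Qed.

Section LinearMaps.

Variables (F : nzRingType) (U V : lmodType F) (f : U -> V).
Hypothesis fP : forall c x y, f (c *: x + y) = c *: f x + f y.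

Lemma map_lin0 : f 0 = 0.
Proof. by have := fP (-1) 0 0; rewrite scaler0 addr0 scaleN1r addNr. Qed.

Lemma map_linD x y : f (x + y) = f x + f y.
Proof. by rewrite -[x]scale1r fP !scale1r. Qed.

Lemma map_linZ c x : f (c *: x) = c *: f x.
Proof. by rewrite -[c *: x]addr0 fP map_lin0 !addr0. Qed.

Lemma map_linN x : f (- x) = - f x.
Proof. by rewrite -!scaleN1r map_linZ. Qed.

Lemma map_lin_sum (I : Type) (r : seq I) (p : I -> F) (x : I -> U) :
  f (\sum_(i <- r) p i *: x i) = \sum_(i <- r) p i *: f (x i).
Proof.
by rewrite (big_morph f map_linD map_lin0); apply: eq_bigr => i _; rewrite map_linZ.
Qed.

End LinearMaps.

Section BraidedDerivatives.

Variables (R : realType) (gT : finGroupType) (S : {set gT}).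
Hypothesis hS : coxeter_system S.
Variable T : braided_algebra R S.

Local Notation C := R[i].
Local Notation h := 'cV[R]_#|S|.
Local Notation P := (proot R S).
Local Notation hact := (@wact R gT S).
Local Notation root := (@wroot R gT S).
Local Notation root_refl := (@wrefl R gT S).
Local Notation pr := (@pairing R gT S).
Local Notation xroot := (@br_xroot R gT S T).
Local Notation gen := (@br_gen R gT S T).
Local Notation tact := (@br_act R gT S T).
Local Notation deriv := (@br_deriv R gT S T).
Local Notation rderiv := (@br_rderiv R gT S T).
Local Notation tsbar := (@br_bar R gT S T).
Local Notation eps := (@br_eps R gT S T).

Definition br_actD g := map_linD (br_actP (b := T) g).
Definition br_actZ g := map_linZ (br_actP (b := T) g).
Definition br_actN g := map_linN (br_actP (b := T) g).
Definition br_act0 g := map_lin0 (br_actP (b := T) g).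
Definition br_derivD a := map_linD (br_derivP (b := T) a).
Definition br_derivZ a := map_linZ (br_derivP (b := T) a).
Definition br_derivN a := map_linN (br_derivP (b := T) a).
Definition br_deriv0 a := map_lin0 (br_derivP (b := T) a).
Definition br_rderivD a := map_linD (br_rderivP (b := T) a).
Definition br_rderivZ a := map_linZ (br_rderivP (b := T) a).
Definition br_rderiv_oppr a := map_linN (br_rderivP (b := T) a).
Definition br_rderiv0 a := map_lin0 (br_rderivP (b := T) a).
Definition br_barD := map_linD (br_barP (b := T)).
Definition br_barZ := map_linZ (br_barP (b := T)).
Definition br_barN := map_linN (br_barP (b := T)).
Definition br_bar0 := map_lin0 (br_barP (b := T)).
Definition br_braidN i := map_linN (br_braidP (b := T) i).
Definition br_coefD l : {morph br_coef (b := T) l : x y / x + y} :=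
  map_linD (V := C^o) (br_coefP l).
Definition br_coef0 l : br_coef (b := T) l 0 = 0 := map_lin0 (V := C^o) (br_coefP l).
Definition br_coefN l : {morph br_coef (b := T) l : x / - x} :=
  map_linN (V := C^o) (br_coefP l).
Definition br_epsD : {morph eps : x y / x + y} := map_linD (V := C^o) (br_epsP (b := T)).
Definition br_epsZ c x : eps (c *: x) = c * eps x :=
  map_linZ (V := C^o) (br_epsP (b := T)) c x.
Definition br_epsN : {morph eps : x / - x} := map_linN (V := C^o) (br_epsP (b := T)).
Definition br_eps0 : eps 0 = 0 := map_lin0 (V := C^o) (br_epsP (b := T)).

Variant xroot_spec (v : h) : T -> Prop :=
  | XrootPos a of v = val a : xroot_spec v (gen a)
  | XrootNeg a of v = - val a : xroot_spec v (- gen a).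

Lemma xroot_rootP (v : h) : root v -> xroot_spec v (xroot v).
Proof.
move=> rv; have pN := posN hS rv.
have mk u : root u -> pos u -> exists a : P, val a = u.
  move=> ru pu; have q : is_proot u by rewrite is_prootE ru.
  by exists (Sub u q).
case: (boolP (pos v)) pN => [pv _|_ pv].
  by have [a <-] := mk v rv pv; rewrite br_xroot_val; left.
have [|a ea] := mk (- v) _ pv; first by rewrite (is_rootN hS).
by rewrite -[v]opprK -ea br_xrootN ?ea ?(is_rootN hS) // -ea br_xroot_val; right.
Qed.

Lemma act_xroot g (v : h) : root v -> tact g (xroot v) = xroot (hact g v).
Proof.
move=> rv; case: (xroot_rootP rv) => a ->; first exact: br_act_gen.
by rewrite br_actN br_act_gen (hactN hS) br_xrootN // (is_root_hact hS) // proot_root.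
Qed.

Lemma act_comp g k (t : T) : tact (g * k)%g t = tact g (tact k t).
Proof.
elim/br_ind: t => [|a t IH|c x y IHx IHy]; first by rewrite !br_act1.
  by rewrite !br_actM IH !br_act_gen act_xroot ?(hactM hS) // (is_root_hact hS) // proot_root.
by rewrite !br_actP IHx IHy.
Qed.

Lemma act_id (t : T) : tact 1%g t = t.
Proof.
elim/br_ind: t => [|a t IH|c x y IHx IHy]; first by rewrite br_act1.
  by rewrite br_actM IH br_act_gen (hact1 hS) br_xroot_val.
by rewrite br_actP IHx IHy.
Qed.

Lemma deriv_xrootM (a v : h) t : root v -> deriv a (xroot v * t) =
  pr a v *: t + xroot v * deriv (hact (root_refl v) a) t.
Proof.
move=> rv; case: (xroot_rootP rv) => c ->; first exact: br_deriv_genM.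
by rewrite !mulNr br_derivN br_deriv_genM pairingNr (root_reflN hS) ?proot_root // scaleNr opprD.
Qed.

Lemma rderiv_xrootM (a v : h) t : root v -> rderiv a (xroot v * t) =
  pr a v *: tact (root_refl v) t + xroot v * rderiv a t.
Proof.
move=> rv; case: (xroot_rootP rv) => c ->; first exact: br_rderiv_genM.
rewrite !mulNr br_rderiv_oppr br_rderiv_genM pairingNr (root_reflN hS) ?proot_root //.
by rewrite scaleNr opprD.
Qed.

Lemma deriv_act (a : h) g t : deriv a (tact g t) = tact g (deriv (hact g^-1%g a) t).
Proof.
elim/br_ind: t a => [|c t IH|k x y IHx IHy] a.
- by rewrite br_act1 !br_deriv1 br_act0.
- have rc := proot_root c.
  rewrite br_actM br_act_gen deriv_xrootM ?(is_root_hact hS) // IH br_deriv_genM.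
  rewrite br_actD br_actZ br_actM br_act_gen (pairing_hact hS) (root_refl_hact hS) //.
  by rewrite -!(hactM hS) !mulgA mulVg mul1g.
- by rewrite br_actP !br_derivP IHx IHy br_actP.
Qed.

Lemma rderiv_act (a : h) g t : rderiv a (tact g t) = tact g (rderiv (hact g^-1%g a) t).
Proof.
elim/br_ind: t => [|c t IH|k x y IHx IHy].
- by rewrite br_act1 !br_rderiv1 br_act0.
- have rc := proot_root c.
  rewrite br_actM br_act_gen rderiv_xrootM ?(is_root_hact hS) // IH br_rderiv_genM.
  rewrite br_actD br_actZ br_actM br_act_gen (pairing_hact hS) (root_refl_hact hS) //.
  by rewrite -!act_comp mulgKV.
- by rewrite br_actP !br_rderivP IHx IHy br_actP.
Qed.

(** An instance of coassociativity: the two derivatives split off degree one parts at opposite ends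
    of the iterated coproduct. *)
Lemma deriv_rderiv (a b : h) t : deriv a (rderiv b t) = rderiv b (deriv a t).
Proof.
elim/br_ind: t a => [|c t IH|k x y IHx IHy] a.
- by rewrite br_rderiv1 br_deriv1 br_deriv0 br_rderiv0.
- rewrite br_rderiv_genM br_deriv_genM br_derivD br_rderivD br_derivZ br_rderivZ.
  rewrite br_deriv_genM br_rderiv_genM IH deriv_act (root_reflV hS) ?proot_root //.
  by rewrite addrCA.
- by rewrite br_rderivP !br_derivP br_rderivP IHx IHy.
Qed.

Lemma bar_xrootM (v : h) t : root v ->
  tsbar (xroot v * t) = xroot v * tact (root_refl v) (tsbar t).
Proof.
move=> rv; case: (xroot_rootP rv) => c ->; first exact: br_bar_genM.
by rewrite !mulNr br_barN br_bar_genM (root_reflN hS) ?proot_root.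
Qed.

Lemma bar_act g (t : T) : tsbar (tact g t) = tact g (tsbar t).
Proof.
elim/br_ind: t => [|c t IH|k x y IHx IHy].
- by rewrite br_act1 br_bar1 br_act1.
- have rc := proot_root c.
  rewrite br_actM br_act_gen bar_xrootM ?(is_root_hact hS) // IH br_bar_genM.
  by rewrite br_actM br_act_gen (root_refl_hact hS) // -!act_comp mulgKV.
- by rewrite br_actP !br_barP IHx IHy br_actP.
Qed.

(** In bar(x_c t) = x_c (s_c bar(t)), the twist of [a] by s_c in the left Leibniz rule cancels
    against the action of s_c, which leaves the right Leibniz rule. *)
Lemma deriv_bar (a : h) (t : T) : deriv a (tsbar t) = tsbar (rderiv a t).
Proof.
elim/br_ind: t a => [|c t IH|k x y IHx IHy] a.
- by rewrite br_bar1 br_deriv1 br_rderiv1 br_bar0.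
- have rc := proot_root c.
  rewrite br_bar_genM br_rderiv_genM br_barD br_barZ br_bar_genM bar_act br_deriv_genM.
  by rewrite deriv_act (root_reflV hS) // -(hactM hS) (root_reflK hS) // (hact1 hS) IH.
- by rewrite br_barP br_derivP br_rderivP br_barP IHx IHy.
Qed.

Lemma eps_xrootM (v : h) t : root v -> eps (xroot v * t) = 0.
Proof.
move=> rv; case: (xroot_rootP rv) => c _; first exact: br_eps_genM.
by rewrite mulNr br_epsN br_eps_genM oppr0.
Qed.

Lemma eps_act g t : eps (tact g t) = eps t.
Proof.
elim/br_ind: t => [|c t IH|k x y IHx IHy]; first by rewrite br_act1.
  by rewrite br_actM br_act_gen eps_xrootM ?br_eps_genM // (is_root_hact hS) // proot_root.
by rewrite br_actP !br_epsP IHx IHy.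
Qed.

Lemma eps_bar t : eps (tsbar t) = eps t.
Proof.
elim/br_ind: t => [|c t IH|k x y IHx IHy]; first by rewrite br_bar1.
  by rewrite br_bar_genM !br_eps_genM.
by rewrite br_barP !br_epsP IHx IHy.
Qed.

Lemma eps_rderiv (a : h) t : eps (rderiv a t) = eps (deriv a t).
Proof.
elim/br_ind: t => [|c t IH|k x y IHx IHy]; first by rewrite br_rderiv1 br_deriv1.
  by rewrite br_rderiv_genM br_deriv_genM !br_epsD !br_epsZ !br_eps_genM eps_act.
by rewrite br_rderivP br_derivP !br_epsP IHx IHy.
Qed.

Fixpoint deriv_seq (l : seq P) (t : T) : T :=
  if l is a :: l' then deriv_seq l' (deriv (val a) t) else t.

(** The functionals that test equality in the Nichols algebra; the first root of [l] is
    differentiated first. *)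
Definition eps_deriv (l : seq P) (t : T) : C := eps (deriv_seq l t).

Lemma eps_derivP l c x y :
  eps_deriv l (c *: x + y) = c * eps_deriv l x + eps_deriv l y.
Proof.
rewrite /eps_deriv.
by elim: l x y => [|a l IH] x y /=; rewrite ?br_derivP ?IH ?br_epsP.
Qed.

Definition eps_derivD l : {morph eps_deriv l : x y / x + y} :=
  map_linD (V := C^o) (eps_derivP l).
Definition eps_deriv0 l : eps_deriv l 0 = 0 := map_lin0 (V := C^o) (eps_derivP l).
Definition eps_derivN l : {morph eps_deriv l : x / - x} :=
  map_linN (V := C^o) (eps_derivP l).
Definition eps_derivZ l c x : eps_deriv l (c *: x) = c * eps_deriv l x :=
  map_linZ (V := C^o) (eps_derivP l) c x.

Lemma eps_deriv_nil t : eps_deriv [::] t = eps t.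
Proof. by []. Qed.

Lemma eps_deriv_cons a l t : eps_deriv (a :: l) t = eps_deriv l (deriv (val a) t).
Proof. by []. Qed.

(** The right derivative commutes past all left ones; applied last, under the constant term, it
    agrees with the left derivative. *)
Lemma eps_deriv_rderiv l (a : P) t :
  eps_deriv l (rderiv (val a) t) = eps_deriv (rcons l a) t.
Proof.
elim: l t => [|b l IH] t /=; first by rewrite /eps_deriv /= eps_rderiv.
by rewrite !eps_deriv_cons deriv_rderiv IH.
Qed.

(** Bar permutes the test functionals, which is why it descends to the Nichols algebra. *)
Lemma eps_deriv_bar l t : eps_deriv l (tsbar t) = eps_deriv (rev l) t.
Proof.
elim: l t => [|a l IH] t; first by rewrite /eps_deriv /= eps_bar.
by rewrite eps_deriv_cons deriv_bar IH eps_deriv_rderiv rev_cons.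
Qed.

End BraidedDerivatives.

(** * Skew elements *)

Section SkewElements.

Variables (R : realType) (gT : finGroupType) (S : {set gT}).
Hypothesis hS : coxeter_system S.
Variable T : braided_algebra R S.

Local Notation C := R[i].
Local Notation n := #|S|.
Local Notation h := 'cV[R]_n.
Local Notation P := (proot R S).
Local Notation len := (coxlen S).
Local Notation rw := (redword (@sref gT S)).
Local Notation wprod := (wordprod (@sref gT S)).
Local Notation "'s_ i" := (@sref gT S i) (at level 0, i at level 0, format "''s_' i").
Local Notation e_ := (simple_root R).
Local Notation sact := (@sact R gT S).
Local Notation hact := (@wact R gT S).
Local Notation root := (@wroot R gT S).
Local Notation root_refl := (@wrefl R gT S).
Local Notation pr := (@pairing R gT S).
Local Notation xroot := (@br_xroot R gT S T).
Local Notation tact := (@br_act R gT S T).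
Local Notation deriv := (@br_deriv R gT S T).
Local Notation rderiv := (@br_rderiv R gT S T).
Local Notation eps := (@br_eps R gT S T).
Local Notation eps_deriv := (@eps_deriv R gT S T).

Definition xword (s : seq 'I_n) : T := \prod_(i <- s) xroot (e_ i).

Lemma xword_cons i s : xword (i :: s) = xroot (e_ i) * xword s.
Proof. exact: big_cons. Qed.

(* A lift of x_(w/v) along the word [s] of w, read off from                   *)
(* Delta(x_i t) = (x_i (x) 1 + 1 (x) x_i) Delta(t).                           *)
Fixpoint skew_word (s : seq 'I_n) (v : gT) : T :=
  if s is i :: s' then
    xroot (e_ i) * skew_word s' v
      + (if (len ('s_i * v)%g < len v)%N then tact 's_i (skew_word s' ('s_i * v)%g)
         else 0)
  else (v == 1%g)%:R.

Lemma skew_word_cons i s v : skew_word (i :: s) v =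
  xroot (e_ i) * skew_word s v
    + (if (len ('s_i * v)%g < len v)%N then tact 's_i (skew_word s ('s_i * v)%g)
       else 0).
Proof. by []. Qed.

(** Only the empty word has a constant term. The value is put in the form required of a deletion
    family, using that a reduced word of 1 is empty. *)
Lemma eps_xword s : eps (xword s) = (reduced s)%:R * (wprod s == 1%g)%:R.
Proof.
case: s => [|i s].
  by rewrite /xword big_nil br_eps1 /reduced wordprod_nil (len1 hS) !eqxx mulr1.
rewrite xword_cons (eps_xrootM hS) ?(root_simple R hS) //.
case: eqP => [e|_]; last by rewrite mulr0.
by rewrite /reduced e (len1 hS) mul0r.
Qed.

Lemma eps_skew_word s v : eps (skew_word s v) = (reduced s)%:R * (wprod s == v)%:R.
Proof.
elim: s v => [|i s IH] v /=.
  rewrite /reduced wordprod_nil (len1 hS) mul1r eq_sym.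
  by case: eqP => _; rewrite ?br_eps1 ?br_eps0.
rewrite br_epsD (eps_xrootM hS) ?(root_simple R hS) // add0r.
have ev : (wprod (i :: s) == v) = (wprod s == ('s_i * v)%g).
  rewrite wordprod_cons; apply/eqP/eqP => [<-|->]; by rewrite (srefKl hS).
rewrite ev (reduced_cons hS).
case: ifP => lt; last first.
  rewrite br_eps0; case: eqP => [e|_]; rewrite ?mulr0 //.
  by rewrite e (srefKl hS) lt andbF mul0r.
rewrite (eps_act hS) IH; case: eqP => [e|_]; rewrite ?mulr0 //.
by rewrite e (srefKl hS) lt andbT.
Qed.

(** The property shared by [xword] and [skew_word] from which their left derivatives are computed
    together. *)
Definition deletion_rule (A : seq 'I_n -> T) := forall s a, root a ->
  deriv a (A s) = \sum_(p <- deletions R s) pr a p.1 *: A p.2.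

Lemma xword_deletion_rule : deletion_rule xword.
Proof.
elim=> [|i s IH] a ra; first by rewrite /xword big_nil br_deriv1 big_nil.
have re := root_simple R hS i.
rewrite xword_cons (deriv_xrootM hS) // IH ?(is_root_hact hS) //= big_cons big_map /=.
congr (_ + _); rewrite mulr_sumr; apply: eq_bigr => p _.
rewrite br_scaleAr xword_cons (root_refl_simple R hS) -{1}(srefV hS).
by rewrite -(pairing_hact hS) (hact_sref hS).
Qed.

Lemma skew_word_deletion_rule v : deletion_rule (skew_word^~ v).
Proof.
move=> s; elim: s v => [|i s IH] v a ra /=.
  by rewrite big_nil -[_%:R]scaler_nat br_derivZ br_deriv1 scaler0.
have re := root_simple R hS i.
have E u : deriv (hact 's_i a) (skew_word s u) =
    \sum_(p <- deletions R s) pr a (sact i p.1) *: skew_word p.2 u.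
  rewrite IH ?(is_root_hact hS) //; apply: eq_bigr => p _.
  by rewrite -(hact_sref hS) (pairing_hact hS) (srefV hS).
rewrite br_derivD (deriv_xrootM hS) // (root_refl_simple R hS) E big_cons big_map /=.
rewrite -addrA; congr (_ + _); under [RHS]eq_bigr => p _ do rewrite scalerDr.
rewrite big_split /= mulr_sumr; congr (_ + _).
  by apply: eq_bigr => p _; rewrite br_scaleAr.
case: ifP => _; last by rewrite br_deriv0 big1 // => p _; rewrite scaler0.
by rewrite (deriv_act hS) (srefV hS) E (map_lin_sum (br_actP (b := T) _)).
Qed.

Section DeletionFamily.

Variables (A : seq 'I_n -> T) (c : gT -> C).
Hypothesis delA : deletion_rule A.
Hypothesis epsA : forall s, eps (A s) = (reduced s)%:R * c (wprod s).

(** Only deletions with root [a] or [- a] contribute. They all spell s_a w, so by the assumption on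
    [l] they share one value, and their signs add up by [sum_deletions]. *)
Lemma eps_deriv_cons_family (a : P) l s :
  (forall s, eps_deriv l (A s) = (reduced s)%:R * eps_deriv l (A (rw (wprod s)))) ->
  eps_deriv (a :: l) (A s) =
    (~~ pos (hact (wprod s)^-1%g (val a)))%:R *
    ((len (root_refl (val a) * wprod s)%g).+1 == size s)%:R *
    eps_deriv l (A (rw (root_refl (val a) * wprod s)%g)).
Proof.
move=> IH; have ra := proot_root a.
rewrite eps_deriv_cons delA // (map_lin_sum (V := C^o) (eps_derivP l)).
have := sum_deletions hS s ra; rewrite /sgn_neg (proot_pos a) subr0 => <-.
rewrite !mulr_suml big_seq [RHS]big_seq; apply: eq_bigr => p /(deletionsP hS) [rp ep sp].
rewrite -mulrA; case: (eqVneq (pr (val a) p.1) 0) => [->|pn].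
  by rewrite scale0r mul0r.
have <- : root_refl p.1 = root_refl (val a).
  by case: (pairing_neq0 pn) => ->; rewrite ?(root_reflN hS).
by rewrite -ep IH /reduced -sp eqSS.
Qed.

(** The braid relations and the vanishing of non-reduced words, as seen by the functionals. *)
Lemma eps_deriv_family l s :
  eps_deriv l (A s) = (reduced s)%:R * eps_deriv l (A (rw (wprod s))).
Proof.
elim: l s => [|a l IH] s.
  by rewrite !eps_deriv_nil !epsA (rwK hS) (reduced_rw hS) mul1r.
rewrite !eps_deriv_cons_family // (rwK hS) size_rw.
set g := wprod s; case: (boolP (pos _)) => np; first by rewrite !mul0r mulr0.
rewrite !mul1r /reduced -/g; case: (eqVneq (len g) (size s)) => [->|ng].
  by rewrite mul1r.
(* For a non-reduced word both sides vanish: s_a g is shorter than g, and g is shorter than the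
   word, so the required equality of lengths fails. *)
have lt := reflect_descent hS (proot_root a) (proot_pos a) np.
have le := len_wprod hS s; rewrite -/g in le.
by case: eqP => [e|]; rewrite ?mul0r //; move: ng; rewrite eqn_leq le -e lt.
Qed.

Lemma eps_deriv_rw (a : P) l g : eps_deriv (a :: l) (A (rw g)) =
  ((len (root_refl (val a) * g)%g).+1 == len g)%:R *
    eps_deriv l (A (rw (root_refl (val a) * g)%g)).
Proof.
rewrite eps_deriv_cons_family ?(rwK hS) ?size_rw; last exact: eps_deriv_family.
case: (boolP (pos _)) => np /=; rewrite ?mul1r // !mul0r.
have lt := reflect_ascent hS (proot_root a) (proot_pos a) np.
by case: eqP => [e|]; rewrite ?mul0r //; move: lt; rewrite -e ltnNge leqnSn.
Qed.

End DeletionFamily.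

Lemma br_rderivN (a : h) (t : T) : rderiv (- a) t = - rderiv a t.
Proof.
elim/br_ind: t => [|c t IH|k x y IHx IHy]; first by rewrite !br_rderiv1 oppr0.
  by rewrite !br_rderiv_genM pairingNl IH scaleNr mulrN opprD.
by rewrite !br_rderivP IHx IHy scalerN opprD.
Qed.

(** Apart from the simple root itself, s_i preserves the positivity of [a], so [v] and s_i v are
    moved by their reflections in the same direction. Parity and length steps of one leave only this
    case distinction. *)
Lemma cover_swap i (a : h) v : root a -> pos a -> a != e_ i ->
  (len ('s_i * v)%g < len v)%N &&
    (len ('s_i * (root_refl a * v))%g == (len ('s_i * v)%g).+1) =
  (len (root_refl a * v)%g == (len v).+1) &&
    (len ('s_i * (root_refl a * v))%g < len (root_refl a * v)%g)%N.
Proof.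
move=> ra pa na; have rs : root (sact i a) by rewrite -(hact_sref hS) (is_root_hact hS).
have ps := pos_sact hS ra pa na.
have e1 : ('s_i * (root_refl a * v) = root_refl (sact i a) * ('s_i * v))%g.
  by rewrite -(hact_sref hS) (root_refl_hact hS) // (srefV hS) -!mulgA (srefKl hS).
have e2 : hact ('s_i * v)^-1%g (sact i a) = hact v^-1%g a.
  by rewrite invMg (hactM hS) -(hact_sref hS) (hactVK hS).
have l1 := len_sl hS i v; have l2 := len_sl hS i (root_refl a * v)%g.
have := reflect_ascent hS (g := v) ra pa; have := reflect_descent hS (g := v) ra pa.
have := reflect_ascent hS (g := 's_i * v)%g rs ps.
have := reflect_descent hS (g := 's_i * v)%g rs ps.
rewrite e2 -e1; move: l1 l2.
move: (len ('s_i * v)%g) (len v) (len ('s_i * (root_refl a * v))%g) (len (root_refl a * v)%g).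
move=> p q r s l1 l2; case: (pos _) => /= h1 h2 h3 h4.
  by move: (h2 isT) (h4 isT) l1 l2 => {h1 h2 h3 h4} h2 h4 l1 l2; apply/idP/idP; lia.
by move: (h1 isT) (h3 isT) l1 l2 => {h1 h2 h3 h4} h1 h3 l1 l2; apply/idP/idP; lia.
Qed.

(** This holds in the tensor algebra itself, by induction on the word. For [a] simple equal to the
    first letter it is a direct computation; otherwise [cover_swap] matches the two terms of the
    recursion. *)
Lemma rderiv_skew_word (a : P) s v : rderiv (val a) (skew_word s v) =
  (len (root_refl (val a) * v)%g == (len v).+1)%:R *: skew_word s (root_refl (val a) * v)%g.
Proof.
elim: s a v => [|i s IH] a v.
  rewrite /skew_word.
  have -> : rderiv (val a) (v == 1%g)%:R = 0 :> T.
    by rewrite -[_%:R]scaler_nat br_rderivZ br_rderiv1 scaler0.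
  case: (_ =P 1%g) => [e|_]; last by rewrite scaler0.
  by rewrite e (len1 hS) scale0r.
have [ra pa] := (proot_root a, proot_pos a).
have [re pe] := (root_simple R hS i, pos_simple R i).
rewrite !skew_word_cons br_rderivD (rderiv_xrootM hS) // (root_refl_simple R hS) IH br_scaleAr.
case: (eqVneq (val a) (e_ i)) => [ea|na].
  rewrite ea (root_refl_simple R hS) (srefKl hS).
  have -> : pr (e_ i) (e_ i) = 1.
    by rewrite /pairing eqxx (negPf (root_neqN hS re)) subr0.
  have r' u : rderiv (- e_ i) (skew_word s u) =
      - ((len ('s_i * u)%g == (len u).+1)%:R *: skew_word s ('s_i * u)%g).
    by rewrite br_rderivN -ea IH ea (root_refl_simple R hS).
  rewrite scale1r; case: (len_sl hS i v) => e.
    rewrite e ltnNge leqnSn /= br_rderiv0 addr0 eqxx ltnSn !scale1r.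
    by rewrite addrC.
  (* If s_i v is shorter than v, the derivative of the leading x_i cancels the derivative of the
     twisted term, because s_i negates its simple root. *)
  rewrite e ltnSn (rderiv_act hS) (srefV hS) (hact_sref hS) (sact_simple1 R hS) r'.
  rewrite (srefKl hS) -e eqxx scale1r br_actN e.
  have -> : (len ('s_i * v)%g == (len ('s_i * v)%g).+2) = false.
    by apply/negbTE; rewrite neq_ltn ltnW.
  by rewrite !scale0r addr0 subrr.
have -> : pr (val a) (e_ i) = 0.
  rewrite /pairing (eq_sym _ (val a)) (negPf na) eq_sym.
  case: eqP => [e|]; last by rewrite subrr.
  by have := posN hS ra; rewrite e pe pa.
have rs : root (sact i (val a)) by rewrite -(hact_sref hS) (is_root_hact hS).
have ps := pos_sact hS ra pa na.
have pb : is_proot (sact i (val a)) by rewrite is_prootE rs.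
pose b : P := Sub _ pb.
rewrite scale0r add0r scalerDr; congr (_ + _).
have eb : (root_refl (val b) * ('s_i * v) = 's_i * (root_refl (val a) * v))%g.
  by rewrite SubK -(hact_sref hS) (root_refl_hact hS) // (srefV hS) -!mulgA (srefKl hS).
have cs := cover_swap v ra pa na.
case: ifP cs => lt /= cs; last first.
  case: eqP cs => e cs; last by rewrite scale0r br_rderiv0.
  by move: cs; rewrite /= => <-; rewrite scaler0 br_rderiv0.
rewrite (rderiv_act hS) (srefV hS) (hact_sref hS) -[sact i _]/(val b) IH eb br_actZ cs.
by case: (_ == _); case: (_ < _)%N; rewrite /= ?scale1r ?scale0r ?scaler0.
Qed.

End SkewElements.

(** * Duality, positivity and the coproduct expansion of skew elements *)

Section SkewIdentities.

Variables (R : realType) (gT : finGroupType) (S : {set gT}).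
Hypothesis hS : coxeter_system S.
Variable T : braided_algebra R S.

Local Notation C := R[i].
Local Notation n := #|S|.
Local Notation P := (proot R S).
Local Notation len := (coxlen S).
Local Notation rw := (redword (@sref gT S)).
Local Notation wprod := (wordprod (@sref gT S)).
Local Notation "'s_ i" := (@sref gT S i) (at level 0, i at level 0, format "''s_' i").
Local Notation e_ := (simple_root R).
Local Notation hact := (@wact R gT S).
Local Notation root := (@wroot R gT S).
Local Notation root_refl := (@wrefl R gT S).
Local Notation xroot := (@br_xroot R gT S T).
Local Notation gen := (@br_gen R gT S T).
Local Notation tact := (@br_act R gT S T).
Local Notation tsbar := (@br_bar R gT S T).
Local Notation eps := (@br_eps R gT S T).
Local Notation eps_deriv := (@eps_deriv R gT S T).
Local Notation w0 := (longest S).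
Local Notation skew_word := (@skew_word R gT S T).
Local Notation xword := (@xword R gT S T).

Lemma eps_deriv_skew_rw (a : P) l w v : eps_deriv (a :: l) (skew_word (rw w) v) =
  ((len (root_refl (val a) * w)%g).+1 == len w)%:R *
    eps_deriv l (skew_word (rw (root_refl (val a) * w)%g) v).
Proof.
exact: (eps_deriv_rw hS (@skew_word_deletion_rule _ _ _ hS T v)
         (c := fun g => (g == v)%:R) (eps_skew_word hS T ^~ v)).
Qed.

Lemma eps_deriv_xword_rw (a : P) l w : eps_deriv (a :: l) (xword (rw w)) =
  ((len (root_refl (val a) * w)%g).+1 == len w)%:R *
    eps_deriv l (xword (rw (root_refl (val a) * w)%g)).
Proof.
exact: (eps_deriv_rw hS (@xword_deletion_rule _ _ _ hS T)
         (c := fun g => (g == 1%g)%:R) (eps_xword hS T)).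
Qed.

Lemma eps_deriv_xword l s :
  eps_deriv l (xword s) = (reduced s)%:R * eps_deriv l (xword (rw (wprod s))).
Proof.
exact: (eps_deriv_family hS (@xword_deletion_rule _ _ _ hS T)
         (c := fun g => (g == 1%g)%:R) (eps_xword hS T)).
Qed.

Lemma eps_skew_rw w v : eps (skew_word (rw w) v) = (w == v)%:R.
Proof. by rewrite (eps_skew_word hS) (rwK hS) (reduced_rw hS) mul1r. Qed.

(** The left side moves [w] down by s_a; on the right side bar turns the derivative into a right
    one, which moves [w * w0] up by the same s_a. At the end of [l] both constant terms test whether
    [w] equals [v]. *)
Lemma eps_deriv_skew_longest l w v : eps_deriv l (skew_word (rw w) v) =
  eps_deriv l (tsbar (skew_word (rw (v * w0)%g) (w * w0)%g)).
Proof.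
elim: l w => [|a l IH] w.
  rewrite !eps_deriv_nil eps_bar !eps_skew_rw eq_sym; congr (_%:R).
  by rewrite (inj_eq (mulIg w0)).
rewrite eps_deriv_skew_rw eps_deriv_cons (deriv_bar hS) (rderiv_skew_word hS).
rewrite br_barZ eps_derivZ mulgA -IH; congr (_%:R * _).
(* Complementing lengths in [w0] makes the drop at [w] and the rise at [w * w0] the same
   condition. *)
have h1 := len_mul_longest R hS w.
have h2 := len_mul_longest R hS (root_refl (val a) * w)%g.
move: h1 h2.
move: (len (w * w0)%g) (len w) (len (root_refl (val a) * w * w0)%g).
move: (len (root_refl (val a) * w)%g) (len w0) => s t p q r h1 h2; apply/eqP/eqP; lia.
Qed.

Lemma bruhat_refl_mul (a : P) v w : (len (root_refl (val a) * w)%g < len w)%N ->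
  bruhat S v (root_refl (val a) * w)%g -> bruhat S v w.
Proof.
move=> lt bv; apply: connect_trans bv (connect1 _).
have [g [i [_ e]]] := root_refl_witness (proot_root a).
(* Bruhat steps multiply on the right, so the reflection is w^-1 s_a w, with s_a written as a
   conjugate of a simple reflection. *)
apply/exists_inP; exists ('s_i ^ (g^-1 * w))%g.
  by apply/imset2P; exists 's_i (g^-1 * w)%g; rewrite ?sref_in ?inE.
by rewrite lt andbT e conjgE invMg invgK !mulgA mulgK mulgKV (srefKr hS) mulgV mul1g.
Qed.

(** Every surviving derivative moves [w] down in the Bruhat order, and a nonzero constant term
    requires reaching [v]. *)
Lemma skew_bruhat l w v : ~~ bruhat S v w -> eps_deriv l (skew_word (rw w) v) = 0.
Proof.
elim: l w => [|a l IH] w nb.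
  rewrite eps_deriv_nil eps_skew_rw; case: eqP => // e.
  by move: nb; rewrite e /bruhat connect0.
rewrite eps_deriv_skew_rw; case: eqP => [e|_]; last by rewrite mul0r.
rewrite IH ?mulr0 //; apply: contra nb; apply: bruhat_refl_mul.
by rewrite -e.
Qed.

Definition br_positive (t : T) : Prop := exists l : seq (nat * seq P),
  t = \sum_(p <- l) (\prod_(a <- p.2) gen a) *+ p.1.

Lemma br_positive0 : br_positive 0.
Proof. by exists [::]; rewrite big_nil. Qed.

Lemma br_positive1 : br_positive 1.
Proof. by exists [:: (1%N, [::])]; rewrite big_seq1 big_nil. Qed.

Lemma br_positiveD x y : br_positive x -> br_positive y -> br_positive (x + y).
Proof. by move=> [l ->] [k ->]; exists (l ++ k); rewrite big_cat. Qed.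

Lemma br_positive_genM a x : br_positive x -> br_positive (gen a * x).
Proof.
move=> [l ->]; exists [seq (p.1, a :: p.2) | p <- l].
rewrite mulr_sumr big_map; apply: eq_bigr => p _.
by rewrite big_cons mulrnAr.
Qed.

(** The group element collects the letters already read: whether a letter is kept or dropped, [g]
    becomes g s_i. Additivity of lengths makes g send the simple root of the next letter to a
    positive root. *)
Lemma positive_bar_skew g s v : len (g * wprod s)%g = (len g + size s)%N ->
  br_positive (tact g (tsbar (skew_word s v))).
Proof.
elim: s g v => [|i s IH] g v /=.
  move=> _; case: eqP => _ /=; last first.
    by rewrite br_bar0 br_act0; apply: br_positive0.
  by rewrite br_bar1 br_act1; apply: br_positive1.
rewrite wordprod_cons mulgA => lg.
have re := root_simple R hS i.
have lgi : len (g * 's_i)%g = (len g).+1.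
  case: (len_sr hS i g) => // e.
  have := lenM hS (g * 's_i)%g (wprod s); rewrite lg e /=.
  have := len_wprod hS s.
  by move: (len (g * 's_i)%g) (len (wprod s)) (size s) => p q r; lia.
have lgs : len (g * 's_i * wprod s)%g = (len (g * 's_i)%g + size s)%N.
  by rewrite lg lgi addnS.
have pg : is_proot (hact g (e_ i)).
  by rewrite is_prootE (is_root_hact hS) // (pos_hact_simple R hS) lgi /=.
rewrite br_barD (bar_xrootM hS) // br_actD br_actM (act_xroot hS) //.
rewrite (root_refl_simple R hS) -(act_comp hS) -[hact g _]/(val (Sub _ pg : P)).
apply: br_positiveD; first by rewrite br_xroot_val; apply/br_positive_genM/IH.
case: ifP => _; last by rewrite br_bar0 br_act0; apply: br_positive0.
by rewrite (bar_act hS) -(act_comp hS); apply: IH.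
Qed.

Lemma is_proot_simple (i : 'I_n) : is_proot (e_ i).
Proof. by rewrite is_prootE (root_simple R hS) pos_simple. Qed.

Definition simple_proot (i : 'I_n) : P := Sub (e_ i) (is_proot_simple i).

(** Differentiating along the simple roots of a reduced word strips its letters one by one, which
    gives functionals dual to the x_w. *)
Lemma eps_deriv_simple s w : reduced s ->
  eps_deriv (map simple_proot s) (xword (rw w)) = (wprod s == w)%:R.
Proof.
elim: s w => [|i s IH] w.
  rewrite eps_deriv_nil (eps_xword hS) (rwK hS) (reduced_rw hS) mul1r wordprod_nil.
  by rewrite eq_sym.
rewrite (reduced_cons hS) => /andP[red lt]; rewrite eps_deriv_xword_rw.
have -> : root_refl (val (simple_proot i)) = 's_i by rewrite (root_refl_simple R hS).
rewrite IH // wordprod_cons.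
have -> : (wprod s == 's_i * w)%g = ('s_i * wprod s == w)%g.
  by apply/eqP/eqP => [->|<-]; rewrite (srefKl hS).
case: (_ =P w) => [<-|_]; last by rewrite mulr0.
rewrite (srefKl hS) mulr1; case: (len_sl hS i (wprod s)) => e; first by rewrite e eqxx.
by move: lt; rewrite e ltnNge leqnSn.
Qed.

(** The coproduct of x_w in dual form. Both sides follow the same deletion rule in [l1]; for [l1]
    empty the sum collapses to the product of the word. *)
Lemma eps_deriv_coprod l1 l2 s : eps_deriv (l1 ++ l2) (xword s) =
  \sum_v eps_deriv l1 (skew_word s v) * eps_deriv l2 (xword (rw v)).
Proof.
elim: l1 s => [|a l IH] s.
  rewrite eps_deriv_xword (bigD1 (wprod s)) //= big1 => [|v nv].
    by rewrite eps_deriv_nil (eps_skew_word hS) eqxx mulr1 addr0.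
  by rewrite eps_deriv_nil (eps_skew_word hS) eq_sym (negPf nv) mulr0 mul0r.
have ra := proot_root a.
rewrite cat_cons eps_deriv_cons (xword_deletion_rule hS) //.
rewrite (map_lin_sum (V := C^o) (eps_derivP _)).
under eq_bigr => p _ do rewrite IH.
under [RHS]eq_bigr => v _ do
  rewrite eps_deriv_cons (skew_word_deletion_rule hS) //
    (map_lin_sum (V := C^o) (eps_derivP _)) mulr_suml.
rewrite exchange_big; apply: eq_bigr => p _; rewrite scaler_sumr.
by apply: eq_bigr => v _; rewrite -scalerAl.
Qed.

End SkewIdentities.

(** * The braided factorial *)

Section Inversions.

Fixpoint inversions (p : seq nat) : nat :=
  if p is j :: p' then (count (fun i => (i < j)%N) p' + inversions p')%N else 0%N.

Lemma inversions_swap p q a b : (a < b)%N ->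
  inversions (p ++ b :: a :: q) = (inversions (p ++ a :: b :: q)).+1.
Proof.
move=> ab; elim: p => [|j p IH] /=.
  by rewrite ab (ltnNge b a) (ltnW ab) /=; lia.
by rewrite IH addnS !count_cat /=; congr (_ + _).+1; lia.
Qed.

Lemma inversions_sorted p : sorted ltn p -> inversions p = 0%N.
Proof.
elim: p => //= j p IH pj; rewrite IH ?(path_sorted pj) // addn0.
apply/eqP; rewrite eqn0Ngt -has_count; apply/hasPn => i ip.
have := order_path_min ltn_trans pj; move/allP/(_ _ ip) => /= ji.
by rewrite -leqNgt ltnW.
Qed.

Variable k : nat.

Definition perm_fun (s : 'S_k.+1) (x : nat) : nat := s (inord x).

Definition perm_word (s : 'S_k.+1) : seq nat := mkseq (perm_fun s) k.+1.

Lemma perm_word_inj : injective perm_word.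
Proof.
move=> s t e; apply/permP => x; apply/val_inj.
have /(congr1 (fun l => nth 0%N l x)) := e.
by rewrite !nth_mkseq // /perm_fun inord_val.
Qed.

Lemma perm_word_iota s : perm_eq (perm_word s) (iota 0 k.+1).
Proof.
apply: uniq_perm; rewrite ?iota_uniq //.
  rewrite map_inj_in_uniq ?iota_uniq // => x y; rewrite !mem_iota /= !add0n => hx hy.
  move/val_inj/perm_inj/(congr1 val); by rewrite /= !inordK.
move=> y; rewrite mem_iota add0n /=; apply/mapP/idP => [[x _ ->]|hy]; first exact: ltn_ord.
exists (val ((s^-1)%g (Ordinal hy))); first by rewrite mem_iota /=.
by rewrite /perm_fun inord_val permKV.
Qed.

Lemma perm_word1 : perm_word 1%g = iota 0 k.+1.
Proof.
rewrite /perm_word /mkseq -[RHS]map_id; apply/eq_in_map => x.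
by rewrite mem_iota add0n /perm_fun perm1 => /= hx; rewrite inordK.
Qed.

Lemma perm_word_sorted s : sorted ltn (perm_word s) -> s = 1%g.
Proof.
move=> srt; apply: perm_word_inj; rewrite perm_word1.
apply: (irr_sorted_eq ltn_trans ltnn srt (iota_ltn_sorted 0 k.+1)).
exact: perm_mem (perm_word_iota s).
Qed.

Lemma mkseq_split (f : nat -> nat) i : (i < k)%N ->
  mkseq f k.+1 = mkseq f i ++ f i :: f i.+1 :: map f (iota i.+2 (k.-1 - i)).
Proof.
move=> ik; rewrite /mkseq -[in LHS](_ : i + (k.-1 - i).+2 = k.+1)%N; last by lia.
by rewrite iotaD map_cat.
Qed.

Lemma perm_fun_adjacent (i : 'I_k) (s : 'S_k.+1) x : (x < k.+1)%N ->
  perm_fun (adjacent i * s)%g x =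
    if x == i then perm_fun s i.+1 else if x == i.+1 then perm_fun s i else perm_fun s x.
Proof.
move=> hx; rewrite /perm_fun permM /adjacent.
have e1 : widen_ord (leqnSn k) i = inord i.
  by apply/val_inj; rewrite /= inordK // ltnS ltnW.
have e2 : lift ord0 i = inord i.+1 by apply/val_inj; rewrite /= /bump /= inordK // ltnS.
have ix y : (y < k.+1)%N -> (inord x == inord y :> 'I_k.+1) = (x == y).
  by move=> hy; rewrite -val_eqE /= !inordK.
have hi : (i < k.+1)%N by rewrite ltnS ltnW.
have hi1 : (i.+1 < k.+1)%N by rewrite ltnS.
rewrite e1 e2; case: tpermP => [/eqP|/eqP|/eqP + /eqP].
- by rewrite (ix _ hi) => ->.
- rewrite (ix _ hi1) => /eqP ->; rewrite eqxx.
  by case: eqP => // /esym/n_Sn.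
- by rewrite (ix _ hi) (ix _ hi1) => /negPf -> /negPf ->.
Qed.

(** Products of permutations compose from left to right, so multiplying by [adjacent i] on the left
    exchanges the values at two neighbouring positions. *)
Lemma perm_word_adjacent (i : 'I_k) (s : 'S_k.+1) : exists p a b q,
  [/\ perm_word s = p ++ a :: b :: q, perm_word (adjacent i * s)%g = p ++ b :: a :: q,
      size p = i & a = perm_fun s i /\ b = perm_fun s i.+1].
Proof.
exists (mkseq (perm_fun s) i), (perm_fun s i), (perm_fun s i.+1).
exists (map (perm_fun s) (iota i.+2 (k.-1 - i))).
rewrite /perm_word !(mkseq_split _ (ltn_ord i)) size_mkseq; split=> //.
have ik := ltn_ord i.
rewrite !perm_fun_adjacent ?ltnS ?(ltnW ik) // !eqxx.
have -> : (i.+1 == i) = false by apply/negbTE; rewrite neq_ltn ltnSn orbT.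
congr (_ ++ _ :: _ :: _); apply/eq_in_map => x; rewrite mem_iota => /andP[h1 h2].
  by rewrite perm_fun_adjacent; [case: eqP => [|_]; [|case: eqP]|]; lia.
by rewrite perm_fun_adjacent; [case: eqP => [|_]; [|case: eqP]|]; lia.
Qed.

Local Notation aprod := (wordprod (@adjacent k)).

Lemma inversions_wordprod s : (inversions (perm_word (aprod s)) <= size s)%N.
Proof.
elim: s => [|i s IH].
  by rewrite wordprod_nil perm_word1 inversions_sorted ?iota_ltn_sorted.
rewrite wordprod_cons; have [p [a [b [q [e1 e2 _ _]]]]] := perm_word_adjacent i (aprod s).
rewrite e2 /= (leq_trans _ (_ : (inversions (perm_word (aprod s))).+1 <= _)%N) // e1.
case: (ltngtP a b) => [ab|ba|->]; last by [].
  by rewrite inversions_swap.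
by rewrite (inversions_swap p q ba) !leqW.
Qed.

(** Bubble sort: exchanging a descent removes exactly one inversion. *)
Lemma adjacent_word s : exists2 w, aprod w = s & size w = inversions (perm_word s).
Proof.
move: {2}(inversions _).+1 (ltnSn (inversions (perm_word s))) => N.
elim: N s => // N IH s hN.
have [/forallP asc|] := boolP [forall i : 'I_k, (perm_fun s i < perm_fun s i.+1)%N].
  have s1 : s = 1%g.
    apply/perm_word_sorted/(sortedP 0%N) => i; rewrite size_mkseq ltnS => hi.
    by rewrite !nth_mkseq // ?ltnS 1?ltnW //; apply: (asc (Ordinal hi)).
  exists [::]; first by rewrite wordprod_nil s1.
  by rewrite s1 perm_word1 inversions_sorted ?iota_ltn_sorted.
case/forallPn => i; rewrite -leqNgt => desc.
have [p [a [b [q [e1 e2 _ [ea eb]]]]]] := perm_word_adjacent i s.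
have nab : a != b.
  have := perm_uniq (perm_word_iota s); rewrite iota_uniq e1 cat_uniq /= inE.
  by case: eqP => // _; rewrite !andbF.
have ba : (b < a)%N by rewrite ltn_neqAle eq_sym nab ea eb.
have inv : inversions (perm_word s) = (inversions (perm_word (adjacent i * s)%g)).+1.
  by rewrite e1 e2 inversions_swap.
have [|w hw sw] := IH (adjacent i * s)%g; first by move: hN; rewrite inv !ltnS.
exists (i :: w); last by rewrite inv -sw.
by rewrite wordprod_cons hw mulgA /adjacent tperm2 mul1g.
Qed.

Lemma adjacent_redword s :
  aprod (redword (@adjacent k) s) = s /\
  size (redword (@adjacent k) s) = inversions (perm_word s).
Proof.
have ex g : exists w, aprod w = g by have [w hw _] := adjacent_word g; exists w.
split; first exact: (redwordK ex).
have [w hw sw] := adjacent_word s.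
apply/eqP; rewrite eqn_leq -{1}sw (redword_min ex hw) /=.
by have := inversions_wordprod (redword (@adjacent k) s); rewrite (redwordK ex).
Qed.

(** Built from the end of its reduced word, a permutation arises from the identity by exchanges of
    neighbouring ascents; this reduces the composite braiding to single crossings. *)
Lemma adjacent_word_ind (Q : seq 'I_k -> seq nat -> Prop) :
  Q [::] (iota 0 k.+1) ->
  (forall (i : 'I_k) w p a b q, size p = i -> (a < b)%N -> uniq (p ++ a :: b :: q) ->
    Q w (p ++ a :: b :: q) -> Q (i :: w) (p ++ b :: a :: q)) ->
  forall s, Q (redword (@adjacent k) s) (perm_word s).
Proof.
move=> Q0 QS s; have [ep es] := adjacent_redword s.
rewrite -{2}ep; move: es; rewrite -{2}ep.
elim: (redword _ _) => [|i w IH] sz; first by rewrite wordprod_nil perm_word1.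
have le := inversions_wordprod w; move: sz; rewrite wordprod_cons.
have [p [a [b [q [e1 e2 sp _]]]]] := perm_word_adjacent i (aprod w).
have := perm_uniq (perm_word_iota (aprod w)); rewrite iota_uniq e1 => u.
rewrite e2 /=; case: (ltngtP a b) => [ab|ba|e].
- rewrite inversions_swap // => -[sz]; apply: QS => //.
  by rewrite -e1; apply: IH; rewrite sz e1.
(* Exchanging a descent would lower the number of inversions, which contradicts reducedness. *)
- move=> sz; move: le; rewrite e1 (inversions_swap p q ba) -sz.
  by rewrite ltnNge leqW.
- by move: u; rewrite e cat_uniq /= inE eqxx !andbF.
Qed.

Lemma sum_perm_word (V : nmodType) (F : seq nat -> V) :
  \sum_(s : 'S_k.+1) F (perm_word s) = \sum_(p <- permutations (iota 0 k.+1)) F p.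
Proof.
have u : uniq [seq perm_word s | s : 'S_k.+1].
  by rewrite map_inj_uniq ?enum_uniq //; apply: perm_word_inj.
have e : perm_eq [seq perm_word s | s : 'S_k.+1] (permutations (iota 0 k.+1)).
  apply: uniq_perm => //; first exact: permutations_uniq.
  have sub : {subset [seq perm_word s | s : 'S_k.+1] <= permutations (iota 0 k.+1)}.
    by move=> p /mapP[s _ ->]; rewrite mem_permutations perm_word_iota.
  have [|_ //] := uniq_min_size u sub.
  by rewrite size_permutations ?iota_uniq // size_iota size_map -cardE card_Sn.
by rewrite -(perm_big _ e) big_map big_enum.
Qed.

End Inversions.

(** * The braided factorial as a matrix of iterated derivatives *)

Section BraidedFactorial.

Variables (R : realType) (gT : finGroupType) (S : {set gT}).
Hypothesis hS : coxeter_system S.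
Variable T : braided_algebra R S.

Local Notation C := R[i].
Local Notation h := 'cV[R]_#|S|.
Local Notation P := (proot R S).
Local Notation hact := (@wact R gT S).
Local Notation root := (@wroot R gT S).
Local Notation root_refl := (@wrefl R gT S).
Local Notation pr := (@pairing R gT S).
Local Notation xroot := (@br_xroot R gT S T).
Local Notation gen := (@br_gen R gT S T).
Local Notation deriv := (@br_deriv R gT S T).
Local Notation braid := (@br_braid R gT S T).
Local Notation coef := (@br_coef R gT S T).
Local Notation eps_deriv := (@eps_deriv R gT S T).

Definition root_word (l : seq h) : T := \prod_(v <- l) xroot v.

Lemma root_word_cons v l : root_word (v :: l) = xroot v * root_word l.
Proof. exact: big_cons. Qed.

Lemma braid0_xroot (a b : h) t : root a -> root b ->
  braid 0 (xroot a * (xroot b * t)) = xroot (hact (root_refl a) b) * (xroot a * t).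
Proof.
move=> ra rb; have rab u : root (hact (root_refl a) (val (u : P))).
  by rewrite (is_root_hact hS) // proot_root.
case: (xroot_rootP hS T ra) => a' ea; case: (xroot_rootP hS T rb) => b' eb.
- by rewrite ea eb br_braid0.
- by rewrite ea eb (hactN hS) br_xrootN -?ea // mulNr mulrN br_braidN ea br_braid0 mulNr.
- by rewrite ea eb (root_reflN hS) ?proot_root // !mulNr br_braidN br_braid0 mulrN.
- rewrite ea eb (hactN hS) br_xrootN -?ea // ea (root_reflN hS) ?proot_root //.
  by rewrite !mulNr !mulrN !opprK br_braid0.
Qed.

Lemma braidS_xroot i (a : h) t : root a ->
  braid i.+1 (xroot a * t) = xroot a * braid i t.
Proof.
move=> ra; case: (xroot_rootP hS T ra) => a' _; first exact: br_braidS.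
by rewrite !mulNr br_braidN br_braidS.
Qed.

Lemma braid_root_word l1 a b l2 : all root (l1 ++ [:: a, b & l2]) ->
  braid (size l1) (root_word (l1 ++ [:: a, b & l2])) =
    root_word (l1 ++ [:: hact (root_refl a) b, a & l2]).
Proof.
elim: l1 => [|c l1 IH] /=.
  by case/and3P=> ra rb _; rewrite !root_word_cons braid0_xroot.
by case/andP=> rc /IH {}IH; rewrite !root_word_cons braidS_xroot // IH.
Qed.

Lemma coef_xrootM (a : P) l (v : h) t : root v ->
  coef (a :: l) (xroot v * t) = pr (val a) v * coef l t.
Proof.
have prv c : pr (val a) (val c) = (a == c)%:R.
  rewrite /pairing (inj_eq val_inj) eq_sym; case: (val c =P - val a) => [e|]; rewrite ?subr0 //.
  by have := proot_pos c; rewrite e (posN hS) ?proot_root ?proot_pos.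
move=> rv; case: (xroot_rootP hS T rv) => c ->; first by rewrite br_coef_genM prv.
by rewrite mulNr br_coefN br_coef_genM pairingNr prv mulNr.
Qed.

Variable f : nat -> h.
Hypothesis rf : forall i, root (f i).

(* The label of strand [j] once it has been crossed by the strands of [p]    *)
(* starting on its left.                                                     *)
Definition crossing (p : seq nat) (j : nat) : gT :=
  (\prod_(i <- iota 0 j | i \in p) root_refl (f i))%g.

Definition strand (p : seq nat) (j : nat) : h := hact (crossing p j) (f j).

Fixpoint strands (p : seq nat) : seq h :=
  if p is j :: p' then strand p' j :: strands p' else [::].

Lemma strand_root p j : root (strand p j).
Proof. exact: is_root_hact. Qed.

Lemma strands_root p : all root (strands p).
Proof. by elim: p => //= j p ->; rewrite strand_root. Qed.

Lemma eq_strand p q : p =i q -> strand p =1 strand q.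
Proof. by move=> e j; rewrite /strand /crossing; congr hact; apply: eq_bigl. Qed.

(** The factors before [a] in the product conjugate the reflection of [f a] into the reflection of
    the current label of strand [a]. *)
Lemma crossing_cons p a b : (a < b)%N -> a \notin p ->
  crossing (a :: p) b = (root_refl (strand p a) * crossing p b)%g.
Proof.
move=> ab ap.
have e : iota 0 b = iota 0 a ++ a :: iota a.+1 (b - a.+1).
  by rewrite -[in LHS](_ : a + (b - a.+1).+1 = b)%N; [rewrite iotaD | lia].
have e1 : (\prod_(i <- iota 0 a | i \in a :: p) root_refl (f i))%g = crossing p a.
  rewrite /crossing big_seq_cond [in RHS]big_seq_cond; apply: eq_bigl => i.
  by rewrite mem_iota inE add0n /=; case: (i =P a) => [->|//]; rewrite ltnn.
have e2 : (\prod_(i <- iota a.+1 (b - a.+1) | i \in a :: p) root_refl (f i) =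
    \prod_(i <- iota a.+1 (b - a.+1) | i \in p) root_refl (f i))%g.
  rewrite big_seq_cond [in RHS]big_seq_cond; apply: eq_bigl => i.
  by rewrite mem_iota inE; case: (i =P a) => [->|//]; rewrite ltnn.
rewrite /strand (root_refl_hact hS) // /crossing e !big_cat !big_cons e1 e2 inE eqxx.
by rewrite (negPf ap) /= -/(crossing p a) !mulgA mulgKV.
Qed.

Lemma strand_swap p a b : (a < b)%N -> a \notin p ->
  strand (a :: p) b = hact (root_refl (strand p a)) (strand p b).
Proof. by move=> ab ap; rewrite /strand crossing_cons // (hactM hS). Qed.

Lemma strand_lt p a b : (a <= b)%N -> strand (b :: p) a = strand p a.
Proof.
move=> ab; rewrite /strand /crossing; congr hact; rewrite big_seq_cond [in RHS]big_seq_cond.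
apply: eq_bigl => i; rewrite mem_iota inE add0n /=; case: eqP => //= ->.
by rewrite ltnNge ab.
Qed.

(** The labels of the strands of [p] when those of [q] stand to their right; they depend on [q] only
    as a set, so a crossing inside [q] leaves them unchanged. *)
Fixpoint strands_before (p q : seq nat) : seq h :=
  if p is j :: p' then strand (p' ++ q) j :: strands_before p' q else [::].

Lemma strands_cat p q : strands (p ++ q) = strands_before p q ++ strands q.
Proof. by elim: p => //= j p ->. Qed.

Lemma size_strands_before p q : size (strands_before p q) = size p.
Proof. by elim: p => //= j p ->. Qed.

Lemma strands_before_root p q : all root (strands_before p q).
Proof. by elim: p => //= j p ->; rewrite strand_root. Qed.

Lemma eq_strands_before p q q' : q =i q' -> strands_before p q = strands_before p q'.
Proof.
move=> e; elim: p => //= j p ->; congr (_ :: _); apply: eq_strand => x.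
by rewrite !mem_cat e.
Qed.

Lemma braid_strands p a b q : (a < b)%N -> uniq (p ++ a :: b :: q) ->
  braid (size p) (root_word (strands (p ++ a :: b :: q))) =
    root_word (strands (p ++ b :: a :: q)).
Proof.
move=> ab; rewrite cat_uniq => /and3P[_ _ /= /and3P[]].
rewrite inE negb_or => /andP[_ aq] bq _.
rewrite !strands_cat (@eq_strands_before p [:: b, a & q] [:: a, b & q]); last first.
  by move=> x; rewrite !inE orbCA.
rewrite /= (strand_lt _ (ltnW ab)) (strand_swap ab aq) -(size_strands_before p [:: a, b & q]).
by apply: braid_root_word; rewrite all_cat /= !strand_root strands_root strands_before_root.
Qed.

Lemma strands_iota j m : strands (iota j m) = map f (iota j m).
Proof.
elim: m j => //= m IH j; rewrite IH; congr (_ :: _).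
rewrite /strand /crossing big1_seq ?(hact1 hS) // => i /andP[].
by rewrite !mem_iota add0n /= => /andP[h1 _] h2; move: h1; rewrite ltnNge ltnW.
Qed.

Definition br_braid_perm k (s : 'S_k.+1) (t : T) : T :=
  foldr (fun i : 'I_k => braid i) t (redword (@adjacent k) s).

Definition br_fact (m : nat) (t : T) : T :=
  if m is k.+1 then \sum_(s : 'S_k.+1) br_braid_perm s t else t.

Lemma br_braid_perm_word k (s : 'S_k.+1) :
  br_braid_perm s (root_word (map f (iota 0 k.+1))) = root_word (strands (perm_word s)).
Proof.
apply: (@adjacent_word_ind k (fun w p =>
  foldr (fun i : 'I_k => braid i) (root_word (map f (iota 0 k.+1))) w =
  root_word (strands p))) => [|i w p a b q sp ab u /= ->].
  by rewrite strands_iota.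
by rewrite -sp braid_strands.
Qed.

(** The Leibniz rule brings each factor [x] to the front, and on the way its label is acted on by
    all earlier factors. *)
Lemma deriv_word_sorted (a : h) A : sorted ltn A ->
  deriv a (root_word (map f A)) =
    \sum_(x <- A) pr a (strand (rem x A) x) *: root_word (map f (rem x A)).
Proof.
elim: A a => [|y A IH] a; first by rewrite /root_word !big_nil br_deriv1.
move=> yA; have /allP yltA := order_path_min ltn_trans yA.
have sA : sorted ltn A := path_sorted yA.
have yy B : {subset B <= A} -> strand B y = f y.
  move=> BA; rewrite /strand /crossing big1_seq ?(hact1 hS) // => i /andP[/BA iA].
  by rewrite mem_iota add0n /= ltnNge ltnW //; apply: yltA.
rewrite /= root_word_cons (deriv_xrootM hS) // IH // big_cons eqxx yy //; congr (_ + _).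
rewrite mulr_sumr big_seq [RHS]big_seq; apply: eq_bigr => x xA.
have yx := yltA _ xA; rewrite br_scaleAr.
rewrite (negPf (_ : y != x)) ?neq_ltn ?yx //= root_word_cons.
have sub : {subset rem x A <= A} by move=> i; apply: mem_rem.
rewrite strand_swap //; last by apply/negP => /sub /yltA; rewrite /= ltnn.
by rewrite yy // (pairing_hact hS) (root_reflV hS).
Qed.

(** Grouping the permutations by their first entry [x] splits off the label of [x] at the front,
    which is one step of [deriv_word_sorted]; the remaining permutations are those of [A] without
    [x]. *)
Lemma sum_coef_strands l A : sorted ltn A ->
  \sum_(p <- permutations A) coef l (root_word (strands p)) =
    eps_deriv l (root_word (map f A)).
Proof.
elim: l A => [|a l IH] A sA.
  case: A sA => [|y A] sA.
    by rewrite big_seq1 br_coef_nil.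
  rewrite eps_deriv_nil root_word_cons (eps_xrootM hS) // big_seq big1 // => p.
  rewrite mem_permutations; case: p => [|j p]; first by move/perm_size.
  by move=> _; rewrite /= root_word_cons br_coef_nil (eps_xrootM hS) // strand_root.
rewrite eps_deriv_cons deriv_word_sorted // (map_lin_sum (V := C^o) (eps_derivP l)).
have uA : uniq A := sorted_uniq ltn_trans ltnn sA.
case: (posnP (size A)) => [/size0nil ->|A0].
  by rewrite big_seq1 /root_word !big_nil br_coef1.
rewrite (perm_big _ (permutationsE A0)) big_allpairs_dep undup_id //.
rewrite big_seq [RHS]big_seq; apply: eq_bigr => x xA.
rewrite -IH; last exact: (subseq_sorted ltn_trans (rem_subseq x A) sA).
rewrite scaler_sumr big_seq [RHS]big_seq; apply: eq_bigr => p.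
rewrite mem_permutations => pA; rewrite /= root_word_cons coef_xrootM ?strand_root //.
by rewrite (eq_strand (perm_mem pA)).
Qed.

Lemma coef_fact_strands l m :
  coef l (br_fact m (root_word (map f (iota 0 m)))) =
    eps_deriv l (root_word (map f (iota 0 m))).
Proof.
rewrite -sum_coef_strands ?iota_ltn_sorted //; case: m => [|k] /=.
  by rewrite big_seq1.
rewrite (big_morph (coef l) (br_coefD l) (br_coef0 T l)).
under eq_bigr => s _ do rewrite br_braid_perm_word.
exact: sum_perm_word.
Qed.

Lemma eps_deriv_size l m : size l != m ->
  eps_deriv l (root_word (map f (iota 0 m))) = 0.
Proof.
have cs k w : all root w -> size k != size w -> coef k (root_word w) = 0.
  elim: k w => [|b k IH] [|v w] //=.
  - by case/andP=> rv _ _; rewrite root_word_cons br_coef_nil (eps_xrootM hS).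
  - by rewrite /root_word big_nil br_coef1.
  - case/andP=> rv rw; rewrite eqSS => sz.
    by rewrite root_word_cons coef_xrootM // IH ?mulr0.
have ss p : size (strands p) = size p by elim: p => //= j p ->.
move=> sl; rewrite -sum_coef_strands ?iota_ltn_sorted // big_seq big1 // => p.
rewrite mem_permutations => /perm_size; rewrite size_iota => sp.
by rewrite cs ?strands_root // ss sp.
Qed.

End BraidedFactorial.

(** * The coproduct *)

(** The same abstraction for the tensor square: it is spanned by pure tensors, bilinear maps factor
    through it, and [sq_shift c] is left multiplication by the coproduct of x_c. *)
Record braided_square (R : realType) (gT : finGroupType) (S : {set gT})
    (T : braided_algebra R S) := BraidedSquare {
  sq_mod :> lmodType R[i];
  sq_tens : T -> T -> sq_mod;
  sq_shift : proot R S -> sq_mod -> sq_mod;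
  sq_cop : T -> sq_mod;
  sq_tensPl : forall c x y z,
    sq_tens (c *: x + y) z = c *: sq_tens x z + sq_tens y z;
  sq_tensPr : forall c x y z,
    sq_tens z (c *: x + y) = c *: sq_tens z x + sq_tens z y;
  sq_span : forall X, exists l : seq (T * T), X = \sum_(p <- l) sq_tens p.1 p.2;
  sq_lift : forall (M : lmodType R[i]) (f : T -> T -> M),
    (forall c x y z, f (c *: x + y) z = c *: f x z + f y z) ->
    (forall c x y z, f z (c *: x + y) = c *: f z x + f z y) ->
    exists2 g : sq_mod -> M, (forall c X Y, g (c *: X + Y) = c *: g X + g Y) &
      forall x y, g (sq_tens x y) = f x y;
  sq_shiftP : forall a c X Y,
    sq_shift a (c *: X + Y) = c *: sq_shift a X + sq_shift a Y;
  sq_shift_tens : forall c x y, sq_shift c (sq_tens x y) =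
    sq_tens (br_gen c * x) y + sq_tens (br_act (wrefl (val c)) x) (br_gen c * y);
  sq_copP : forall c x y, sq_cop (c *: x + y) = c *: sq_cop x + sq_cop y;
  sq_cop1 : sq_cop 1 = sq_tens 1 1;
  sq_cop_genM : forall c t, sq_cop (br_gen c * t) = sq_shift c (sq_cop t)
}.

Arguments sq_tens {R gT S T b}.
Arguments sq_shift {R gT S T b}.
Arguments sq_cop {R gT S T b}.

Section TensorSquare.

Variables (R : realType) (gT : finGroupType) (S : {set gT}).
Hypothesis hS : coxeter_system S.
Variable T : braided_algebra R S.
Variable T2 : braided_square T.

Local Notation C := R[i].
Local Notation h := 'cV[R]_#|S|.
Local Notation rw := (redword (@sref gT S)).
Local Notation hact := (@wact R gT S).
Local Notation root_refl := (@wrefl R gT S).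
Local Notation pr := (@pairing R gT S).
Local Notation gen := (@br_gen R gT S T).
Local Notation deriv := (@br_deriv R gT S T).
Local Notation eps := (@br_eps R gT S T).
Local Notation eps_deriv := (@eps_deriv R gT S T).
Local Notation skew_word := (@skew_word R gT S T).
Local Notation xword := (@xword R gT S T).
Local Notation tens := (@sq_tens R gT S T T2).
Local Notation shift := (@sq_shift R gT S T T2).
Local Notation cop := (@sq_cop R gT S T T2).

(** Membership in the ideal of the Nichols algebra, as identified in [nkerP]. *)
Definition null (t : T) : Prop := forall l, eps_deriv l t = 0.

Definition null2 (X : T2) : Prop := exists2 l : seq (T * T),
  forall p, p \in l -> null p.1 \/ null p.2 & X = \sum_(p <- l) tens p.1 p.2.

Lemma tens_linl z c x y : tens (c *: x + y) z = c *: tens x z + tens y z.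
Proof. exact: sq_tensPl. Qed.

Lemma tensDl z : {morph tens^~ z : x y / x + y}.
Proof. exact: (map_linD (tens_linl z)). Qed.

Lemma tensZl c x z : tens (c *: x) z = c *: tens x z.
Proof. exact: (map_linZ (tens_linl z)). Qed.

Lemma tensNl x z : tens (- x) z = - tens x z.
Proof. exact: (map_linN (tens_linl z)). Qed.

Lemma tensDr z : {morph tens z : x y / x + y}.
Proof. exact: (map_linD (fun c x y => sq_tensPr T2 c x y z)). Qed.

Lemma tensZr c x z : tens z (c *: x) = c *: tens z x.
Proof. exact: (map_linZ (fun c x y => sq_tensPr T2 c x y z)). Qed.

Lemma tens0r z : tens z 0 = 0.
Proof. exact: (map_lin0 (fun c x y => sq_tensPr T2 c x y z)). Qed.

Lemma sq_ext (M : lmodType C) (f g : T2 -> M) :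
  (forall c X Y, f (c *: X + Y) = c *: f X + f Y) ->
  (forall c X Y, g (c *: X + Y) = c *: g X + g Y) ->
  (forall x y, f (tens x y) = g (tens x y)) -> f =1 g.
Proof.
move=> fP gP fg X; have [l ->] := sq_span X.
rewrite (big_morph f (map_linD fP) (map_lin0 fP)).
rewrite (big_morph g (map_linD gP) (map_lin0 gP)).
by apply: eq_bigr => p _.
Qed.

(* Gaussian elimination on the first factors reduces the number of terms     *)
(* until all of them are null, leaving null second factors behind.           *)
Lemma null2_sum (l : seq (T * T)) :
  (forall a b, \sum_(p <- l) eps_deriv a p.1 * eps_deriv b p.2 = 0) ->
  null2 (\sum_(p <- l) tens p.1 p.2).
Proof.
move: {2}(size l).+1 (ltnSn (size l)) => N; elim: N l => // N IH l lN hl.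
have [all0|] := pselect (forall p, p \in l -> null p.1).
  by exists l => // p /all0; left.
move=> /existsNP[p /not_implyP[pl /existsNP[a /eqP cn]]].
set c := eps_deriv a p.1 in cn.
pose co (q : T * T) := c^-1 * eps_deriv a q.1.
pose l' := [seq (q.1 - co q *: p.1, q.2) | q <- rem p l].
pose m := p.2 + \sum_(q <- rem p l) co q *: q.2.
have el (V : zmodType) (F : T * T -> V) :
    \sum_(q <- l) F q = F p + \sum_(q <- rem p l) F q.
  by rewrite (perm_big _ (perm_to_rem pl)) big_cons.
have em b : eps_deriv b m = 0.
  rewrite /m eps_derivD (map_lin_sum (V := C^o) (eps_derivP b)).
  apply: (mulfI cn); rewrite mulr0 -[RHS](hl a b) el mulrDr mulr_sumr; congr (_ + _).
  by apply: eq_bigr => q _; rewrite -[_ *: _]/(_ * _) /co !mulrA divff // mul1r.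
have emb a' b : eps_deriv a' p.1 * eps_deriv b p.2 =
    - \sum_(q <- rem p l) co q * eps_deriv a' p.1 * eps_deriv b q.2.
  apply/eqP; rewrite -subr_eq0 opprK; have := em b; rewrite /m eps_derivD.
  rewrite (map_lin_sum (V := C^o) (eps_derivP b)) => /(congr1 ( *%R (eps_deriv a' p.1))).
  rewrite mulr0 mulrDr mulr_sumr => /eqP; congr (_ + _ == _).
  by apply: eq_bigr => q _; rewrite -[_ *: _]/(_ * _) mulrA (mulrC (co q)).
have eX : \sum_(q <- l) tens q.1 q.2 = \sum_(q <- l') tens q.1 q.2 + tens p.1 m.
  rewrite el /m tensDr (big_morph (tens p.1) (tensDr p.1) (tens0r p.1)).
  rewrite addrCA; congr (_ + _); rewrite big_map -big_split /=.
  apply: eq_bigr => q _; rewrite tensDl tensNl tensZl tensZr -addrA.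
  by rewrite addNr addr0.
have [||k hk ek] := IH l'.
- by rewrite size_map size_rem // -ltnS prednK //; case: (l) pl.
- move=> a' b; rewrite big_map /=.
  under eq_bigr => q _ do rewrite eps_derivD eps_derivN eps_derivZ mulrDl mulNr.
  by rewrite big_split /= sumrN -emb addrC -[RHS](hl a' b) el.
exists (rcons k (p.1, m)); last by rewrite eX ek -cats1 big_cat big_seq1.
by move=> q; rewrite mem_rcons inE => /orP[/eqP -> /=|/hk //]; right=> b; apply: em.
Qed.

(** The ideal of the tensor square is detected by products of two test functionals, by [null2_sum].
    Such a product is given as any linear map with the right values on pure tensors. *)
Lemma null2P (X : T2) :
  (forall a b (g : T2 -> C^o), (forall c X Y, g (c *: X + Y) = c *: g X + g Y) ->
     (forall x y, g (tens x y) = eps_deriv a x * eps_deriv b y) -> g X = 0) ->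
  null2 X.
Proof.
have [l ->] := sq_span X => hX; apply: null2_sum => a b.
have [||g gP gE] := @sq_lift _ _ _ _ T2 C^o (fun x y => eps_deriv a x * eps_deriv b y).
- by move=> c x y z; rewrite eps_derivP mulrDl -mulrA.
- by move=> c x y z; rewrite eps_derivP mulrDr mulrCA.
rewrite -[RHS](hX a b g gP gE) (big_morph g (map_linD gP) (map_lin0 gP)).
by apply: eq_bigr => p _; rewrite gE.
Qed.

Lemma deriv_lift (a : h) : exists2 D : T2 -> T2,
  (forall c X Y, D (c *: X + Y) = c *: D X + D Y) &
  (forall x y, D (tens x y) = tens (deriv a x) y).
Proof.
have [||D DP DE] := @sq_lift _ _ _ _ T2 T2 (fun x y => tens (deriv a x) y).
- by move=> c x y z; rewrite br_derivP tens_linl.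
- by move=> c x y z; rewrite sq_tensPr.
- by exists D.
Qed.

(** Coassociativity again: a left derivative only affects the first tensor factor of the
    coproduct. *)
Lemma deriv_lift_cop (a : h) (D : T2 -> T2) t :
  (forall c X Y, D (c *: X + Y) = c *: D X + D Y) ->
  (forall x y, D (tens x y) = tens (deriv a x) y) ->
  D (cop t) = cop (deriv a t).
Proof.
elim/br_ind: t a D => [|c t IH|k x y IHx IHy] a D DP DE.
- rewrite sq_cop1 DE br_deriv1 (map_lin0 (sq_copP T2)).
  by rewrite (map_lin0 (tens_linl 1)).
- have [D' D'P D'E] := deriv_lift (hact (root_refl (val c)) a).
  have key : D (shift c (cop t)) = pr a (val c) *: cop t + shift c (D' (cop t)).
    apply: (@sq_ext _ (fun X => D (shift c X)) (fun X => pr a (val c) *: X + shift c (D' X))).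
    - by move=> k X Y; rewrite sq_shiftP DP.
    - by move=> k X Y; rewrite D'P sq_shiftP scale_exchange.
    move=> x y; rewrite sq_shift_tens (map_linD DP) !DE D'E sq_shift_tens.
    rewrite br_deriv_genM tens_linl -addrA (deriv_act hS) (root_reflV hS) //.
    exact: proot_root.
  by rewrite sq_cop_genM key (IH _ _ D'P D'E) br_deriv_genM sq_copP sq_cop_genM.
- by rewrite sq_copP DP (IHx _ _ DP DE) (IHy _ _ DP DE) br_derivP sq_copP.
Qed.

Lemma counit_cop (E : T2 -> T) t :
  (forall c X Y, E (c *: X + Y) = c *: E X + E Y) ->
  (forall x y, E (tens x y) = eps x *: y) -> E (cop t) = t.
Proof.
move=> EP EE; elim/br_ind: t => [|c t IH|k x y IHx IHy].
- by rewrite sq_cop1 EE br_eps1 scale1r.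
- rewrite sq_cop_genM -[in RHS]IH.
  apply: (@sq_ext _ (fun X => E (shift c X)) (fun X => gen c * E X)).
  + by move=> k X Y; rewrite sq_shiftP EP.
  + by move=> k X Y; rewrite EP mulrDr br_scaleAr.
  move=> x y; rewrite sq_shift_tens (map_linD EP) !EE br_eps_genM scale0r add0r.
  by rewrite (eps_act hS) br_scaleAr.
- by rewrite sq_copP EP IHx IHy.
Qed.

(** The derivatives along [a] are pulled through the coproduct one at a time, and then the counit
    axiom removes the first factor. *)
Lemma eps_deriv_cop a b (g : T2 -> C^o) t :
  (forall c X Y, g (c *: X + Y) = c *: g X + g Y) ->
  (forall x y, g (tens x y) = eps_deriv a x * eps_deriv b y) ->
  g (cop t) = eps_deriv (a ++ b) t.
Proof.
elim: a g t => [|a l IH] g t gP gE.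
  have [||E EP EE] := @sq_lift _ _ _ _ T2 T (fun x y => eps x *: y).
  - by move=> c x y z; rewrite br_epsP scalerDl scalerA.
  - by move=> c x y z; rewrite scalerDr !scalerA mulrC.
  rewrite -[in RHS](counit_cop t EP EE) /=.
  apply: (@sq_ext _ g (fun X => eps_deriv b (E X) : C^o)) => //.
    by move=> c X Y; rewrite EP eps_derivP.
  by move=> x y; rewrite gE EE eps_derivZ.
have [D DP DE] := deriv_lift (val a).
have [||g' g'P g'E] := @sq_lift _ _ _ _ T2 C^o (fun x y => eps_deriv l x * eps_deriv b y).
- by move=> c x y z; rewrite eps_derivP mulrDl -mulrA.
- by move=> c x y z; rewrite eps_derivP mulrDr mulrCA.
rewrite cat_cons eps_deriv_cons -(IH g') // -(deriv_lift_cop t DP DE).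
apply: (@sq_ext _ g (fun X => g' (D X))) => //.
  by move=> c X Y; rewrite DP g'P.
by move=> x y; rewrite gE DE g'E.
Qed.

Lemma null2_cop t : null t -> null2 (cop t).
Proof. by move=> nt; apply: null2P => a b g gP gE; rewrite (eps_deriv_cop _ gP gE). Qed.

Lemma null2_cop_xword s :
  null2 (cop (xword s) - \sum_v tens (skew_word s v) (xword (rw v))).
Proof.
apply: null2P => a b g gP gE.
rewrite (map_linD gP) (map_linN gP) (eps_deriv_cop _ gP gE) (eps_deriv_coprod hS).
rewrite (big_morph g (map_linD gP) (map_lin0 gP)); apply/eqP; rewrite subr_eq0.
by apply/eqP; apply: eq_bigr => v _; rewrite gE.
Qed.

(** The functional dual to x_v, applied to the second factors, isolates [y v]; it kills null second
    factors and keeps null first factors null. *)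
Lemma null2_unique (y : gT -> T) :
  null2 (\sum_v tens (y v) (xword (rw v))) -> forall v, null (y v).
Proof.
move=> [l hl el] v.
set b := map (simple_proot R hS) (rw v).
have [||G GP GE] := @sq_lift _ _ _ _ T2 T (fun x z => eps_deriv b z *: x).
- by move=> c x z u; rewrite scalerDr !scalerA mulrC.
- by move=> c x z u; rewrite eps_derivP scalerDl scalerA.
have := congr1 G el; rewrite !(big_morph G (map_linD GP) (map_lin0 GP)).
under eq_bigr => u _ do
  rewrite GE /b (eps_deriv_simple hS) ?(reduced_rw hS) // (rwK hS).
rewrite (bigD1 v) //= eqxx scale1r big1 ?addr0 => [-> a|u]; last first.
  by rewrite eq_sym => /negPf ->; rewrite scale0r.
rewrite (big_morph (eps_deriv a) (eps_derivD a) (eps_deriv0 T a)).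
rewrite big_seq big1 // => p /hl pl; rewrite GE eps_derivZ.
by case: pl => ->; rewrite ?mul0r ?mulr0.
Qed.

End TensorSquare.

(** * The tensor algebra *)

(* The default [done] calls [discriminate] on every hypothesis; on equations *)
(* between tensors this starts very long conversion tests.                   *)
Ltac done ::=
  trivial; hnf; intros; solve
   [ do ![solve [trivial | simple refine (@sym_equal _ _ _ _); trivial]
         | match goal with
           | H : is_true _ |- _ => discriminate H
           | H : @eq bool _ _ |- _ => discriminate H
           | H : @eq nat _ _ |- _ => discriminate H
           | |- ~ _ => discriminate
           end
         | contradiction | split]
   | match goal with H : ~ _ |- _ => solve [case H; trivial] end ].

Section LinearExtensionTheory.

Variables (K : choiceType) (F : nzRingType) (M : lmodType F).

Lemma mlinU (f : K -> M) k : mlin f << k >> = f k.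
Proof. by rewrite /mlin msuppU oner_eq0 big_seq_fset1 mcoeffUU scale1r. Qed.

Lemma mlinP (f : K -> M) c x y : mlin f (c *: x + y) = c *: mlin f x + mlin f y.
Proof. exact: linearP. Qed.

Lemma malg_sumE (t : {malg F[K]}) : t = \sum_(k <- msupp t) t@_k *: << k >>.
Proof.
rewrite {1}[t]monalgE; apply: eq_bigr => k _; apply/malgP => j.
by rewrite mcoeffZ !mcoeffU mulrnAr mulr1.
Qed.

Lemma malg_ind (Q : {malg F[K]} -> Prop) : Q 0 -> (forall k, Q << k >>) ->
  (forall c x y, Q x -> Q y -> Q (c *: x + y)) -> forall t, Q t.
Proof.
move=> Q0 QU QP t; rewrite [t]malg_sumE; elim/big_rec: _ => // k x _.
exact: QP.
Qed.

End LinearExtensionTheory.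

(** The algebra structure in use makes scalars commute with products only in the left factor; this
    is the right-hand counterpart. *)
Lemma malg_scaleAr (K : monomType) (F : comNzRingType) c (x t : {malg F[K]}) :
  x * (c *: t) = c *: (x * t).
Proof.
apply/malgP => k.
rewrite mcoeffZ (mcoeffMlw k (fsubset_refl _) (msuppZ_le c t)) mcoeffMl mulr_sumr.
apply: eq_bigr => k1 _; rewrite mulr_sumr; apply: eq_bigr => k2 _.
by rewrite mcoeffZ mulrnAr mulrCA.
Qed.

(* Stated in general because rewriting in the tensor algebra is too slow.     *)
Section AbstractRewriting.

Variables (F : nzRingType) (A : lalgType F) (phi psi : A -> A).
Hypothesis scaleAr : forall c (x t : A), x * (c *: t) = c *: (x * t).
Hypothesis phiP : forall c x y, phi (c *: x + y) = c *: phi x + phi y.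
Hypothesis psiP : forall c x y, psi (c *: x + y) = c *: psi x + psi y.
Hypothesis phiM : forall x y, phi (x * y) = phi x * phi y.
Hypothesis psiM : forall x y, psi (x * y) = psi y * psi x.

Lemma lalg_mulP (a : A) c x y : a * (c *: x + y) = c *: (a * x) + a * y.
Proof. by rewrite mulrDr scaleAr. Qed.

Lemma lalg_mulP2 (a b : A) c x y :
  a * (b * (c *: x + y)) = c *: (a * (b * x)) + a * (b * y).
Proof. by rewrite !lalg_mulP. Qed.

Lemma mulr_assoc5 (u v x y z : A) : u * v * x * y * z = u * (v * x * y * z).
Proof. by rewrite !mulrA. Qed.

Lemma lalg_linear_mul2 a b c x y :
  phi (a * (b * (c *: x + y))) = c *: phi (a * (b * x)) + phi (a * (b * y)).
Proof. by rewrite lalg_mulP2 phiP. Qed.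

Lemma antimorph_comm_genM g t : psi g = g -> psi (phi g) = phi g ->
  psi (phi t) = phi (psi t) -> psi (phi (g * t)) = phi (psi (g * t)).
Proof. by move=> e1 e2 e3; rewrite phiM !psiM phiM e1 e2 e3. Qed.

Lemma antimorph_comm_lin c x y : psi (phi x) = phi (psi x) ->
  psi (phi y) = phi (psi y) -> psi (phi (c *: x + y)) = phi (psi (c *: x + y)).
Proof. by move=> ex ey; rewrite phiP !psiP phiP ex ey. Qed.

End AbstractRewriting.

(** * The tensor algebra as a braided algebra *)

Section FreeBraidedAlgebra.

Variables (R : realType) (gT : finGroupType) (S : {set gT}).
Hypothesis hS : coxeter_system S.

Local Notation C := R[i].
Local Notation h := 'cV[R]_#|S|.
Local Notation P := (proot R S).
Local Notation T := (tensalg R S).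
Local Notation hact := (@wact R gT S).
Local Notation root := (@wroot R gT S).
Local Notation root_refl := (@wrefl R gT S).
Local Notation pr := (@pairing R gT S).
Local Notation xroot := (@xroot R gT S).

Lemma mon_nil : mon [::] = 1 :> T.
Proof. by congr (<< _ >>); apply/eqP; rewrite fmP fm1. Qed.

Lemma monM (s t : seq P) : mon s * mon t = mon (s ++ t) :> T.
Proof.
rewrite /mon malgM_def /fgmul !msuppU1 !big_seq_fset1 !mcoeffUU mulr1.
by congr (<< _ >>); apply/eqP; rewrite fmP fmM.
Qed.

Lemma tens_scaleAr c (x t : T) : x * (c *: t) = c *: (x * t).
Proof. exact: malg_scaleAr. Qed.

Lemma tens_mulP (a : T) c x y : a * (c *: x + y) = c *: (a * x) + a * y.
Proof. exact: (lalg_mulP tens_scaleAr). Qed.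

Lemma tens_mon_ind (Q : T -> Prop) : (forall s, Q (mon s)) ->
  (forall c x y, Q x -> Q y -> Q (c *: x + y)) -> forall t, Q t.
Proof.
move=> Qm QP; have Q0 : Q 0 by rewrite -(addNr (mon [::])) -scaleN1r; apply: QP.
by apply: malg_ind => // -[s]; apply: Qm.
Qed.

Lemma tens_gen_ind (Q : T -> Prop) : Q 1 -> (forall a t, Q t -> Q (mon [:: a] * t)) ->
  (forall c x y, Q x -> Q y -> Q (c *: x + y)) -> forall t, Q t.
Proof.
move=> Q1 QM QP; apply: tens_mon_ind QP; elim=> [|a s IH]; first by rewrite mon_nil.
by rewrite -[a :: s]/([:: a] ++ s) -monM; apply: QM.
Qed.

Lemma tens_ext (M : lmodType C) (f g : T -> M) :
  (forall c x y, f (c *: x + y) = c *: f x + f y) ->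
  (forall c x y, g (c *: x + y) = c *: g x + g y) ->
  (forall s, f (mon s) = g (mon s)) -> f =1 g.
Proof.
move=> fP gP fg; elim/tens_mon_ind => // c x y ex ey.
by rewrite fP gP ex ey.
Qed.

Lemma xroot_val (a : P) : xroot (val a) = mon [:: a].
Proof. by rewrite /Defs.xroot valK. Qed.

Lemma xroot_cases (v : h) : root v -> exists a : P,
  v = val a /\ xroot v = mon [:: a] \/ v = - val a /\ xroot v = - mon [:: a].
Proof.
move=> rv; have pN := posN hS rv; rewrite /Defs.xroot.
case: insubP => [a _ <-|]; first by exists a; left.
rewrite is_prootE rv /= -pN => pv.
case: insubP => [a _ e|]; last by rewrite is_prootE (is_rootN hS) rv pv.
by exists a; right; rewrite e opprK.
Qed.

(** The negative of a root is never lost or counted twice, because exactly one of the two roots is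
    positive. *)
Lemma xrootN (v : h) : root v -> xroot (- v) = - xroot v.
Proof.
move=> rv; have rN : root (- v) by rewrite (is_rootN hS).
have nab (a b : P) : val a <> - val b.
  move=> e; have := proot_pos a.
  by rewrite e (posN hS) ?proot_root // proot_pos.
have [a [] [ea ->]] := xroot_cases rv; have [b [] [eb ->]] := xroot_cases rN.
- by case: (nab b a); rewrite -eb -ea.
- by move: eb; rewrite ea => /oppr_inj/val_inj ->.
- by rewrite opprK; move: eb; rewrite ea opprK => /val_inj ->.
- by case: (nab a b); rewrite -eb ea opprK.
Qed.

Lemma tact_linear g c (x y : T) : tact g (c *: x + y) = c *: tact g x + tact g y.
Proof. exact: mlinP. Qed.

Lemma tact_mon g (s : seq P) : tact g (mon s) = \prod_(a <- s) xroot (hact g (val a)).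
Proof. by rewrite wact.unlock; apply: mlinU. Qed.

Lemma tact_one g : tact g (1 : T) = 1.
Proof. by rewrite -[X in tact g X]mon_nil tact_mon big_nil. Qed.

Lemma tact_gen g (a : P) : tact g (mon [:: a]) = xroot (hact g (val a)).
Proof. by rewrite tact_mon big_seq1. Qed.

Lemma tactM g (t u : T) : tact g (t * u) = tact g t * tact g u.
Proof.
move: t; apply: tens_ext => [c x y|c x y|s].
- by rewrite mulrDl -scalerAl tact_linear.
- by rewrite tact_linear mulrDl -scalerAl.
move: u; apply: tens_ext => [c x y|c x y|t].
- by rewrite tens_mulP tact_linear.
- by rewrite tact_linear tens_mulP.
by rewrite monM !tact_mon big_cat.
Qed.

Fixpoint deriv_word (a : h) (s : seq P) : T :=
  if s is c :: s' then
    pr a (val c) *: mon s' + mon [:: c] * deriv_word (hact (root_refl (val c)) a) s'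
  else 0.

Definition left_deriv (a : h) : T -> T := mlin (fun m : {fmonom P} => deriv_word a m).

Fixpoint rderiv_word (a : h) (s : seq P) : T :=
  if s is c :: s' then
    pr a (val c) *: tact (root_refl (val c)) (mon s') + mon [:: c] * rderiv_word a s'
  else 0.

Definition right_deriv (a : h) : T -> T :=
  mlin (fun m : {fmonom P} => rderiv_word a m).

Lemma left_deriv_linear a c x y :
  left_deriv a (c *: x + y) = c *: left_deriv a x + left_deriv a y.
Proof. exact: mlinP. Qed.

Lemma right_deriv_linear a c x y :
  right_deriv a (c *: x + y) = c *: right_deriv a x + right_deriv a y.
Proof. exact: mlinP. Qed.

Lemma left_deriv_mon a s : left_deriv a (mon s) = deriv_word a s.
Proof. exact: mlinU. Qed.

Lemma right_deriv_mon a s : right_deriv a (mon s) = rderiv_word a s.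
Proof. exact: mlinU. Qed.

Lemma left_deriv1 a : left_deriv a 1 = 0.
Proof. by rewrite -mon_nil left_deriv_mon. Qed.

Lemma right_deriv1 a : right_deriv a 1 = 0.
Proof. by rewrite -mon_nil right_deriv_mon. Qed.

Lemma left_deriv_genM a (c : P) t : left_deriv a (mon [:: c] * t) =
  pr a (val c) *: t + mon [:: c] * left_deriv (hact (root_refl (val c)) a) t.
Proof.
move: t; apply: tens_ext => [k x y|k x y|s].
- by rewrite tens_mulP left_deriv_linear.
- rewrite left_deriv_linear tens_mulP; exact: scale_exchange.
by rewrite monM !left_deriv_mon.
Qed.

Lemma right_deriv_genM a (c : P) t : right_deriv a (mon [:: c] * t) =
  pr a (val c) *: tact (root_refl (val c)) t + mon [:: c] * right_deriv a t.
Proof.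
move: t; apply: tens_ext => [k x y|k x y|s].
- by rewrite tens_mulP right_deriv_linear.
- rewrite right_deriv_linear tact_linear tens_mulP; exact: scale_exchange.
by rewrite monM !right_deriv_mon.
Qed.

Lemma trev_linear c (x y : T) : trev (c *: x + y) = c *: trev x + trev y.
Proof. exact: mlinP. Qed.

Lemma trev_mon (s : seq P) : trev (mon s) = mon (rev s) :> T.
Proof. exact: mlinU. Qed.

Lemma trevN (x : T) : trev (- x) = - trev x.
Proof. exact: (map_linN trev_linear). Qed.

Lemma trevM (t u : T) : trev (t * u) = trev u * trev t.
Proof.
move: t; apply: tens_ext => [c x y|c x y|s].
- by rewrite mulrDl -scalerAl trev_linear.
- by rewrite trev_linear tens_mulP.
move: u; apply: tens_ext => [c x y|c x y|t].
- by rewrite tens_mulP trev_linear.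
- by rewrite trev_linear mulrDl -scalerAl.
by rewrite monM !trev_mon rev_cat -monM.
Qed.

Lemma trev_tact g (t : T) : trev (tact g t) = tact g (trev t).
Proof.
elim/tens_gen_ind: t => [|a t IH|c x y IHx IHy].
- by rewrite tact_one -mon_nil trev_mon mon_nil tact_one.
- have rg := is_root_hact hS g (proot_root a).
  have e2 : trev (tact g (mon [:: a])) = tact g (mon [:: a]).
    by rewrite tact_gen; have [b [] [_ ->]] := xroot_cases rg; rewrite ?trevN trev_mon.
  have e1 : trev (mon [:: a]) = mon [:: a] :> T by rewrite trev_mon.
  exact (antimorph_comm_genM (A := T) (tactM g) trevM e1 e2 IH).
- exact (antimorph_comm_lin (A := T) (tact_linear g) trev_linear c IHx IHy).
Qed.

Lemma antipode_mon (s : seq P) : antipode (mon s) = antipode_word s :> T.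
Proof. exact: mlinU. Qed.

Lemma tsbar_linear c (x y : T) : tsbar (c *: x + y) = c *: tsbar x + tsbar y.
Proof. exact: mlinP. Qed.

Lemma tsbar_mon (s : seq P) :
  tsbar (mon s) = (-1) ^+ size s *: trev (antipode (mon s)) :> T.
Proof. exact: mlinU. Qed.

Lemma tsbar_one : tsbar 1 = 1 :> T.
Proof.
by rewrite -[X in tsbar X]mon_nil tsbar_mon expr0 scale1r antipode_mon
  -[antipode_word [::]]/(1 : T) -mon_nil trev_mon.
Qed.

Lemma tsbar_genM (c : P) t :
  tsbar (mon [:: c] * t) = mon [:: c] * tact (root_refl (val c)) (tsbar t).
Proof.
move: t; apply: tens_ext => [k x y|k x y|s].
- by rewrite tens_mulP tsbar_linear.
- by rewrite tsbar_linear tact_linear tens_mulP.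
have tactZ g k (x : T) : tact g (k *: x) = k *: tact g x.
  exact: (map_linZ (tact_linear g)).
rewrite monM !tsbar_mon !antipode_mon [antipode_word ([:: c] ++ s)]/= trevM trevN trev_mon.
rewrite trev_tact tactZ tens_scaleAr wrefl.unlock exprS mulN1r mulNr.
by rewrite scaleNr scalerN opprK.
Qed.

Definition word_coef (l : seq P) (t : T) : C := mcoeff (FMonom l) t.

Lemma word_coef_linear l c x y :
  word_coef l (c *: x + y) = c * word_coef l x + word_coef l y.
Proof. by rewrite /word_coef mcoeffD mcoeffZ. Qed.

Lemma word_coef_mon l s : word_coef l (mon s) = (s == l)%:R.
Proof. by rewrite /word_coef /mon mcoeffU -val_eqE. Qed.

Lemma word_coef_genM a l (c : P) t :
  word_coef (a :: l) (mon [:: c] * t) = (a == c)%:R * word_coef l t.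
Proof.
move: t; apply: (@tens_ext C^o) => [k x y|k x y|s].
- by rewrite tens_mulP word_coef_linear.
- by rewrite word_coef_linear mulrDr mulrCA.
by rewrite monM !word_coef_mon eqseq_cons eq_sym; case: eqP; rewrite ?mul1r ?mul0r.
Qed.

Lemma word_coef_nil_genM (c : P) t : word_coef [::] (mon [:: c] * t) = 0.
Proof.
move: t; apply: (@tens_ext C^o) => [k x y|k x y|s].
- by rewrite tens_mulP word_coef_linear.
- by rewrite scaler0 addr0.
by rewrite monM word_coef_mon.
Qed.

Lemma braid_linear i c (x y : T) : braid i (c *: x + y) = c *: braid i x + braid i y.
Proof. exact: mlinP. Qed.

Lemma braid_mon i (s : seq P) : braid i (mon s) = braid_word i (FMonom s) :> T.
Proof. exact: mlinU. Qed.

Lemma mon_conj_assoc (x : T) a s : mon [::] * x * mon [:: a] * mon s = x * mon (a :: s).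
Proof. by rewrite mon_nil mul1r -mulrA monM. Qed.

Lemma braid0_gen (a c : P) t : braid 0 (mon [:: a] * (mon [:: c] * t)) =
  xroot (hact (root_refl (val a)) (val c)) * (mon [:: a] * t).
Proof.
move: t; apply: tens_ext => [k x y|k x y|s].
- exact (lalg_linear_mul2 (A := T) tens_scaleAr (braid_linear 0) _ _ k x y).
- exact (lalg_mulP2 (A := T) tens_scaleAr _ _ k x y).
have e : mon [:: a] * (mon [:: c] * mon s) = mon [:: a, c & s].
  exact (etrans (congr1 ( *%R (mon [:: a])) (monM [:: c] s)) (monM [:: a] (c :: s))).
have e1 : mon [:: a] * mon s = mon (a :: s) := monM [:: a] s.
rewrite e e1 braid_mon /braid_word [drop _ _]/= [take _ _]/= -tact_gen wrefl.unlock.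
exact (mon_conj_assoc _ a s).
Qed.

Lemma mon_cons_assoc c s (x y z : T) :
  mon (c :: s) * x * y * z = mon [:: c] * (mon s * x * y * z).
Proof.
have e : mon (c :: s) = mon [:: c] * mon s := esym (monM [:: c] s).
rewrite e; exact (mulr_assoc5 (A := T) _ _ x y z).
Qed.

Lemma braidS_gen i (c : P) t : braid i.+1 (mon [:: c] * t) = mon [:: c] * braid i t.
Proof.
move: t; apply: tens_ext => [k x y|k x y|s].
- by rewrite tens_mulP braid_linear.
- by rewrite braid_linear tens_mulP.
rewrite monM !braid_mon /braid_word [drop _ _]/=.
case: (drop i s) => [|a [|b s']]; [exact (esym (monM [:: c] s)) | exact (esym (monM [:: c] s)) |].
exact (mon_cons_assoc c _ _ _ _).
Qed.

Definition free_braided : braided_algebra R S :=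
  @BraidedAlgebra R gT S T (fun a => mon [:: a]) xroot (@tact R gT S)
    left_deriv right_deriv (@tsbar R gT S) (word_coef [::]) (@braid R gT S) word_coef
    tens_scaleAr tens_gen_ind xroot_val xrootN
    tact_linear tactM tact_one tact_gen
    left_deriv_linear left_deriv1 left_deriv_genM
    right_deriv_linear right_deriv1 right_deriv_genM
    tsbar_linear tsbar_one tsbar_genM
    (word_coef_linear [::])
    (etrans (congr1 (word_coef [::]) (esym mon_nil)) (word_coef_mon [::] [::]))
    word_coef_nil_genM
    braid_linear braid0_gen braidS_gen
    word_coef_linear (fun t => erefl)
    (fun a l => etrans (congr1 (word_coef (a :: l)) (esym mon_nil))
                       (word_coef_mon (a :: l) [::]))
    word_coef_genM.

End FreeBraidedAlgebra.

Lemma add_linear (F : nzRingType) (U V : lmodType F) (f g : U -> V) :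
  (forall c x y, f (c *: x + y) = c *: f x + f y) ->
  (forall c x y, g (c *: x + y) = c *: g x + g y) ->
  forall c x y, f (c *: x + y) + g (c *: x + y) = c *: (f x + g x) + (f y + g y).
Proof. by move=> fP gP c x y; rewrite fP gP scalerDr addrACA. Qed.

(** * The tensor square of the tensor algebra *)

Section FreeBraidedSquare.

Variables (R : realType) (gT : finGroupType) (S : {set gT}).
Hypothesis hS : coxeter_system S.

Local Notation C := R[i].
Local Notation P := (proot R S).
Local Notation W := {fmonom P}.
Local Notation T := (tensalg R S).
Local Notation T2 := (tens2 R S).
Local Notation FB := (free_braided R hS).

(** Writing the double sum over supports as nested linear extensions gives bilinearity without any
    bookkeeping of supports. *)
Lemma tprodE (a b : T) :
  tprod a b = mlin (fun m : W => mlin (fun k : W => << (m, k) >> : T2) b) a.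
Proof.
rewrite /tprod /mlin; apply: eq_bigr => m _; rewrite scaler_sumr.
by apply: eq_bigr => k _; rewrite scalerA.
Qed.

Lemma tprod_linl c (x y z : T) : tprod (c *: x + y) z = c *: tprod x z + tprod y z.
Proof. by rewrite 3!tprodE mlinP. Qed.

Lemma tprod_linr c (x y z : T) : tprod z (c *: x + y) = c *: tprod z x + tprod z y.
Proof.
rewrite 3!tprodE /mlin scaler_sumr -big_split; apply: eq_bigr => m _ /=.
by rewrite -!/(mlin _ _) mlinP scalerDr !scalerA (mulrC c).
Qed.

Lemma tprod_mon (s t : seq P) : tprod (mon s) (mon t) = << (FMonom s, FMonom t) >> :> T2.
Proof. by rewrite tprodE /mon mlinU mlinU. Qed.

Lemma tprod_span (X : T2) : exists l : seq (T * T), X = \sum_(p <- l) tprod p.1 p.2.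
Proof.
exists [seq (X@_p *: mon p.1, mon p.2) | p <- msupp X].
rewrite {1}[X]malg_sumE big_map; apply: eq_bigr => -[[s] [t]] _.
by rewrite tprodZl tprod_mon.
Qed.

Lemma tprod_lift (M : lmodType C) (f : T -> T -> M) :
  (forall c x y z, f (c *: x + y) z = c *: f x z + f y z) ->
  (forall c x y z, f z (c *: x + y) = c *: f z x + f z y) ->
  exists2 g : T2 -> M, (forall c X Y, g (c *: X + Y) = c *: g X + g Y) &
    forall x y, g (tprod x y) = f x y.
Proof.
move=> fl fr; exists (mlin (fun p : W * W => f (mon p.1) (mon p.2))).
  by move=> c X Y; apply: mlinP.
move=> x y; move: x; apply: tens_ext => [c x z|c x z|s].
- by rewrite tprod_linl mlinP.
- exact: fl.
move: y; apply: tens_ext => [c x z|c x z|t].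
- by rewrite tprod_linr mlinP.
- exact: fr.
by rewrite tprod_mon mlinU.
Qed.

Definition tmul_word (p q : W * W) : T2 :=
  tprod (mon p.1 * tact (wdeg p.2) (mon q.1)) (mon p.2 * mon q.2).

Lemma tmulE (X Y : T2) : tmul X Y = mlin (fun p => mlin (tmul_word p) Y) X.
Proof.
rewrite /tmul /mlin; apply: eq_bigr => p _; rewrite scaler_sumr.
by apply: eq_bigr => q _; rewrite scalerA.
Qed.

Definition tshift (c : P) (X : T2) : T2 :=
  tmul (tprod (mon [:: c]) 1 + tprod 1 (mon [:: c])) X.

Lemma tshiftE c X : tshift c X =
  mlin (tmul_word (FMonom [:: c], FMonom [::])) X +
  mlin (tmul_word (FMonom [::], FMonom [:: c])) X.
Proof.
have e1 : tprod (mon [:: c]) 1 = << (FMonom [:: c], FMonom [::]) >> :> T2.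
  exact (etrans (congr1 (tprod (mon [:: c])) (esym (mon_nil R S))) (tprod_mon _ _)).
have e2 : tprod 1 (mon [:: c]) = << (FMonom [::], FMonom [:: c]) >> :> T2.
  exact (etrans (congr1 (fun a => tprod a (mon [:: c])) (esym (mon_nil R S))) (tprod_mon _ _)).
rewrite /tshift tmulE e1 e2; set f := fun p => _.
exact (etrans (map_linD (mlinP f) _ _) (congr2 +%R (mlinU f _) (mlinU f _))).
Qed.

Lemma tshift_linear c k X Y : tshift c (k *: X + Y) = k *: tshift c X + tshift c Y.
Proof.
rewrite (tshiftE c (k *: X + Y)) (tshiftE c X) (tshiftE c Y).
exact (add_linear (mlinP _) (mlinP _) k X Y).
Qed.

Lemma tshift_tprod c (x y : T) : tshift c (tprod x y) =
  tprod (mon [:: c] * x) y + tprod (tact (wrefl (val c)) x) (mon [:: c] * y).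
Proof.
rewrite tshiftE; congr (_ + _).
  move: x; apply: tens_ext => [k x z|k x z|s].
  - by rewrite tprod_linl mlinP.
  - by rewrite tens_mulP tprod_linl.
  move: y; apply: tens_ext => [k x z|k x z|t].
  - by rewrite tprod_linr mlinP.
  - exact: tprod_linr.
  have ew : wdeg ([::] : seq P) = 1%g by rewrite /wdeg big_nil.
  have e : tact (wdeg ([::] : seq P)) (mon s) = mon s :> T.
    rewrite ew; exact (act_id hS (T := FB) (mon s)).
  have e2 : mon [::] * mon t = mon t :> T := monM [::] t.
  rewrite tprod_mon mlinU.
  exact (congr2 (@tprod R gT S) (congr1 ( *%R (mon [:: c])) e) e2).
move: x; apply: tens_ext => [k x z|k x z|s].
- by rewrite tprod_linl mlinP.
- by rewrite tact_linear tprod_linl.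
move: y; apply: tens_ext => [k x z|k x z|t].
- by rewrite tprod_linr mlinP.
- by rewrite tens_mulP tprod_linr.
have e (u : T) : mon [::] * u = u.
  exact (etrans (congr1 (fun a : T => a * u) (mon_nil R S)) (mul1r u)).
have ew : wdeg [:: c] = wrefl (val c) by rewrite /wdeg big_seq1 wrefl.unlock.
have e1 : mon [::] * tact (wdeg [:: c]) (mon s) = tact (wrefl (val c)) (mon s).
  rewrite ew; exact (e _).
rewrite tprod_mon mlinU.
exact (congr1 (fun a : T => tprod a (mon [:: c] * mon t)) e1).
Qed.

Lemma coprod_linear c (x y : T) : coprod (c *: x + y) = c *: coprod x + coprod y.
Proof. exact: mlinP. Qed.

Lemma coprod_mon (s : seq P) :
  coprod (mon s) = foldr (@tshift) (tprod 1 1) s :> T2.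
Proof. exact: mlinU. Qed.

Lemma coprod_one : coprod (1 : T) = tprod 1 1.
Proof. by rewrite -[X in coprod X]mon_nil coprod_mon. Qed.

Lemma coprod_genM c (t : T) : coprod (mon [:: c] * t) = tshift c (coprod t).
Proof.
move: t; apply: tens_ext => [k x y|k x y|s].
- by rewrite tens_mulP coprod_linear.
- by rewrite coprod_linear tshift_linear.
by rewrite monM !coprod_mon.
Qed.

Definition free_square : braided_square FB :=
  @BraidedSquare R gT S FB T2 (@tprod R gT S) tshift (@coprod R gT S)
    tprod_linl tprod_linr tprod_span tprod_lift tshift_linear tshift_tprod
    coprod_linear coprod_one coprod_genM.

End FreeBraidedSquare.

(** * The Nichols algebra *)

Section NicholsIdeal.

Variables (R : realType) (gT : finGroupType) (S : {set gT}).
Hypothesis hS : coxeter_system S.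

Local Notation C := R[i].
Local Notation h := 'cV[R]_#|S|.
Local Notation P := (proot R S).
Local Notation T := (tensalg R S).
Local Notation T2 := (tens2 R S).
Local Notation FB := (free_braided R hS).
Local Notation FS := (free_square R hS).
Local Notation eps_deriv := (@eps_deriv R gT S FB).

Lemma mon_prod (s : seq P) : \prod_(a <- s) (@br_gen R gT S FB a) = mon s :> T.
Proof.
elim: s => [|a s IH]; first by rewrite big_nil mon_nil.
by rewrite big_cons IH; apply: (monM [:: a] s).
Qed.

Lemma root_word_mon (s : seq P) : root_word FB (map val s) = mon s :> T.
Proof.
rewrite /root_word big_map -[RHS]mon_prod; apply: eq_bigr => a _.
exact: (br_xroot_val FB a).
Qed.

Lemma homog_linear m c (x y : T) : homog m (c *: x + y) = c *: homog m x + homog m y.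
Proof. exact: mlinP. Qed.

Lemma homog_mon m (s : seq P) : homog m (mon s) = (if size s == m then mon s else 0) :> T.
Proof. exact: mlinU. Qed.

Lemma bfactE m (t : T) : bfact m t = br_fact (T := FB) m t.
Proof. by case: m. Qed.

Lemma bfact0 m : bfact m (0 : T) = 0.
Proof. exact (map_lin0 (@bfact_linear R gT S m)). Qed.

(** By linearity it suffices to take a monomial, where [coef_fact_strands] applies; a mismatch of
    degrees gives zero on both sides. *)
Lemma word_coef_fact l m (t : T) :
  word_coef l (bfact m (homog m t)) = (size l == m)%:R * eps_deriv l t.
Proof.
move: t; apply: (@tens_ext R gT S C^o) => [k x y|k x y|s].
- by rewrite homog_linear bfact_linear word_coef_linear.
- by rewrite (eps_derivP (T := FB)) mulrDr mulrCA.
rewrite homog_mon; case: s => [|a s].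
  have eb b k : eps_deriv (b :: k) (1 : T) = 0.
    by rewrite eps_deriv_cons br_deriv1 (eps_deriv0 FB k).
  have e1 : eps_deriv [::] (1 : T) = 1 by exact: (br_eps1 FB).
  rewrite mon_nil; case: (size [::] =P m) => [<-|/eqP/negPf nm].
    rewrite -[bfact _ _]/(1 : T) -(mon_nil R S) word_coef_mon mon_nil.
    by case: l => [|b l]; rewrite ?eb ?mulr0 // e1 mulr1.
  rewrite bfact0 (map_lin0 (V := C^o) (word_coef_linear l)).
  by case: l => [|b l]; rewrite ?eb ?mulr0 // nm mul0r.
(* The default letter [a] makes [f] root-valued on all naturals; this is why the empty word was
   treated separately. *)
pose f i : h := val (nth a (a :: s) i).
have rf i : wroot (f i) by apply: proot_root.
have es : mon (a :: s) = root_word FB (map f (iota 0 (size (a :: s)))) :> T.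
  rewrite -root_word_mon; congr (root_word FB _).
  by rewrite -[in LHS](mkseq_nth a (a :: s)) /mkseq -map_comp.
case: (size (a :: s) =P m) => [<-|ne].
  rewrite es bfactE; have := coef_fact_strands hS FB rf l (size (a :: s)).
  move=> e; rewrite -[LHS]/(br_coef (b := FB) l _) e.
  case: (size l =P size (a :: s)) => [_|/eqP ne]; first by rewrite mul1r.
  by rewrite mul0r; apply: eps_deriv_size.
rewrite bfact0 (map_lin0 (V := C^o) (word_coef_linear l)).
case: (size l =P m) => [el|_]; last by rewrite mul0r.
rewrite mul1r es (eps_deriv_size hS FB rf) //.
by apply/eqP => e; apply: ne; rewrite -e.
Qed.

Lemma nkerP (t : T) : t \in @nker R gT S <-> null (T := FB) t.
Proof.
split=> [/asboolP ht l|ht]; last first.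
  apply/asboolP => m; apply/malgP => -[l].
  rewrite -[LHS]/(word_coef l _) word_coef_fact ht mulr0.
  exact: esym (mcoeff0 _).
have := word_coef_fact l (size l) t.
by rewrite ht (map_lin0 (V := C^o) (word_coef_linear l)) eqxx mul1r.
Qed.

Lemma nker2P (X : T2) : X \in @nker2 R gT S <-> null2 (T2 := FS) X.
Proof.
split=> [/asboolP[l [/allP hl ->]]|[l hl ->]].
  by exists l => // p /hl /orP[] /nkerP; [left | right].
apply/asboolP; exists l; split=> //; apply/allP => p /hl.
by case=> /nkerP h; rewrite h ?orbT.
Qed.

End NicholsIdeal.

Lemma sum_support (V : nmodType) (I : finType) (Q : pred I) (F G : I -> V) :
  (forall i, Q i -> F i = G i) -> (forall i, ~~ Q i -> F i = 0) ->
  \sum_i F i = \sum_(i | Q i) G i.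
Proof.
move=> FG F0; rewrite (bigID Q) /= [X in _ + X]big1 // addr0.
exact: eq_bigr.
Qed.

(** * Skew elements in the Nichols algebra *)

Section NicholsSkew.

Variables (R : realType) (gT : finGroupType) (S : {set gT}).
Hypothesis hS : coxeter_system S.

Local Notation T := (tensalg R S).
Local Notation T2 := (tens2 R S).
Local Notation FB := (free_braided R hS).
Local Notation FS := (free_square R hS).
Local Notation rw := (redword (@sref gT S)).
Local Notation w0 := (longest S).
Local Notation skew w v := (@skew_word R gT S FB (rw w) v : T).
Local Notation xred v := (@xword R gT S FB (rw v) : T).
Local Notation N := (nichols R S).

Lemma npi_null (t u : T) : npi t = npi u <-> null (T := FB) (t - u).
Proof. by rewrite npi_eq; apply: nkerP. Qed.

Lemma npi0 : npi (0 : T) = 0 :> N.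
Proof. by apply: (addrI (npi 0)); rewrite -npiD !addr0. Qed.

Lemma npi2_eq (X Y : T2) : npi2 X = npi2 Y <-> X - Y \in @nker2 R gT S.
Proof.
by rewrite /npi2; split=> [/eqP|h]; [|apply/eqP]; rewrite -Quotient.idealrBE.
Qed.

Lemma npi2D : {morph @npi2 R gT S : X Y / X + Y}.
Proof. by move=> X Y; rewrite /npi2 !piE. Qed.

Lemma npi2_0 : npi2 (0 : T2) = 0.
Proof. by apply: (addrI (npi2 0)); rewrite -npi2D !addr0. Qed.

Lemma null_repr (t : T) : null (T := FB) (generic_quotient.repr (npi t) - t).
Proof. by apply/npi_null; apply: npi_surj. Qed.

Lemma tprod_null_l (x y : T) : null (T := FB) x -> tprod x y \in @nker2 R gT S.
Proof.
move=> nx; apply/(nker2P hS); exists [:: (x, y)]; last by rewrite big_seq1.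
by move=> p; rewrite inE => /eqP ->; left.
Qed.

Lemma tprod_null_r (x y : T) : null (T := FB) y -> tprod x y \in @nker2 R gT S.
Proof.
move=> ny; apply/(nker2P hS); exists [:: (x, y)]; last by rewrite big_seq1.
by move=> p; rewrite inE => /eqP ->; right.
Qed.

Lemma tprodBl (x y z : T) : tprod (x - y) z = tprod x z - tprod y z :> T2.
Proof. exact (etrans (tensDl FS z x (- y)) (congr1 (+%R (tprod x z)) (tensNl FS y z))). Qed.

Lemma tprodBr (x y z : T) : tprod z (x - y) = tprod z x - tprod z y :> T2.
Proof.
rewrite -[- y]scaleN1r; exact (etrans (tensDr FS z x (-1 *: y))
  (congr1 (+%R (tprod z x)) (etrans (tensZr FS (-1) y z) (scaleN1r _)))).
Qed.

Lemma ntens_npi_r (x : N) (t : T) :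
  ntens x (npi t) = npi2 (tprod (generic_quotient.repr x) t).
Proof.
apply/npi2_eq; rewrite -tprodBr; apply: tprod_null_r; exact: null_repr.
Qed.

Lemma ntens_npi (s t : T) : ntens (npi s) (npi t) = npi2 (tprod s t).
Proof.
rewrite ntens_npi_r; apply/npi2_eq; rewrite -tprodBl; apply: tprod_null_l.
exact: null_repr.
Qed.

(** The coproduct descends: it sends the ideal to the ideal of the tensor square, by [null2_cop]. *)
Lemma ncoprod_npi (t : T) : ncoprod (npi t) = npi2 (coprod t).
Proof.
apply/npi2_eq; set u := generic_quotient.repr _.
have -> : coprod u - coprod t = coprod (u - t).
  have cP := @coprod_linear R gT S.
  exact (esym (etrans (map_linD cP u (- t)) (congr1 (+%R (coprod u)) (map_linN cP t)))).
apply/(nker2P hS); exact: (null2_cop hS FS (null_repr t)).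
Qed.

Lemma nsbar_npi (t : T) : nsbar (npi t) = npi (tsbar t).
Proof.
apply/npi_null; set u := generic_quotient.repr _.
have -> : tsbar u - tsbar t = tsbar (u - t).
  have cP := @tsbar_linear R gT S.
  exact (esym (etrans (map_linD cP u (- t)) (congr1 (+%R (tsbar u)) (map_linN cP t)))).
by move=> l; rewrite (eps_deriv_bar hS (T := FB)); apply: null_repr.
Qed.

Lemma npi2_sum (I : Type) (r : seq I) (F : I -> T2) :
  npi2 (\sum_(i <- r) F i) = \sum_(i <- r) npi2 (F i).
Proof. exact: (big_morph _ npi2D npi2_0). Qed.

Lemma npi_skew_bruhat w v : ~~ bruhat S v w -> npi (skew w v) = 0 :> N.
Proof.
move=> nb; rewrite -npi0; apply/npi_null => l; rewrite subr0.
exact: (skew_bruhat hS FB l nb).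
Qed.

Lemma ntens0 (x : N) (v : gT) : x = 0 -> ntens x (xw R S v) = 0.
Proof.
move=> ->; rewrite -npi0 -[xw R S v]/(npi (xred v)) ntens_npi -npi2_0.
apply/npi2_eq; rewrite subr0; apply: tprod_null_l => l.
exact: (eps_deriv0 FB l).
Qed.

Lemma skew_family_sum w (y : {ffun gT -> N}) : skew_family w y ->
  ncoprod (xw R S w) = \sum_v ntens (y v) (xw R S v).
Proof.
move=> [e y0]; apply: etrans e (esym _).
by apply: sum_support => // v /y0; apply: ntens0.
Qed.

Lemma ncoprod_xw w : ncoprod (xw R S w) = \sum_v ntens (npi (skew w v)) (xw R S v).
Proof.
have := null2_cop_xword hS FS (rw w) => /(nker2P hS)/npi2_eq e.
rewrite -[xw R S w]/(npi (xred w)) ncoprod_npi; apply: etrans e _.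
rewrite npi2_sum; apply: eq_bigr => v _.
by rewrite -[xw R S v]/(npi (xred v)) ntens_npi.
Qed.

Lemma skew_family_npi w : skew_family w [ffun v => npi (skew w v)].
Proof.
split; last by move=> v nb; rewrite ffunE npi_skew_bruhat.
apply: etrans (ncoprod_xw w) _; apply: sum_support => v nb; first by rewrite ffunE.
exact: ntens0 (npi_skew_bruhat nb).
Qed.

(** The differences between representatives of [y] and the lifts give a null sum against the x_v, so
    each difference is null by [null2_unique]. *)
Lemma skew_family_unique w y : skew_family w y -> y = [ffun v => npi (skew w v)].
Proof.
move=> /skew_family_sum e; apply/ffunP => v; rewrite ffunE.
pose z u : T := generic_quotient.repr (y u) - skew w u.
suff nz : null (T := FB) (z v).
  by rewrite -[LHS]npi_surj; apply/npi_null.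
apply: (null2_unique hS (T2 := FS) (y := z)); apply/(nker2P hS).
have e1 : npi2 (\sum_u tprod (generic_quotient.repr (y u)) (xred u)) = ncoprod (xw R S w).
  apply: etrans (npi2_sum _ _) _; rewrite e; apply: eq_bigr => u _.
  exact: esym (ntens_npi_r _ _).
have e2 : npi2 (\sum_u tprod (skew w u) (xred u)) = ncoprod (xw R S w).
  apply: etrans (npi2_sum _ _) _; rewrite ncoprod_xw; apply: eq_bigr => u _.
  exact: esym (ntens_npi _ _).
have es : \sum_u tprod (z u) (xred u) =
    \sum_u tprod (generic_quotient.repr (y u)) (xred u) - \sum_u tprod (skew w u) (xred u).
  apply: etrans (sumrB _ _ _ _); apply: eq_bigr => u _; exact: tprodBl.
have := etrans e1 (esym e2) => /npi2_eq; rewrite -es; exact.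
Qed.

(** Existence and uniqueness of the skew family make the choice in its definition harmless and
    reduce the theorem to statements about lifts. *)
Lemma xskewE w v : xskew R S w v = npi (skew w v).
Proof.
rewrite /xskew (xget_unique _ (skew_family_npi w)) ?ffunE // => y.
exact: skew_family_unique.
Qed.

Lemma xskew_longest w v :
  xskew R S w v = nsbar (xskew R S (v * w0)%g (w * w0)%g).
Proof.
rewrite !xskewE nsbar_npi; apply/npi_null => l.
have := eps_deriv_skew_longest hS FB l w v.
rewrite (eps_derivD (T := FB)) (eps_derivN (T := FB)) => ->; exact: subrr.
Qed.

Lemma xskew_positive w v : npositive (xskew R S w v).
Proof.
rewrite xskew_longest xskewE nsbar_npi.
have [|l e] := positive_bar_skew hS FB (g := 1%g) (s := rw (v * w0)%g) (w * w0)%g.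
  by rewrite mul1g (rwK hS) len1.
have e' : tsbar (skew (v * w0)%g (w * w0)%g) =
    \sum_(p <- l) (\prod_(a <- p.2) @br_gen R gT S FB a : T) *+ p.1.
  exact (etrans (esym (act_id hS (T := FB) _)) e).
have npiMn (t : T) k : npi (t *+ k) = npi t *+ k :> N.
  by elim: k => [|k IH]; [rewrite !mulr0n npi0 | rewrite !mulrS npiD IH].
exists l; rewrite e' (big_morph _ (@npiD R gT S) npi0); apply: eq_bigr => p _.
by rewrite npiMn (mon_prod hS).
Qed.

End NicholsSkew.

Theorem theorem6p11 (R : realType) (gT : finGroupType) (S : {set gT})
    (hS : coxeter_system S) (v w : gT) (hvw : bruhat S v w) :
  xskew R S w v =
    nsbar (xskew R S (v * longest S)%g (w * longest S)%g)
  /\ npositive (xskew R S w v).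
Proof. by split; [apply: xskew_longest | apply: xskew_positive]. Qed.
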